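(* Let $y:\Omega\to\mathbb{R}$ be uniformly bounded by $Y>0$, and let $$L^{TV}(u)=\int_{\Omega}u(x)^2-2u(x)y(x)+|\nabla u(x)|\,dx,\qquad L^{TV}_N(\phi)=\frac1N\sum_{i=1}^N\big(\phi(x_i)^2-2\phi(x_i)y(x_i)+|\nabla\phi(x_i)|\big),$$ where $x_1,\dots,x_N$ are i.i.d. sampled from $\Omega$. Let $\hat u=\arg\min_{u\in BV(\Omega)}L^{TV}(u)$, and let $\mathcal{F}^m_{\mathrm{SP}_\tau}(B)$ be the set of two-layer softplus networks of width $m$ with $B>0$ and $\tau=\sqrt m$. Assume that $\hat u$ belongs to the Barron space $\mathcal{B}(\Omega)$ and that $B>\|\hat u\|_{\mathcal{B}(\Omega)}$. Suppose $\hat\phi^N\in\mathcal{F}^m_{\mathrm{SP}_\tau}(B)$ is a $\delta$-minimizer of $L^{TV}_N$ over $\mathcal{F}^m_{\mathrm{SP}_\tau}(B)$, and let $0<\epsilon<1$. Then, with probability at least $1-\epsilon$ over the choice of $(x_1,\dots,x_N)$, $$L^{TV}(\hat\phi^N)-L^{TV}(\hat u)\le\big(2Y+49B+\|\hat u\|_{L^2(\Omega)}+1\big)\frac{\|\hat u\|_{\mathcal{B}(\Omega)}}{\sqrt m}\big(24\log(m)+65\big)+4\frac{\sqrt m}{\sqrt N}\big(Z_1+Z_2\sqrt{\log(m)}\big)+2M_1\frac{\sqrt{-2\log(\epsilon)}}{\sqrt N}+2\delta,$$ where $Z_1$ is a constant depending on $B$, $d$ and $Y$, $Z_2$ is a constant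 depending on $B$ and $d$, and $M_1$ is a constant depending on $B$ and $Y$; they are the constants of the quadrature estimate recalled in the context.
   Context: $\Omega\subset\mathbb{R}^d$ is a bounded domain. $BV(\Omega)$ is the space of functions of bounded variation on $\Omega$; the gradient in the total variation term is the distributional derivative. Softplus: $\mathrm{SP}_\tau(z)=\frac1\tau\log(1+e^{\tau z})$. Two-layer networks: for an activation $\sigma:\mathbb{R}\to\mathbb{R}$, $B>0$ and width $m$, $$\mathcal{F}^m_\sigma(B)=\Big\{\phi(x)=c+\frac1m\sum_{k=1}^m a_k\sigma(\omega_k\cdot x+b_k)\ :\ |c|\le2B,\ |a_k|\le16B,\ |\omega_k|_1=1,\ |b_k|\le1,\ k=1,\dots,m\Big\}.$$ Barron space: $f:\Omega\to\mathbb{R}$ belongs to $\mathcal{B}(\Omega)$ if there is an extension of $f$ to $\mathbb{R}^d$ with Fourier transform $\tilde f$ such that $f(x)=\int_{\mathbb{R}^d}e^{i\omega\cdot x}\tilde f(\omega)\,d\omega$ for $x\in\Omega$ and $\int_{\mathbb{R}^d}(1+|\omega|_1)^2|\tilde f(\omega)|\,d\omega<\infty$; $\|f\|_{\mathcal{B}(\Omega)}$ is the infimum of the latter integral over all such extensions. Here $|\cdot|_1$ is the $\ell^1$ norm on $\mathbb{R}^d$. For a functional $L$ on a set $W$, $\hat w\in W$ is a $\delta$-minimizer of $L$ over $W$ if $L(\hat w)\le\inf_{w\in W}L(w)+\delta$. Quadrature estimate defining the constants: for any $\epsilon\in(0,1)$, with probability at least $1-\epsilon$, $\sup_{\phi\in\mathcal{F}^m_{\mathrm{SP}_\tau}(B)}|L^{TV}_N(\phi)-L^{TV}(\phi)|\le2\frac{\sqrt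 m}{\sqrt N}(Z_1+Z_2\sqrt{\log(m)})+M_1\frac{\sqrt{-2\log(\epsilon)}}{\sqrt N}$.
   Formalization: The domain Ω is additionally assumed to lie in the cube [-1,1]^d; without this normalization (matching |ω_k|_1=1, |b_k|≤1) the bound fails, e.g. for Ω=(5,6), where the networks become nearly affine as m grows. *)

(* Defs.v *)
From HB Require Import structures.
From mathcomp Require Import all_boot all_order all_algebra.
From mathcomp Require Import complex.
From mathcomp Require Import all_classical all_reals all_analysis.

Set Implicit Arguments.
Unset Strict Implicit.
Unset Printing Implicit Defensive.

Import Order.TTheory GRing.Theory Num.Theory.
Import numFieldNormedType.Exports.
Local Open Scope classical_set_scope.
Local Open Scope ring_scope.

Definition rV_display : measure_display. Proof. exact. Qed.

(* As on n.-tuple R in the library, the sigma-algebra on 'rV[R]_n is the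
   product one, generated by the coordinates; it is the Borel sigma-algebra. *)
Section rV_measurable.
Context {R : realType} (n : nat).

Let coord (j : 'I_n) (v : 'rV[R]_n) : R := v 0 j.

Let rV_set0 : g_sigma_preimage coord set0.
Proof. exact: sigma_algebra0. Qed.

Let rV_setC A : g_sigma_preimage coord A -> g_sigma_preimage coord (~` A).
Proof. exact: sigma_algebraC. Qed.

Let rV_bigcup (F : (set 'rV[R]_n)^nat) :
  (forall i, g_sigma_preimage coord (F i)) ->
  g_sigma_preimage coord (\bigcup_i F i).
Proof. exact: sigma_algebra_bigcup. Qed.

HB.instance Definition _ := @isMeasurable.Build rV_display
  'rV[R]_n (g_sigma_preimage coord) rV_set0 rV_setC rV_bigcup.

End rV_measurable.

Section rV_measurable_lemmas.
Context {R : realType}.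

Lemma measurable_fun_coord n (j : 'I_n) :
  measurable_fun [set: 'rV[R]_n] (fun v : 'rV[R]_n => v 0 j).
Proof.
move=> _ Y mY; rewrite setTI; apply: sub_sigma_algebra => /=.
rewrite -bigcup_seq/=; exists j => /=; first by rewrite mem_index_enum.
by exists Y => //; rewrite setTI.
Qed.

Lemma measurable_fun_rVP d (T : measurableType d) n (f : T -> 'rV[R]_n) :
  (forall j, measurable_fun [set: T] (fun x => f x 0 j)) ->
  measurable_fun [set: T] f.
Proof.
move=> mf.
suff S : g_sigma_preimage (fun j x => f x 0 j) `<=` @measurable _ T.
  move=> _ A mA; apply: S; rewrite setTI.
  rewrite [X in X _](_ : _ = preimage_set_system [set: T] f
    (g_sigma_preimage (fun j (v : 'rV[R]_n) => v 0 j))); last first.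
    by rewrite -g_sigma_preimage_comp.
  by exists A => //; rewrite setTI.
apply: smallest_sub; first exact: sigma_algebra_measurable.
elim/big_ind: _ => [//|A B sA sB|j _]; first by rewrite subUset.
by move=> _ [B mB <-]; exact: mf.
Qed.

Definition rV_cons n (p : R * 'rV[R]_n) : 'rV[R]_n.+1 :=
  row_mx (p.1)%:M p.2 : 'rV[R]_(1 + n).

Definition rV_uncons n (v : 'rV[R]_n.+1) : R * 'rV[R]_n :=
  (v 0 0, @rsubmx _ 1 1 n v).

Lemma rV_consK n : cancel (@rV_cons n) (@rV_uncons n).
Proof.
move=> [x v]; rewrite /rV_uncons /rV_cons row_mxKr; congr (_, _) => /=.
have -> : (0 : 'I_n.+1) = @lshift 1 n 0 by exact/val_inj.
by rewrite (@row_mxEl _ 1 1 n) mxE.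
Qed.

Lemma measurable_rV_cons n : measurable_fun [set: R * 'rV[R]_n] (@rV_cons n).
Proof.
apply: measurable_fun_rVP => j.
have [k jk|k jk] := @splitP 1 n j.
- have -> : j = @lshift 1 n k by exact/val_inj.
  rewrite [X in measurable_fun _ X](_ : _ = fst)//.
  by apply/funext => -[x v]; rewrite /rV_cons (@row_mxEl _ 1 1 n) mxE ord1.
- have -> : j = @rshift 1 n k by exact/val_inj.
  rewrite [X in measurable_fun _ X](_ : _ =
      (fun v : 'rV[R]_n => v 0 k) \o snd); last first.
    by apply/funext => -[x v]; rewrite /rV_cons (@row_mxEr _ 1 1 n).
  by apply: measurableT_comp => //; exact: measurable_fun_coord.
Qed.

Lemma measurable_rV_uncons n : measurable_fun [set: 'rV[R]_n.+1] (@rV_uncons n).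
Proof.
apply/measurable_fun_pair; first exact: measurable_fun_coord.
apply: measurable_fun_rVP => j.
rewrite (_ : (fun x => _) = fun v : 'rV[R]_n.+1 => v 0 (rshift 1 j)).
  exact: measurable_fun_coord.
by apply/funext => v; rewrite mxE.
Qed.

End rV_measurable_lemmas.

Section rV_prod.
Context {R : realType} (n : nat).
Variable mu : {sigma_finite_measure set 'rV[R]_n -> \bar R}.

Definition rV_prod : set 'rV[R]_n.+1 -> \bar R :=
  pushforward ((@lebesgue_measure R) \x mu)%E (@rV_cons R n).

Let rV_prod0 : rV_prod set0 = 0%E.
Proof. by rewrite /rV_prod /pushforward preimage_set0 measure0. Qed.

Let rV_prod_ge0 A : (0 <= rV_prod A)%E.
Proof. by rewrite /rV_prod /pushforward; exact: measure_ge0. Qed.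

Let rV_prod_sigma_additive : semi_sigma_additive rV_prod.
Proof.
have mc := @measurable_rV_cons R n.
exact: (@measure_semi_sigma_additive _ _ _ (pushforward _ _)).
Qed.

HB.instance Definition _ := isMeasure.Build _ _ _ rV_prod
  rV_prod0 rV_prod_ge0 rV_prod_sigma_additive.

Let rV_prod_sigma_finite : sigma_finite setT rV_prod.
Proof.
have /sigma_finiteP[F [FT ndF Foo]] := sigma_finiteT (@lebesgue_measure R).
have /sigma_finiteP[G [GT ndG Goo]] := sigma_finiteT mu.
exists (fun k => @rV_uncons R n @^-1` (F k `*` G k)).
  rewrite -preimage_bigcup (_ : \bigcup_k _ = setT) ?preimage_setT//.
  apply/seteqP; split => // -[x v] _ /=.
  have [k _ Fkx] : (\bigcup_k F k) x by rewrite -FT.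
  have [l _ Glv] : (\bigcup_l G l) v by rewrite -GT.
  exists (maxn k l) => //; split => /=.
    by move: x Fkx; exact/subsetPset/ndF/leq_maxl.
  by move: v Glv; exact/subsetPset/ndG/leq_maxr.
move=> k; have [mF Fk] := Foo k; have [mG Gk] := Goo k; split.
  rewrite -[X in measurable X]setTI; apply: measurable_rV_uncons => //.
  exact: measurableX.
rewrite /rV_prod /pushforward -comp_preimage.
rewrite [X in X @^-1` _](_ : _ = id); last by apply/funext => p; exact: rV_consK.
by rewrite product_measure1E// lte_mul_pinfty// ge0_fin_numE.
Qed.

HB.instance Definition _ := Measure_isSigmaFinite.Build _ _ _ rV_prod
  rV_prod_sigma_finite.

End rV_prod.

Fixpoint lebesgue_rV (R : realType) (n : nat) :
    {sigma_finite_measure set 'rV[R]_n -> \bar R} :=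
  match n with
  | 0 => \d_(0 : 'rV[R]_0)
  | k.+1 => rV_prod (lebesgue_rV R k)
  end.

Lemma lebesgue_rV_box (R : realType) n (A : 'I_n -> set R) :
  (forall j, measurable (A j)) ->
  (lebesgue_rV R n [set v : 'rV[R]_n | forall j, A j (v 0%R j)] =
   \big[*%E/1%E]_(j < n) (@lebesgue_measure R (A j)))%E.
Proof.
elim: n A => [|n IHn] A mA.
  by rewrite big_ord0 /= diracE mem_set//= => -[].
rewrite big_ord_recl -(IHn (fun j => A (lift ord0 j)))// -product_measure1E//.
- rewrite /= /rV_prod /pushforward; congr (_ _).
  apply/seteqP; split => -[x v] /=.
  + move=> Axv; split.
    * have := Axv ord0; rewrite /rV_cons.
      have -> : (ord0 : 'I_n.+1) = @lshift 1 n 0 by exact/val_inj.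
      by rewrite (@row_mxEl _ 1 1 n) mxE.
    * move=> j; have := Axv (lift ord0 j); rewrite /rV_cons.
      have -> : lift ord0 j = @rshift 1 n j by exact/val_inj.
      by rewrite (@row_mxEr _ 1 1 n).
  + move=> [Ax Av] j; rewrite /rV_cons.
    case: (unliftP ord0 j) => [k ->|->].
      have := Av k.
      have -> : lift ord0 k = @rshift 1 n k by exact/val_inj.
      by rewrite (@row_mxEr _ 1 1 n).
    move: Ax; have -> : (ord0 : 'I_n.+1) = @lshift 1 n 0 by exact/val_inj.
    by rewrite (@row_mxEl _ 1 1 n) mxE.
- exact: mA.
- rewrite [X in measurable X](_ : _ =
    \big[setI/setT]_(j < n) ((fun v : 'rV[R]_n => v 0 j) @^-1` A (lift ord0 j))).
    apply: bigsetI_measurable => j _; rewrite -[X in measurable X]setTI.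
    exact: measurable_fun_coord.
  rewrite -bigcap_seq; apply/seteqP; split => [v Av j _|v Av j].
    exact: Av.
  by apply: (Av j); rewrite /= mem_index_enum.
Qed.

Section euclidean_space.
Context {R : realType} {d : nat}.
Implicit Types x v w : 'rV[R]_d.

Definition dotrV w x : R := \sum_(j < d) w 0 j * x 0 j.

(* the norm `|x| of the library on 'rV[R]_d is the sup norm *)
Definition l1norm w : R := \sum_(j < d) `|w 0 j|.

Definition l2norm v : R := Num.sqrt (\sum_(j < d) v 0 j ^+ 2).

Definition partial (j : 'I_d) (f : 'rV[R]_d -> R) : 'rV[R]_d -> R :=
  fun x => 'D_(delta_mx 0 j) f x.

Definition gradient (f : 'rV[R]_d -> R) x : 'rV[R]_d :=
  \row_(j < d) partial j f x.

Definition bounded_domain (Omega : set 'rV[R]_d) : Prop :=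
  [/\ Omega !=set0, open Omega, connected Omega & bounded_set Omega].

End euclidean_space.

Section bounded_variation.
Context {R : realType} {d : nat}.
Variable Omega : set 'rV[R]_d.
Let mu := lebesgue_rV R d.

(* C^1 vector fields with compact support in Omega, bounded by 1 *)
Definition test_field (p : 'rV[R]_d -> 'rV[R]_d) : Prop :=
  let supp := closure [set x | p x != 0] in
  [/\ forall i j x, derivable (fun z => p z 0 i) x (delta_mx 0 j),
      forall i j, continuous (partial j (fun z => p z 0 i)),
      compact supp /\ supp `<=` Omega &
      forall x, l2norm (p x) <= 1].

Definition divergence (p : 'rV[R]_d -> 'rV[R]_d) (x : 'rV[R]_d) : R :=
  \sum_(j < d) partial j (fun z => p z 0 j) x.

(* |Du|(Omega), the total variation of the distributional derivative of u *)
Definition total_variation (u : 'rV[R]_d -> R) : \bar R :=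
  ereal_sup [set (\int[mu]_(x in Omega) (u x * divergence p x)%:E)%E
            | p in test_field].

Definition BV : set ('rV[R]_d -> R) :=
  [set u : _ -> R | mu.-integrable Omega (EFin \o u) /\ (total_variation u < +oo)%E].

Definition L2norm (u : 'rV[R]_d -> R) : R :=
  Num.sqrt (\int[mu]_(x in Omega) (u x ^+ 2)).

(* For bounded y, +oo on the elements of BV that are not in L^2. *)
Definition L_TV (y u : 'rV[R]_d -> R) : \bar R :=
  (\int[mu]_(x in Omega) (u x ^+ 2 - 2 * u x * y x)%:E + total_variation u)%E.

End bounded_variation.

Definition L_TV_emp {R : realType} {d N : nat} (y : 'rV[R]_d -> R)
    (x : 'I_N -> 'rV[R]_d) (phi : 'rV[R]_d -> R) : R :=
  N%:R^-1 * \sum_(i < N)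
    (phi (x i) ^+ 2 - 2 * phi (x i) * y (x i) + l2norm (gradient phi (x i))).

Definition is_argmin {R : realType} {T : Type} (L : T -> \bar R) (W : set T)
    (w : T) : Prop :=
  W w /\ forall v, W v -> (L w <= L v)%E.

Definition is_delta_minimizer {R : realType} {T : Type} (delta : R)
    (L : T -> R) (W : set T) (w : T) : Prop :=
  W w /\ ((L w)%:E <= ereal_inf [set (L v)%:E | v in W] + delta%:E)%E.

Definition softplus {R : realType} (tau z : R) : R :=
  tau^-1 * ln (1 + expR (tau * z)).

Definition two_layer {R : realType} (d : nat) (sigma : R -> R) (m : nat)
    (B : R) : set ('rV[R]_d -> R) :=
  [set phi | exists (c : R) (a : 'I_m -> R) (w : 'I_m -> 'rV[R]_d)
      (b : 'I_m -> R),
    [/\ `|c| <= 2 * B,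
        forall k, [/\ `|a k| <= 16 * B, l1norm (w k) = 1 & `|b k| <= 1] &
        forall x, phi x =
          c + m%:R^-1 * \sum_(k < m) a k * sigma (dotrV (w k) x + b k)]].

(* the class F^m_{SP_tau}(B) with tau = sqrt m *)
Definition softplus_nets {R : realType} (d m : nat) (B : R) :
    set ('rV[R]_d -> R) :=
  two_layer (softplus (Num.sqrt m%:R)) m B.
Arguments softplus_nets {R} d m B.

Section barron.
Local Open Scope complex_scope.
Context {R : realType} {d : nat}.
Let mu := lebesgue_rV R d.

Definition cexpi (t : R) : R[i] := cos t +i* sin t.

Definition cmeasurable (f : 'rV[R]_d -> R[i]) : Prop :=
  measurable_fun setT (fun w => complex.Re (f w)) /\
  measurable_fun setT (fun w => complex.Im (f w)).

Definition cintegral (f : 'rV[R]_d -> R[i]) : R[i] :=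
  (\int[mu]_w complex.Re (f w)) +i* (\int[mu]_w complex.Im (f w)).

Definition barron_weight (ft : 'rV[R]_d -> R[i]) : \bar R :=
  (\int[mu]_w ((1 + l1norm w) ^+ 2 * ComplexField.Normc.normc (ft w))%:E)%E.

(* fe extends f from Omega to R^d, and ft is its Fourier transform, with the
   normalization of the inversion formula fe(x) = \int e^{i w.x} ft(w) dw. *)
Definition barron_representation (Omega : set 'rV[R]_d) (f : 'rV[R]_d -> R)
    (fe ft : 'rV[R]_d -> R[i]) : Prop :=
  [/\ forall x, Omega x -> fe x = (f x)%:C,
      cmeasurable ft,
      (barron_weight ft < +oo)%E &
      forall x, fe x = cintegral (fun w => cexpi (dotrV w x) * ft w)].

Definition barron (Omega : set 'rV[R]_d) : set ('rV[R]_d -> R) :=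
  [set f | exists fe ft, barron_representation Omega f fe ft].

Definition barron_norm (Omega : set 'rV[R]_d) (f : 'rV[R]_d -> R) : R :=
  fine (ereal_inf
    [set barron_weight ft | ft in
       [set ft | exists fe, barron_representation Omega f fe ft]]).

End barron.

Section sampling.
Local Open Scope ereal_scope.
Context {disp : measure_display} {T : measurableType disp} {R : realType}
  (P : probability T R).

(* E itself need not be measurable *)
Definition with_prob_ge (p : R) (E : set T) : Prop :=
  exists A : set T, [/\ measurable A, A `<=` E & p%:E <= P A].

Definition independent_rVs (d N : nat) (X : 'I_N -> {RV P >-> 'rV[R]_d}) :
    Prop :=
  forall A : 'I_N -> set 'rV[R]_d, (forall i, measurable (A i)) ->
    P (\bigcap_i (X i @^-1` A i)) = \big[*%E/1%E]_(i < N) P (X i @^-1` A i).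

Definition uniform_on (d : nat) (Omega : set 'rV[R]_d)
    (X : {RV P >-> 'rV[R]_d}) : Prop :=
  (forall t, Omega (X t)) /\
  forall A, measurable A ->
    distribution P X A * lebesgue_rV R d Omega = lebesgue_rV R d (Omega `&` A).

Definition iid_sample (d N : nat) (Omega : set 'rV[R]_d)
    (X : 'I_N -> {RV P >-> 'rV[R]_d}) : Prop :=
  independent_rVs X /\ forall i, uniform_on Omega (X i).

End sampling.

Definition quadrature_bound {R : realType} (Z1 Z2 M1 eps : R) (m N : nat) : R :=
  2 * (Num.sqrt m%:R / Num.sqrt N%:R) * (Z1 + Z2 * Num.sqrt (ln m%:R))
  + M1 * (Num.sqrt (- 2 * ln eps) / Num.sqrt N%:R).

(* What the constants Z1, Z2, M1 are required to satisfy; they do not depend on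
   the width, the sample (hence on N) or the confidence level.  Letting N tend
   to infinity with constant networks, the estimate forces lebesgue_rV R d Omega
   to be 1, the sample being uniform and L_TV not being averaged over Omega. *)
Definition quadrature_estimate {R : realType} {d : nat} (Omega : set 'rV[R]_d)
    (y : 'rV[R]_d -> R) (B Z1 Z2 M1 : R) : Prop :=
  forall (disp : measure_display) (T : measurableType disp)
    (P : probability T R) (m N : nat) (X : 'I_N -> {RV P >-> 'rV[R]_d})
    (eps : R),
  (0 < m)%N -> (0 < N)%N -> iid_sample Omega X -> 0 < eps < 1 ->
  with_prob_ge P (1 - eps) [set t |
    (ereal_sup [set `| (L_TV_emp y (fun i => X i t) phi)%:E - L_TV Omega y phi |
               | phi in softplus_nets d m B]
     <= (quadrature_bound Z1 Z2 M1 eps m N)%:E)%E].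

(* Main.v *)
(** Maurey's sampling argument, made deterministic.  Write the Barron
    representation of [uhat] as [c + f], where [f] is an average of ridge functions
    [h (w . x)] with [|w|_1 = 1].  On [-1, 1], Taylor's formula with integral
    remainder writes [h] as an average of ReLU ridges, and replacing ReLU by
    softplus costs [O (1 / tau)] both in [h] and in [h'].  In the space of pairs
    (function, gradient) with the L^2 inner product over [Omega], this says that
    [f] lies, up to [O (1 / tau)], in the closed convex hull of the bounded set of
    neurons; so, neurons being chosen one after the other, each can be taken with an
    almost nonpositive inner product against the accumulated error, whose squared
    norm then grows linearly.  With [tau = sqrt m] this gives an H^1 error of order
    [|uhat|_B / sqrt m].

    The gradient of [f] is only used weakly: testing [f] against a compactly
    supported C^1 field reduces by Fubini to testing each ridge function.  Finally
    the quadrature estimate, applied to the constant networks [2 B] and [- 2 B] with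
    the sample size tending to infinity, forces [Omega] to have measure 1, and its
    application to the given sample compares the empirical and exact energies. *)

Require Import Defs.
From HB Require Import structures.
From mathcomp Require Import all_boot all_order all_algebra.
From mathcomp Require Import complex.
From mathcomp Require Import all_classical all_reals all_analysis.
From mathcomp Require Import measurable_realfun.
From mathcomp Require Import ring lra.
Import Order.TTheory GRing.Theory Num.Theory.
Import numFieldNormedType.Exports.
Local Open Scope classical_set_scope.
Local Open Scope ring_scope.

Set Implicit Arguments.
Unset Strict Implicit.
Unset Printing Implicit Defensive.

(** * Measurability and directional derivatives on R^d *)

(** The convex hull is never built: it enters through its support function. The pairing of [f] with
    any weights is at most W times twice the largest pairing with a neuron of amplitude 1, up to
    O(1/tau) times the L^1 size of the weights; if no neuron were suitable, this inequality would
    contradict itself. The radius is 2 W because the linear Taylor term costs two opposite neurons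
    and the biases fill an interval of length 2; amplitude 3 W leaves slack. The softplus error is
    proportional to the accumulated error, of order W sqrt m, so with tau = sqrt m each step adds
    only a multiple of W^2. A growth of K^2 W^2 per neuron is consistent once 6 K + 137 <= K^2; K =
    17 is taken, whence the error 17 W / tau. The infimum defining the Barron norm need not be
    attained: the bounds are proved for each W strictly between the norm and B, and W decreases to
    the norm at the very end. Measure 1 turns L^2 bounds into L^1 bounds at no cost. *)

Section rV_topology.
Context {R : realType} {n : nat}.
Implicit Types U : set 'rV[R]_n.

Lemma rV_ballP (x y : 'rV[R]_n) (e : R) : 0 < e ->
  ball x e y <-> forall j, `|x 0 j - y 0 j| < e.
Proof.
move=> e0; split=> [[_ xy] j|xy]; first exact: xy.
by split => // i j; rewrite ord1; exact: xy.
Qed.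

Lemma rV_norm_le (x : 'rV[R]_n) (r : R) : 0 <= r ->
  (forall j, `|x 0 j| <= r) -> `|x| <= r.
Proof.
move=> r0 xr; rewrite [leLHS]/Num.norm/= mx_normrE; apply/bigmax_leP; split => //.
by move=> [i j] _ /=; rewrite ord1.
Qed.

Lemma rV_coord_le (x : 'rV[R]_n) j : `|x 0 j| <= `|x|.
Proof.
rewrite [leRHS]/Num.norm/= mx_normrE.
exact: (@le_bigmax _ _ _ _ (fun ij => `|x ij.1 ij.2|) (0, j)).
Qed.

Lemma measurable_rV_box (A : 'I_n -> set R) : (forall j, measurable (A j)) ->
  measurable [set v : 'rV[R]_n | forall j, A j (v 0 j)].
Proof.
move=> mA; rewrite [X in measurable X](_ : _ =
  \big[setI/setT]_(j < n) ((fun v : 'rV[R]_n => v 0 j) @^-1` A j)).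
  apply: bigsetI_measurable => j _; rewrite -[X in measurable X]setTI.
  exact: measurable_fun_coord.
rewrite -bigcap_seq; apply/seteqP; split => [v Av j _|v Av j]; first exact: Av.
by apply: (Av j); rewrite /= mem_index_enum.
Qed.

Lemma measurable_rV_ball (x : 'rV[R]_n) (e : R) : measurable (ball x e).
Proof.
have [e0|e0] := ltP 0 e; last first.
  rewrite (_ : ball x e = set0)//; apply/seteqP; split => // y [].
  by rewrite ltNge e0.
rewrite (_ : ball x e = [set y : 'rV[R]_n | forall j, ball (x 0 j) e (y 0 j)]).
  apply: (measurable_rV_box (A := fun j => ball (x 0 j) e)) => j.
  by apply: open_measurable; exact: ball_open.
apply/seteqP; split => y /= xy; first by move=> j; move/(rV_ballP _ _ e0): xy; exact.
by apply/rV_ballP => // j; exact: xy.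
Qed.

(** The topology is that of the sup norm, the sigma-algebra that of the coordinates; an open set is
    the countable union of the balls of rational centre and radius that it contains. *)
Lemma open_rV_measurable U : open U -> measurable U.
Proof.
move=> oU.
pose F (p : 'rV[rat]_n * rat) : set 'rV[R]_n :=
  if `[< ball (map_mx ratr p.1 : 'rV[R]_n) (ratr p.2) `<=` U >]
  then ball (map_mx ratr p.1 : 'rV[R]_n) (ratr p.2) else set0.
rewrite (_ : U = \bigcup_p F p).
  apply: countable_bigcupT_measurable; first exact: countableP.
  by move=> p; rewrite /F; case: ifPn => // _; exact: measurable_rV_ball.
apply/seteqP; split => [x Ux|x [p _]]; last first.
  by rewrite /F; case: ifPn => // /asboolP; exact.
move: oU; rewrite openE => /(_ _ Ux); rewrite /interior => /nbhs_ballP[e /= e0 eU].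
(* With radius below [e / 2], a ball of radius [r] whose centre is within [r] of [x] stays inside
   [ball x e]. *)
have [r /andP[r0 re]] : exists r : rat, 0 < (ratr r : R) < e / 2.
  have /rat_in_itvoo[r] : 0 < e / 2 by rewrite divr_gt0.
  by rewrite in_itv/=; exists r.
have /choice[c cx] : forall j, exists c : rat, `|(ratr c : R) - x 0 j| < ratr r.
  move=> j; have /rat_in_itvoo[c] : x 0 j - ratr r < x 0 j + ratr r by lra.
  by rewrite in_itv/= => cj; exists c; rewrite ltr_norml; lra.
exists (\row_j c j, r) => //; rewrite /F ifT/=.
  by apply/rV_ballP => // j; rewrite !mxE; exact: cx.
apply/asboolP => z /(rV_ballP _ _ r0) zc; apply: eU.
apply/rV_ballP => // j; move: (zc j) (cx j); rewrite !mxE !ltr_norml; lra.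
Qed.

Lemma continuous_rV_measurable (f : 'rV[R]_n -> R) : continuous f ->
  measurable_fun setT f.
Proof.
move=> /continuousP cf; apply: (measurability _ (RGenOpens.measurableE R)).
move=> _ [_ [a [b ->] <-]]; rewrite setTI; apply: open_rV_measurable.
exact/cf/interval_open.
Qed.

Lemma lebesgue_rV_bounded (D : set 'rV[R]_n) (r : R) : measurable D ->
  (forall x, D x -> forall j, `|x 0 j| <= r) -> (lebesgue_rV R n D < +oo)%E.
Proof.
move=> mD Dr; pose I : set R := `[- r, r]%classic.
pose B := [set v : 'rV[R]_n | forall j, I (v 0 j)].
have mB : measurable B.
  by apply: (measurable_rV_box (A := fun=> I)) => j; exact: measurable_itv.
apply: (@le_lt_trans _ _ (lebesgue_rV R n B)).
  apply: le_measure; rewrite ?inE//.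
  move=> x Dx j; rewrite /I/=.
  by rewrite in_itv/= -ler_norml; exact: Dr.
rewrite (lebesgue_rV_box (A := fun=> I)); last by move=> j; exact: measurable_itv.
suff /andP[] : (0 <= \big[*%E/1%E]_(j < n)
    lebesgue_measure I < +oo)%E by [].
elim/big_ind : _ => [|a b /andP[a0 ay] /andP[b0 bY]|j _].
- by rewrite lee01 ltry.
- by rewrite mule_ge0// lte_mul_pinfty// ge0_fin_numE.
- rewrite measure_ge0 lebesgue_measure_itv/=.
  by case: ifP; rewrite ?ltry.
Qed.

End rV_topology.

(** * Directional derivatives under affine substitution *)

Section directional.
Context {R : realType}.

(* Both sides are limits of the same difference quotient. *)
Lemma derive_along (V W : normedModType R) (U : normedModType R)
    (phi : V -> W) (F : W -> U) (x v : V) (w : W) :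
  (forall h : R, phi (h *: v + x) = h *: w + phi x) ->
  'D_v (F \o phi) x = 'D_w F (phi x).
Proof.
move=> phiE; rewrite /derive; set g1 := (fun _ => _); set g2 := (fun _ => _).
by suff -> : g1 = g2 by []; apply/funext => h; rewrite /g1 /g2 /= phiE.
Qed.

Lemma derivable_along (V W : normedModType R) (U : normedModType R)
    (phi : V -> W) (F : W -> U) (x v : V) (w : W) :
  (forall h : R, phi (h *: v + x) = h *: w + phi x) ->
  derivable F (phi x) w -> derivable (F \o phi) x v.
Proof.
move=> phiE; rewrite /derivable; set g1 := (fun _ => _); set g2 := (fun _ => _).
by suff -> : g1 = g2 by []; apply/funext => h; rewrite /g1 /g2 /= phiE.
Qed.

Lemma derive_open0 (V : normedModType R) (A : set V) (F : V -> R) (x v : V) :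
  open A -> A x -> (forall z, A z -> F z = 0) -> 'D_v F x = 0.
Proof.
move=> oA Ax F0; rewrite (@near_eq_derive _ _ _ F (cst 0)) ?derive_cst//.
by move: oA; rewrite openE => /(_ _ Ax); apply: filterS.
Qed.

Lemma integral_derive0 (g : R -> R) (r : R) :
  (forall x, derivable g x 1) -> continuous (fun x => 'D_1 g x) ->
  (forall x, r < `|x| -> g x = 0) ->
  (\int[lebesgue_measure]_x ('D_1 g x)%:E = 0)%E.
Proof.
(* [g] is known to vanish only strictly beyond [r], whose sign is unknown; the enlarged radius is
   positive and puts both endpoints in the zero region. *)
move=> dg cg g0; set s := `|r| + 1.
have s0 : 0 < s by rewrite ltr_wpDl.
have rs x : s <= `|x| -> r < `|x|.
  by move=> sx; rewrite (lt_le_trans _ sx)// ltr_pwDr// ler_norm.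
have D0 x : ~ `[- s, s]%classic x -> 'D_1 g x = 0.
  move=> /= xs; apply: (@derive_open0 _ [set y | r < `|y|]).
  - rewrite (_ : mkset _ = (fun y : R => `|y|) @^-1` [set y | r < y]).
      by apply: open_comp; [move=> z _; exact: norm_continuous|exact: open_gt].
    by apply/seteqP; split.
  - by apply: rs; rewrite leNgt; apply/negP => /ltW sx; apply: xs;
      rewrite in_itv/= -ler_norml.
  - by move=> z; exact: g0.
transitivity (\int[lebesgue_measure]_(x in `[(- s)%R, s]) ('D_1 g x)%:E)%E.
  rewrite [RHS]integral_mkcond; apply: eq_integral => x _.
  by rewrite patchE; case: ifPn => // /negP; rewrite inE => /D0 ->.
have ss : - s < s by lra.
rewrite (@continuous_FTC2 _ (fun x => 'D_1 g x) g)//.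
- by rewrite !g0 ?subee//; apply: rs; rewrite ?normrN ger0_norm// ltW.
- exact: continuous_subspaceT.
- have cg' : continuous g by move=> x; exact/differentiable_continuous/derivable1_diffP.
  split => //; [exact/cvg_at_right_filter/cg'|exact/cvg_at_left_filter/cg'].
- by move=> x _; rewrite derive1E.
Qed.

End directional.

Section slices.
Context {R : realType} {n : nat}.

Lemma rV_cons0 (x : R) (v : 'rV[R]_n) : rV_cons (x, v) 0 0 = x.
Proof. by have := congr1 fst (rV_consK (x, v)). Qed.

Lemma rV_consS (x : R) (v : 'rV[R]_n) j : rV_cons (x, v) 0 (lift ord0 j) = v 0 j.
Proof.
rewrite /rV_cons; have -> : lift ord0 j = @rshift 1 n j by exact/val_inj.
by rewrite (@row_mxEr _ 1 1 n).
Qed.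

(** The increment is written [h *: 1 + x] because that is the form [derive_along] expects for a
    derivative along 1 in R. *)
Lemma rV_cons_shift0 (h x : R) (v : 'rV[R]_n) :
  rV_cons (h *: 1 + x, v) = h *: delta_mx 0 0 + rV_cons (x, v).
Proof.
apply/rowP => j; have [k ->|->] := unliftP ord0 j.
  by rewrite [RHS]mxE [X in _ = X + _]mxE 2!rV_consS mxE/= mulr0 add0r.
by rewrite [RHS]mxE [X in _ = X + _]mxE !rV_cons0 mxE/=.
Qed.

Lemma rV_cons_shiftS (h x : R) (v : 'rV[R]_n) k :
  rV_cons (x, h *: delta_mx 0 k + v) =
  h *: delta_mx 0 (lift ord0 k) + rV_cons (x, v).
Proof.
apply/rowP => j; have [i ->|->] := unliftP ord0 j.
  by rewrite [RHS]mxE [X in _ = X + _]mxE !rV_consS !mxE/= (inj_eq lift_inj).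
by rewrite [RHS]mxE [X in _ = X + _]mxE !rV_cons0 mxE/= mulr0 add0r.
Qed.

Lemma continuous_rV_cons : continuous (@rV_cons R n).
Proof.
move=> -[x v]; apply/cvgrPdist_lt => e e0.
have e20 : 0 < e / 2 by rewrite divr_gt0.
have c1 : fst z @[z --> (x, v)] --> x by exact: cvg_fst.
have c2 : snd z @[z --> (x, v)] --> v by exact: cvg_snd.
near=> z; apply: (@le_lt_trans _ _ (e / 2)); last by lra.
apply: rV_norm_le; first lra.
move=> j; rewrite mxE [X in _ + X]mxE; have [i ->|->] := unliftP ord0 j.
  rewrite {1}[z]surjective_pairing !rV_consS.
  apply: le_trans (_ : `|v - z.2| <= _).
    by have := rV_coord_le (v - z.2) i; rewrite !mxE.
  apply/ltW; near: z; move/cvgrPdist_lt : c2; exact.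
rewrite {1}[z]surjective_pairing !rV_cons0.
apply/ltW; near: z; move/cvgrPdist_lt : c1; exact.
Unshelve. all: by end_near. Qed.

End slices.

(** * Integration by parts against test fields *)

Section integral_partial.
Context {R : realType}.

Lemma bounded_measurable_integrable d (T : measurableType d)
    (mu : {measure set T -> \bar R}) (D : set T) (f : T -> R) (M : R) :
  measurable D -> (mu D < +oo)%E -> measurable_fun D f ->
  (forall x, D x -> `|f x| <= M) -> mu.-integrable D (EFin \o f).
Proof.
move=> mD Dfin mf fM; apply: measurable_bounded_integrable => //.
exists M; split; first exact: num_real.
by move=> r Mr x Dx; apply: le_trans (fM x Dx) (ltW Mr).
Qed.

Lemma integrable_boundedT n (G : 'rV[R]_n -> R) (r M : R) :
  measurable_fun setT G -> (forall x, `|G x| <= M) ->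
  (forall x : 'rV[R]_n, (exists i, r < `|x 0 i|) -> G x = 0) ->
  (lebesgue_rV R n).-integrable setT (EFin \o G).
Proof.
move=> mG GM G0; pose I : set R := `[- r, r]%classic.
pose B := [set v : 'rV[R]_n | forall j, I (v 0 j)].
have mB : measurable B.
  by apply: (measurable_rV_box (A := fun=> I)) => j; exact: measurable_itv.
have BE (x : 'rV[R]_n) : B x <-> forall j, `|x 0 j| <= r.
  by split=> Bx j; have := Bx j; rewrite /I/= in_itv/= ler_norml.
have iB : (lebesgue_rV R n).-integrable B (EFin \o G).
  apply: (@bounded_measurable_integrable _ _ _ _ _ M) => //.
    by apply: (lebesgue_rV_bounded mB (r := r)) => x /BE.
  exact: measurable_funS mG.
move/(integrable_mkcond _ mB): iB; congr (_.-integrable _ _).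
apply/funext => x; rewrite patchE; case: ifPn => // /negP; rewrite inE => Bx.
rewrite /= G0//; apply: contrapT => H; apply: Bx; apply/BE => j.
by rewrite leNgt; apply/negP => rx; apply: H; exists j.
Qed.

(** The bound [M] and the bounded support give integrability on the product, so that Fubini's
    theorem may integrate the coordinates in either order. *)
Lemma integral_partial0 n (F : 'rV[R]_n -> R) (r M : R) j :
  (forall x, derivable F x (delta_mx 0 j)) -> continuous (partial j F) ->
  (forall x, `|partial j F x| <= M) ->
  (forall x : 'rV[R]_n, (exists i, r < `|x 0 i|) -> F x = 0) ->
  (\int[lebesgue_rV R n]_x (partial j F x)%:E = 0)%E.
Proof.
elim: n F j => [F []//|n IHn F j dF cF FM F0].
have F0' (x : 'rV[R]_n.+1) : (exists i, r < `|x 0 i|) -> partial j F x = 0.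
  move=> [i xi]; rewrite /partial.
  apply: (@derive_open0 _ _ [set y : 'rV[R]_n.+1 | r < `|y 0 i|]) => //.
    rewrite (_ : mkset _ = (fun y : 'rV[R]_n.+1 => y 0 i) @^-1` [set y | r < `|y|])//.
    apply: open_comp; first by move=> z _; exact: coord_continuous.
    rewrite (_ : mkset _ = (fun y : R => `|y|) @^-1` [set y | r < y])//.
    by apply: open_comp; [move=> z _; exact: norm_continuous|exact: open_gt].
  by move=> z ri; apply: F0; exists i.
have mF : measurable_fun setT (partial j F) by exact: continuous_rV_measurable.
have iF : (lebesgue_rV R n.+1).-integrable setT (EFin \o partial j F).
  exact: integrable_boundedT F0'.
have mEF : measurable_fun setT (EFin \o partial j F) by exact/measurable_EFinP.
have iFc : (@lebesgue_measure R \x lebesgue_rV R n)%E.-integrable setT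
    ((EFin \o partial j F) \o @rV_cons R n).
  apply/integrableP; split.
    by apply: measurableT_comp => //; exact: measurable_rV_cons.
  move/integrableP : iF => [_]; rewrite [X in (X < _)%E]ge0_integral_pushforward//=.
  - exact: measurable_rV_cons.
  - by apply/measurable_EFinP; exact: measurableT_comp.
transitivity (\int[(@lebesgue_measure R \x lebesgue_rV R n)%E]_p
    ((EFin \o partial j F) \o @rV_cons R n) p)%E.
  by rewrite [LHS]integral_pushforward//=; exact: measurable_rV_cons.
(* In a direction other than the first, the first coordinate is frozen and the induction hypothesis
   applies to the slice; in the first direction, that coordinate is integrated first, by the
   fundamental theorem of calculus. *)
have [k jk|jk] := unliftP ord0 j; rewrite {j}jk in dF cF FM F0' mF iF mEF iFc *.
  rewrite -(integral12_prod_meas1 iFc) /fubini_F.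
  rewrite (eq_integral (cst 0%E)) ?integral0// => x _.
  pose G v := F (rV_cons (x, v)).
  have dE v : partial (lift ord0 k) F (rV_cons (x, v)) = partial k G v.
    apply/esym; apply: (@derive_along _ _ _ _ (fun v => rV_cons (x, v))) => h.
    exact: rV_cons_shiftS.
  have cG : continuous (partial k G).
    rewrite (_ : partial k G = (partial (lift ord0 k) F \o @rV_cons R n) \o pair x).
      move=> v; apply: continuous_comp; last first.
        by apply: continuous_comp; [exact: continuous_rV_cons|exact: cF].
      by apply: (@cvg_pair _ _ _ (nbhs v) (nbhs x) (nbhs v)); [exact: cvg_cst|exact: cvg_id].
    by apply/funext => v; rewrite /= dE.
  under eq_integral do rewrite /= dE.
  apply: IHn => //.
  - move=> v; apply: (@derivable_along _ _ _ _ (fun v => rV_cons (x, v))).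
      by move=> h; exact: rV_cons_shiftS.
    exact: dF.
  - by move=> v; rewrite -dE.
  - by move=> v [i vi]; apply: F0; exists (lift ord0 i); rewrite rV_consS.
rewrite -(integral21_prod_meas1 iFc) /fubini_G.
rewrite (eq_integral (cst 0%E)) ?integral0// => v _.
pose g s := F (rV_cons (s, v)).
have dE s : partial ord0 F (rV_cons (s, v)) = 'D_1 g s.
  apply/esym; apply: (@derive_along _ _ _ _ (fun s => rV_cons (s, v))) => h.
  exact: rV_cons_shift0.
under eq_integral do rewrite /= dE.
apply: (@integral_derive0 _ _ r).
- move=> s; apply: (@derivable_along _ _ _ _ (fun s => rV_cons (s, v))).
    by move=> h; exact: rV_cons_shift0.
  exact: dF.
- rewrite (_ : (fun _ => _) = (partial ord0 F \o @rV_cons R n) \o (pair^~ v)).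
    move=> s; apply: continuous_comp; last first.
      by apply: continuous_comp; [exact: continuous_rV_cons|exact: cF].
    by apply: (@cvg_pair _ _ _ (nbhs s) (nbhs s) (nbhs v)); [exact: cvg_id|exact: cvg_cst].
  by apply/funext => s; rewrite /= dE.
- by move=> s rs; apply: F0; exists 0; rewrite rV_cons0.
Qed.

End integral_partial.

(** * Continuity and boundedness of test fields *)

Section lipschitz.
Context {R : realType}.

Lemma l1norm_delta d (j : 'I_d) : l1norm (delta_mx 0 j : 'rV[R]_d) = 1.
Proof.
rewrite /l1norm (bigD1 j)//= big1 => [|i /negPf ij]; rewrite mxE/= ?eqxx.
  by rewrite normr1 addr0.
by rewrite ij normr0.
Qed.

Lemma bounded_derive_lipschitz (g : R -> R) (M : R) :
  (forall x, derivable g x 1) -> (forall x, `|'D_1 g x| <= M) ->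
  forall a b, `|g b - g a| <= M * `|b - a|.
Proof.
move=> dg gM a b; wlog ab : a b / a <= b.
  move=> H; have [|/ltW] := leP a b; first exact: H.
  by move/H; rewrite distrC [X in _ <= _ * X]distrC.
have [| |c _ ->] := @MVT_segment R g (fun x => 'D_1 g x) a b ab.
- by move=> x _; exact: derivableP.
- by apply: derivable_within_continuous => x _.
- by rewrite normrM ler_wpM2r.
Qed.

(** [test_field] speaks only of partial derivatives; continuity of the field itself is recovered
    here from their boundedness, through a Lipschitz estimate. *)
Lemma bounded_partial_continuous n (F : 'rV[R]_n -> R) (M : R) :
  (forall j x, derivable F x (delta_mx 0 j)) ->
  (forall j x, `|partial j F x| <= M) -> continuous F.
Proof.
move=> dF FM x.
have lip j (z : 'rV[R]_n) a : `|F (a *: delta_mx 0 j + z) - F z| <= M * `|a|.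
  pose G (s : R) := F (s *: delta_mx 0 j + z).
  have phiE (s h : R) : (h *: (1 : R) + s) *: delta_mx 0 j + z =
    h *: delta_mx 0 j + (s *: delta_mx 0 j + z) :> 'rV[R]_n.
    by rewrite addrA -scalerDl [h *: 1]mulr1.
  have := @bounded_derive_lipschitz G M _ _ 0 a.
  rewrite /G scale0r add0r subr0; apply => s.
    exact: (@derivable_along _ _ _ _ (fun s : R => s *: delta_mx 0 j + z)).
  rewrite (@derive_along _ _ _ _ (fun s : R => s *: delta_mx 0 j + z) F _ _ (delta_mx 0 j))//.
  exact: FM.
(* go from x to y one coordinate at a time *)
have FxM (y : 'rV[R]_n) : `|F y - F x| <= M *+ n * `|y - x|.
  pose z k : 'rV[R]_n := \row_i (if (i < k)%N then y 0 i else x 0 i).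
  have -> : F y - F x = \sum_(k < n) (F (z k.+1) - F (z k)).
    rewrite -(big_mkord xpredT (fun k => F (z k.+1) - F (z k))) telescope_sumr//.
    congr (F _ - F _); apply/rowP => i; rewrite mxE// ltn_ord//.
  apply: le_trans (ler_norm_sum _ _ _) _.
  rewrite mulrnAl -[X in _ *+ X]card_ord -sumr_const; apply: ler_sum => k _.
  have -> : z k.+1 = (y 0 k - x 0 k) *: delta_mx 0 k + z k.
    apply/rowP => i; rewrite !mxE eqxx ltnS leq_eqVlt.
    have [->|ik] := eqVneq i k; first by rewrite eqxx ltnn mulr1 subrK.
    by rewrite (inj_eq val_inj) (negPf ik) mulr0 add0r.
  have M0 : 0 <= M by apply: le_trans (FM k x).
  apply: le_trans (lip _ _ _) _; rewrite ler_wpM2l//.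
  by have := rV_coord_le (y - x) k; rewrite !mxE.
have K0 : 0 < `|M *+ n| + 1 by rewrite ltr_wpDl.
apply/(@cvgrPdist_lt _ _ _ (nbhs x) (nbhs_filter x)) => e e0; apply/nbhs_ballP.
exists (e / (`|M *+ n| + 1)); first by rewrite /= divr_gt0.
move=> y; rewrite -ball_normE /= => xy.
rewrite distrC (le_lt_trans (FxM y))//.
apply: (@le_lt_trans _ _ ((`|M *+ n| + 1) * `|y - x|)).
  by rewrite ler_wpM2r// (le_trans (ler_norm _))// lerDl.
by rewrite mulrC -ltr_pdivlMr// distrC.
Qed.

Lemma compact_support_bounded n (g : 'rV[R]_n -> R) (K : set 'rV[R]_n) :
  continuous g -> compact K -> (forall x, ~ K x -> g x = 0) ->
  exists M, forall x, `|g x| <= M.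
Proof.
move=> cg cK g0.
have : compact (g @` K).
  by apply: continuous_compact => //; exact: continuous_subspaceT.
move=> /compact_bounded[M [_ gM]]; exists (`|M| + 1) => x.
have [Kx|/g0->] := pselect (K x); last by rewrite normr0.
by apply: (gM (`|M| + 1)); [rewrite ltr_pwDr// ler_norm|exists x].
Qed.

Lemma continuous_rV_sum n (I : Type) (s : seq I) (F : I -> 'rV[R]_n -> R) :
  (forall i, continuous (F i)) -> continuous (fun x => \sum_(i <- s) F i x).
Proof.
move=> cF; elim: s => [|i s IHs].
  by under eq_fun do rewrite big_nil; move=> x; exact: cst_continuous.
under eq_fun do rewrite big_cons.
by move=> x; exact: (continuousD (cF i x) (IHs x)).
Qed.

End lipschitz.

Section test_fields.
Context {R : realType} {d : nat} (Omega : set 'rV[R]_d).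
Variable p : 'rV[R]_d -> 'rV[R]_d.
Hypothesis tp : test_field Omega p.

Let supp := closure [set x | p x != 0].

Lemma test_field_out x : ~ supp x -> p x = 0.
Proof.
move=> sx; apply/eqP; apply: contrapT => /negP px; apply: sx.
exact: subset_closure.
Qed.

Lemma test_field_partial_out x i j : ~ supp x -> partial j (fun z => p z 0 i) x = 0.
Proof.
move=> sx; apply: (@derive_open0 _ _ (~` supp)) => //.
  by rewrite openC; exact: closed_closure.
by move=> z /test_field_out ->; rewrite mxE.
Qed.

Lemma test_field_le1 x i : `|p x 0 i| <= 1.
Proof.
have [_ _ _ /(_ x) p1] := tp; apply: le_trans p1.
rewrite /l2norm -[leLHS]ger0_norm// -sqrtr_sqr ler_wsqrtr// real_normK ?num_real//.
by rewrite (bigD1 i)//= lerDl sumr_ge0// => k _; rewrite sqr_ge0.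
Qed.

Lemma test_field_partial_bounded : exists M, forall i j x,
  `|partial j (fun z => p z 0 i) x| <= M.
Proof.
have [_ cp [cK _] _] := tp.
have /choice[M pM] : forall ij : 'I_d * 'I_d, exists M, forall x,
    `|partial ij.2 (fun z => p z 0 ij.1) x| <= M.
  move=> [i j]; apply: (@compact_support_bounded _ _ _ supp) => //.
  by move=> x /test_field_partial_out; exact.
exists (\sum_ij `|M ij|) => i j x; apply: le_trans (pM (i, j) x) _.
by rewrite (bigD1 (i, j))//= (le_trans (ler_norm _))// lerDl sumr_ge0.
Qed.

Lemma test_field_continuous i : continuous (fun z => p z 0 i).
Proof.
have [M pM] := test_field_partial_bounded; have [dp _ _ _] := tp.
exact: bounded_partial_continuous (pM i).
Qed.

Lemma divergence_continuous : continuous (divergence p).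
Proof.
by have [_ cp _ _] := tp; apply: continuous_rV_sum => j; exact: cp.
Qed.

Lemma divergence_bounded : exists M, forall x, `|divergence p x| <= M.
Proof.
have [M pM] := test_field_partial_bounded; exists (M *+ d) => x.
apply: le_trans (ler_norm_sum _ _ _) _.
rewrite -[X in _ *+ X]card_ord -sumr_const; exact: ler_sum.
Qed.

End test_fields.

(** * Ridge functions against test fields *)

Section ridge.
Context {R : realType} {d : nat}.

Lemma dotrV_shift (w x : 'rV[R]_d) j (h : R) :
  dotrV w (h *: delta_mx 0 j + x) = h *: w 0 j + dotrV w x.
Proof.
rewrite /dotrV; under eq_bigr do rewrite !mxE mulrDr.
rewrite big_split/= (bigD1 j)//= big1 ?addr0 ?eqxx; last first.
  by move=> i /negPf ->; rewrite mulr0 mulr0.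
by rewrite mulr1 mulrC.
Qed.

Lemma continuous_dotrV (w : 'rV[R]_d) : continuous (dotrV w).
Proof.
apply: continuous_rV_sum => j x.
by apply: continuousM; [exact: cst_continuous|exact: coord_continuous].
Qed.

Variables (g g' : R -> R) (w : 'rV[R]_d).
Hypothesis dg : forall z : R, is_derive z (1 : R) g (g' z).

Lemma ridge_derivable x j : derivable (fun x => g (dotrV w x)) x (delta_mx 0 j).
Proof.
apply: (@derivable_along _ _ _ _ (dotrV w) g _ _ (w 0 j)).
  by move=> h; exact: dotrV_shift.
by apply: diff_derivable; apply/derivable1_diffP; have [] := dg (dotrV w x).
Qed.

Lemma ridge_partial j :
  partial j (fun x => g (dotrV w x)) = fun x => w 0 j * g' (dotrV w x).
Proof.
apply/funext => x; rewrite /partial.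
rewrite (@derive_along _ _ _ _ (dotrV w) g _ _ (w 0 j)); last first.
  by move=> h; exact: dotrV_shift.
have [dgx gx] := dg (dotrV w x).
have diffg : differentiable g (dotrV w x) by apply/derivable1_diffP.
rewrite deriveE// -[w 0 j]mulr1 -[w 0 j * 1]/(w 0 j *: (1 : R)) linearZ/=.
by rewrite -deriveE// gx [_%:A]mulr1.
Qed.

(** The integrand is the divergence of the compactly supported field [g (w . x) p x]; its vanishing
    integral identifies [g' (w . x) w] as the weak gradient of the ridge function. *)
Lemma ridge_ibp (Omega : set 'rV[R]_d) (p : 'rV[R]_d -> 'rV[R]_d) :
  open Omega -> continuous g' -> test_field Omega p ->
  \int[lebesgue_rV R d]_(x in Omega)
    (divergence p x * g (dotrV w x)
     + (\sum_(j < d) p x 0 j * w 0 j) * g' (dotrV w x)) = 0.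
Proof.
move=> oO cg' tp; have [dp cp [cK KO] _] := tp.
set K := closure _ in cK KO.
have cg : continuous g.
  by move=> z; apply/differentiable_continuous/derivable1_diffP; have [] := dg z.
pose f x := g (dotrV w x).
have cf : continuous f.
  by move=> x; apply: continuous_comp; [exact: continuous_dotrV|exact: cg].
pose F j x := f x * p x 0 j.
have dF j x : derivable (F j) x (delta_mx 0 j).
  by apply: derivableM; [exact: ridge_derivable|exact: dp].
have FE j : partial j (F j) = fun x =>
    f x * partial j (fun z => p z 0 j) x + p x 0 j * (w 0 j * g' (dotrV w x)).
  apply/funext => x; rewrite /partial [LHS]deriveM//; last exact: ridge_derivable.
  by have /(congr1 (fun h => h x)) := ridge_partial j; rewrite /partial => ->.
have cF j : continuous (partial j (F j)).
  have cgw : continuous (fun x => g' (dotrV w x)).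
    by move=> x; apply: continuous_comp; [exact: continuous_dotrV|exact: cg'].
  rewrite FE => x; apply: (@continuousD _ _ _ (fun x => f x * _ x)
    (fun x => p x 0 j * (w 0 j * g' (dotrV w x)))).
    exact: (continuousM (cf x) (cp j j x)).
  apply: (@continuousM _ _ (fun x => p x 0 j) (fun x => w 0 j * g' (dotrV w x))).
    exact: (@test_field_continuous _ _ _ _ tp j x).
  apply: (@continuousM _ _ (cst (w 0 j)) (fun x => g' (dotrV w x))).
    exact: cst_continuous.
  exact: cgw.
have F0 j x : ~ K x -> partial j (F j) x = 0.
  move=> Kx; rewrite FE test_field_partial_out// (test_field_out Kx) mxE.
  by rewrite mulr0 mul0r addr0.
have /choice[M FM] : forall j, exists M, forall x, `|partial j (F j) x| <= M.
  by move=> j; exact: compact_support_bounded (cF j) cK (F0 j).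
have [r Kr] : exists r, forall x : 'rV[R]_d, (exists i, r < `|x 0 i|) -> ~ K x.
  have [r [_ rK]] := compact_bounded cK; exists (r + 1) => x [i xi] Kx.
  have := rK (r + 1) _ _ Kx; rewrite ltrDl ltr01 => /(_ isT).
  by move/(le_trans (rV_coord_le x i)); rewrite leNgt xi.
have i0 j : (\int[lebesgue_rV R d]_x (partial j (F j) x)%:E = 0)%E.
  apply: (@integral_partial0 _ _ _ r (M j)) => //.
  by move=> x /Kr Kx; rewrite /F (test_field_out Kx) mxE mulr0.
have iF j : (lebesgue_rV R d).-integrable setT (EFin \o partial j (F j)).
  apply: (@integrable_boundedT _ _ _ r (M j)) => //.
    exact: continuous_rV_measurable.
  by move=> x /Kr; exact: F0.
(* The integrand vanishes off the support of [p], so the integral may be taken over the whole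
   space. *)
transitivity (\int[lebesgue_rV R d]_x (\sum_(j < d) partial j (F j) x)).
  rewrite Rintegral_mkcond; apply: eq_Rintegral => x _; rewrite patchE.
  case: ifPn => [_|/negP]; last first.
    by rewrite inE => Ox; rewrite big1// => j _; apply: F0 => /KO.
  under [RHS]eq_bigr do rewrite FE.
  rewrite big_split/= /divergence mulrC mulr_sumr mulr_suml; congr (_ + _).
  by apply: eq_bigr => j _; rewrite mulrA.
rewrite /Rintegral; under eq_integral do rewrite -sumEFin.
by rewrite integral_sum// big1.
Qed.

End ridge.

(** * Softplus ridge representation *)

Section real_calculus.
Context {R : realType}.

Lemma is_derive_affine (a b z : R) :
  is_derive z (1 : R) (fun z => a * z + b) a.
Proof.
have d := is_deriveD (is_deriveZ a (is_derive_id z (1 : R)))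
  (is_derive_cst b z (1 : R)).
by apply: (is_derive_eq d); rewrite addr0 [LHS]mulr1.
Qed.

Lemma is_derive_comp_affine (f : R -> R) (df a b z : R) :
  is_derive (a * z + b) (1 : R) f df ->
  is_derive z (1 : R) (fun z => f (a * z + b)) (a * df).
Proof.
move=> dff; rewrite mulrC.
exact: (@is_derive1_comp _ f (fun z => a * z + b) _ _ _ dff (is_derive_affine a b z)).
Qed.

Lemma is_derive_continuous (f f' : R -> R) :
  (forall z : R, is_derive z (1 : R) f (f' z)) -> continuous f.
Proof.
move=> df z; apply/differentiable_continuous/derivable1_diffP.
by have [] := df z.
Qed.

End real_calculus.

Section softplus_calculus.
Context {R : realType}.
Variable tau : R.
Hypothesis tau0 : 0 < tau.

Definition sigmoid (z : R) : R := (1 + expR (- (tau * z)))^-1.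

Lemma sigmoidE (z : R) : sigmoid z = expR (tau * z) / (1 + expR (tau * z)).
Proof.
rewrite /sigmoid expRN; have := expR_gt0 (tau * z); set e := expR _ => e0.
by field; rewrite !gt_eqF//= ?addr_gt0.
Qed.

Lemma sigmoid_ge0 z : 0 <= sigmoid z.
Proof. by rewrite invr_ge0 addr_ge0 ?expR_ge0. Qed.

Lemma sigmoidN z : sigmoid (- z) = 1 - sigmoid z.
Proof.
rewrite sigmoidE /sigmoid mulrN; have := expR_gt0 (- (tau * z)).
set e := expR _ => e0; field.
by rewrite gt_eqF// addr_gt0.
Qed.

Lemma sigmoid_le1 z : sigmoid z <= 1.
Proof. by rewrite -subr_ge0 -sigmoidN sigmoid_ge0. Qed.

Lemma is_derive_softplus z : is_derive z (1 : R) (softplus tau) (sigmoid z).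
Proof.
have e0 : 0 < 1 + expR (tau * z) by rewrite addr_gt0 ?expR_gt0.
have d1 : is_derive z (1 : R) (fun z => 1 + expR (tau * z)) (tau * expR (tau * z)).
  have := @is_derive_comp_affine R expR _ tau 0 z (is_derive_expR _).
  under eq_fun do rewrite addr0; rewrite addr0 => d2.
  have d3 := is_deriveD (is_derive_cst (1 : R) z (1 : R)) d2.
  by apply: (is_derive_eq d3); rewrite add0r.
have d2 := @is_derive1_comp R (@ln R) (fun z => 1 + expR (tau * z)) _ _ _ (is_derive1_ln e0) d1.
apply: (is_derive_eq (is_deriveZ tau^-1 d2)).
by rewrite sigmoidE /GRing.scale/=; field; rewrite !gt_eqF.
Qed.

Lemma continuous_softplus : continuous (softplus tau).
Proof. exact: is_derive_continuous is_derive_softplus. Qed.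

Lemma continuous_sigmoid : continuous sigmoid.
Proof.
pose f' (z : R) : R := 0 + - tau * expR (- tau * z + 0).
pose f : R -> R := cst (1 : R) + fun z : R => expR (- tau * z + 0).
have c : continuous f.
  apply: (@is_derive_continuous _ _ f') => z.
  exact: is_deriveD (is_derive_cst (1 : R) z (1 : R))
    (is_derive_comp_affine (is_derive_expR _)).
rewrite (_ : sigmoid = fun z => (f z)^-1) => [z|].
  apply: (cvgV _ (c z)).
  by rewrite gt_eqF// addr_gt0 ?expR_gt0.
by apply/funext => u; rewrite /sigmoid /= -mulNr -[X in expR X]addr0.
Qed.

Lemma softplus_ge0 z : 0 <= softplus tau z.
Proof.
rewrite /softplus mulr_ge0 ?invr_ge0 ?(ltW tau0)// ln_ge0//.
by rewrite lerDl expR_ge0.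
Qed.

(** An exact identity: a linear ridge is a difference of two opposite neurons, with no error in
    [tau^-1]. It also reduces positive arguments to negative ones. *)
Lemma softplusB z : softplus tau z - softplus tau (- z) = z.
Proof.
have [e1 e2] : 0 < 1 + expR (tau * z) /\ 0 < 1 + expR (tau * - z).
  by split; rewrite addr_gt0 ?expR_gt0.
rewrite /softplus -mulrBr -lnV ?posrE// -lnM ?posrE ?invr_gt0//.
rewrite (_ : _ / _ = expR (tau * z)).
  by rewrite expRK mulrA mulVf ?mul1r// gt_eqF.
move: e1 e2; rewrite mulrN expRN; have := expR_gt0 (tau * z).
set e := expR _ => e0 e1 e2; field.
by rewrite !gt_eqF//= addrC.
Qed.

(** The logarithm is at most 1, because [1 + expR (tau * z) <= 2 <= expR 1]. *)
Lemma softplus_le0 z : z <= 0 -> softplus tau z <= tau^-1.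
Proof.
move=> z0; rewrite /softplus ger_pMr ?invr_gt0//.
rewrite -ler_expR lnK ?posrE ?addr_gt0 ?expR_gt0//.
apply: le_trans (expR_ge1Dx _); rewrite lerD2l -[leRHS]expR0 ler_expR.
by rewrite pmulr_rle0.
Qed.

Lemma softplus_le z : softplus tau z <= `|z| + tau^-1.
Proof.
have [z0|z0] := leP z 0.
  by apply: (le_trans (softplus_le0 z0)); rewrite lerDr.
rewrite -lerBlDl gtr0_norm// -{2}[z]softplusB opprB addrC subrK.
by apply: softplus_le0; lra.
Qed.

End softplus_calculus.

Section interval_integral.
Context {R : realType}.
Implicit Types (f g F : R -> R) (a b c : R).

Local Notation I a b f := (\int[lebesgue_measure]_(x in `[a, b]) f x).

Lemma continuous_itv_integrable f a b : continuous f ->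
  lebesgue_measure.-integrable `[a, b] (EFin \o f).
Proof.
move=> cf; apply: continuous_compact_integrable; first exact: segment_compact.
exact: continuous_subspaceT.
Qed.

Lemma Rintegral_FTC f F a b : a <= b -> continuous f ->
  (forall z : R, is_derive z (1 : R) F (f z)) -> I a b f = F b - F a.
Proof.
rewrite le_eqVlt => /predU1P[<- _ _|ab cf dF].
  by rewrite subrr set_itv1 Rintegral_set1.
have cF : continuous F by exact: is_derive_continuous dF.
rewrite /Rintegral (@continuous_FTC2 _ _ F)//.
- exact: continuous_subspaceT.
- split; first by move=> x _; have [] := dF x.
    exact/cvg_at_right_filter/cF.
  exact/cvg_at_left_filter/cF.
- by move=> x _; rewrite derive1E; have [] := dF x.
Qed.

Lemma Rintegral_itv_cst (k a b : R) : a <= b -> I a b (fun=> k) = k * (b - a).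
Proof.
move=> ab.
rewrite (Rintegral_FTC ab (@cst_continuous _ _ k) (is_derive_affine k 0)).
by rewrite !addr0 mulrBr.
Qed.

Lemma Rintegral_itv_split f a b c : a <= c -> c <= b -> continuous f ->
  I a b f = I a c f + I c b f.
Proof.
move=> ac cb cf; have := @Rintegral_itvB R f (BLeft a) (BRight b) c.
move=> /(_ (continuous_itv_integrable _ _ cf)); rewrite !bnd_simp => /(_ ac cb).
rewrite [RHS]Rintegral_itv_obnd_cbnd => [<-|]; first by rewrite addrC subrK.
by apply: integrableS (continuous_itv_integrable c b cf) => //; exact: subset_itv_oc_cc.
Qed.

Lemma le_Rintegral_itv f g a b : continuous f -> continuous g ->
  (forall x, a <= x <= b -> f x <= g x) -> I a b f <= I a b g.
Proof.
by move=> cf cg fg; apply: le_Rintegral => //; exact: continuous_itv_integrable.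
Qed.

Lemma norm_Rintegral_itv f g a b : continuous f -> continuous g ->
  (forall x, a <= x <= b -> `|f x| <= g x) -> `|I a b f| <= I a b g.
Proof.
move=> cf cg fg.
apply: le_trans (le_normr_Rintegral _ (continuous_itv_integrable a b cf)) _ => //.
apply: (le_Rintegral_itv (f := fun x => `|f x|)) => //.
by move=> x; apply: continuous_comp; [exact: cf|exact: norm_continuous].
Qed.

Lemma Rintegral_itvB_fun f g a b : continuous f -> continuous g ->
  I a b f - I a b g = I a b (fun x => f x - g x).
Proof. by move=> cf cg; rewrite RintegralB//; exact: continuous_itv_integrable. Qed.

End interval_integral.

Section softplus_representation.
Context {R : realType}.
Variable tau : R.
Hypothesis tau0 : 0 < tau.
Variables (h h' h'' : R -> R) (M : R).
Hypothesis dh : forall z : R, is_derive z (1 : R) h (h' z).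
Hypothesis dh' : forall z : R, is_derive z (1 : R) h' (h'' z).
Hypothesis ch'' : continuous h''.
Hypothesis h''M : forall z, `|h'' z| <= M.

Local Notation I a b f := (\int[lebesgue_measure]_(x in `[a, b]) f x).

Let continuous_affine (c s : R) : continuous (fun b : R => c + s * b).
Proof.
apply: (@is_derive_continuous _ _ (fun=> s)) => z.
by under eq_fun do rewrite addrC; exact: is_derive_affine.
Qed.

Let continuous_shift (k : R -> R) (c s : R) : continuous k ->
  continuous (fun b => k (c + s * b)).
Proof.
by move=> ck z; apply: continuous_comp; [exact: continuous_affine|exact: ck].
Qed.

Let continuous_mul (f g : R -> R) : continuous f -> continuous g ->
  continuous (fun x => f x * g x).
Proof. by move=> cf cg x; exact: (continuousM (cf x) (cg x)). Qed.

Let M0 : 0 <= M. Proof. exact: le_trans (h''M 0). Qed.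

(* Taylor's formula at [-1] with ReLU [(z - b)_+] replaced by softplus. *)
Lemma softplus_repr_deriv (z : R) : -1 <= z <= 1 ->
  `|h' z - h' (-1) - I (-1) 1 (fun b => h'' b * sigmoid tau (z + -1 * b))|
  <= 2 * M / tau.
Proof.
move=> /andP[z1 z2].
have cs (c s : R) : continuous (fun b : R => sigmoid tau (c + s * b)).
  by apply: continuous_shift; exact: continuous_sigmoid.
rewrite -(Rintegral_FTC z1 ch'' dh') (Rintegral_itv_split z1 z2); last first.
  exact: continuous_mul.
rewrite opprD addrA Rintegral_itvB_fun//; last exact: continuous_mul.
(* A primitive of the dominating function. Near [b = z] the sigmoid is of order 1, so no uniform
   pointwise bound is small; its integral is at most [softplus tau 0], hence at most [tau^-1]. *)
have dS (c s x : R) : s != 0 ->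
    is_derive x (1 : R) (fun b : R => M * (s^-1 * softplus tau (c + s * b)))
      (M * sigmoid tau (c + s * x)).
  move=> s0.
  have d := is_deriveZ M (is_deriveZ s^-1
    (is_derive_comp_affine (is_derive_softplus tau0 (s * x + c)))).
  rewrite (_ : (fun b => _) = M \*: (s^-1 \*: fun z => softplus tau (s * z + c))).
    by apply: (is_derive_eq d); rewrite /GRing.scale/= mulKf// addrC.
  by apply/funext => b; rewrite [c + _]addrC.
have S0 : softplus tau 0 <= tau^-1 by exact: softplus_le0.
apply: le_trans (ler_normB _ _) _.
rewrite (_ : 2 * M / tau = M * tau^-1 + M * tau^-1); last by ring.
apply: lerD.
(* To the left of [z] the target is [h''] itself, and the defect [1 - sigmoid] is the sigmoid of the
   opposite argument. *)
- have -> : (fun x => h'' x - h'' x * sigmoid tau (z + -1 * x)) =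
     (fun x => h'' x * sigmoid tau (- z + 1 * x)).
    apply/funext => x; rewrite -[in LHS](mulr1 (h'' x)) -mulrA -mulrBr mul1r.
    by rewrite -sigmoidN; congr (_ * sigmoid _ _); ring.
  apply: (@le_trans _ _ (I (-1) z (fun b => M * sigmoid tau (- z + 1 * b)))).
    apply: norm_Rintegral_itv; [exact: continuous_mul| |].
      by apply: continuous_mul => //; exact: cst_continuous.
    by move=> x _; rewrite normrM ler_pM// ger0_norm ?sigmoid_ge0.
  rewrite (Rintegral_FTC z1 _ (fun x => dS (- z) 1 x (oner_neq0 _))); last first.
    by apply: continuous_mul => //; exact: cst_continuous.
  rewrite -mulrBr ler_wpM2l// invr1 !mul1r addNr.
  by rewrite lerBlDr (le_trans S0)// lerDl softplus_ge0.
- have N1 : (-1 : R) != 0 by rewrite oppr_eq0 oner_neq0.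
  apply: (@le_trans _ _ (I z 1 (fun b => M * sigmoid tau (z + -1 * b)))).
    apply: norm_Rintegral_itv; [exact: continuous_mul| |].
      by apply: continuous_mul => //; exact: cst_continuous.
    by move=> x _; rewrite normrM ler_pM// ger0_norm ?sigmoid_ge0.
  rewrite (Rintegral_FTC z2 _ (fun x => dS z (-1) x N1)); last first.
    by apply: continuous_mul => //; exact: cst_continuous.
  rewrite -mulrBr ler_wpM2l// invrN1 !mulN1r opprK addrC subrr.
  by rewrite lerBlDr (le_trans S0)// lerDl softplus_ge0.
Qed.

(** Unlike the derivative, the value has a pointwise defect of at most [tau^-1]; the constant 2 is
    the length of [-1, 1]. *)
Lemma softplus_repr (z : R) : -1 <= z <= 1 ->
  `|h z - (h (-1) + h' (-1)) - h' (-1) * z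
    - I (-1) 1 (fun b => h'' b * softplus tau (z + -1 * b))| <= 2 * M / tau.
Proof.
move=> /andP[z1 z2].
have cs (c s : R) : continuous (fun b : R => softplus tau (c + s * b)).
  by apply: continuous_shift; exact: continuous_softplus.
(* A primitive of [h'' b * (z - b)], whose increment from -1 to [z] is the Taylor remainder. *)
pose F b := h' b * (z + -1 * b) + h b.
have dF (b : R) : is_derive b (1 : R) F (h'' b * (z + -1 * b)).
  have d := is_deriveD (is_deriveM (dh' b) (is_derive_affine (-1) z b)) (dh b).
  rewrite (_ : F = h' * (fun b => -1 * b + z) + h).
    by apply: (is_derive_eq d); rewrite /GRing.scale/=; ring.
  by apply/funext => u; rewrite /F addrC [z + _]addrC addrC.
have := Rintegral_FTC z1 (continuous_mul ch'' (@continuous_affine z (-1))) dF.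
rewrite /F => FTC.
rewrite (_ : h z - _ - _ = I (-1) z (fun b => h'' b * (z + -1 * b))); last first.
  by rewrite FTC; ring.
rewrite (Rintegral_itv_split z1 z2); last exact: continuous_mul.
rewrite opprD addrA Rintegral_itvB_fun; [|exact: continuous_mul..].
apply: le_trans (ler_normB _ _) _.
rewrite (_ : 2 * M / tau = M / tau * (z - -1) + M / tau * (1 - z)); last by ring.
apply: lerD.
- have -> : (fun x => h'' x * (z + -1 * x) - h'' x * softplus tau (z + -1 * x)) =
     (fun x => - h'' x * softplus tau (- z + 1 * x)).
    apply/funext => x; rewrite (_ : - z + 1 * x = - (z + -1 * x)); last by ring.
    by set u := z + _; rewrite -mulrBr -{1}(softplusB tau0 u); ring.
  apply: (@le_trans _ _ (I (-1) z (fun=> M / tau))).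
    apply: norm_Rintegral_itv; [|exact: cst_continuous|].
      by apply: continuous_mul => // x; apply: cvgN; exact: ch''.
    move=> x /andP[_ xz]; rewrite normrM normrN ler_pM//.
    by rewrite ger0_norm ?softplus_ge0// softplus_le0//; lra.
  by rewrite Rintegral_itv_cst.
- apply: (@le_trans _ _ (I z 1 (fun=> M / tau))).
    apply: norm_Rintegral_itv; [exact: continuous_mul|exact: cst_continuous|].
    move=> x /andP[zx _]; rewrite normrM ler_pM//.
    by rewrite ger0_norm ?softplus_ge0// softplus_le0//; lra.
  by rewrite Rintegral_itv_cst.
Qed.

End softplus_representation.

(** * Bounded measurable functions and Fubini *)

Section bounded_measurable.
Context {R : realType} {dT : measure_display} {T : measurableType dT}.
Variables (mu : {measure set T -> \bar R}) (D : set T).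
Hypotheses (mD : measurable D) (muD : (mu D < +oo)%E).
Implicit Types f g : T -> R.

(** The functions integrated over the domain in the estimates are of this kind. The class is closed
    under the algebraic operations and integrable on sets of finite measure, so integrability is
    settled once. *)
Definition bounded_measurable f :=
  measurable_fun D f /\ exists M, forall x, D x -> `|f x| <= M.

Lemma bm_cst c : bounded_measurable (cst c).
Proof. by split; [exact: measurable_cst|exists `|c|]. Qed.

Lemma bmD f g : bounded_measurable f -> bounded_measurable g ->
  bounded_measurable (fun x => f x + g x).
Proof.
move=> [mf [M fM]] [mg [N gN]]; split; first exact: measurable_funD.
by exists (M + N) => x Dx; rewrite (le_trans (ler_normD _ _))// lerD ?fM ?gN.
Qed.

Lemma bmM f g : bounded_measurable f -> bounded_measurable g ->
  bounded_measurable (fun x => f x * g x).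
Proof.
move=> [mf [M fM]] [mg [N gN]]; split; first exact: measurable_funM.
by exists (M * N) => x Dx; rewrite normrM ler_pM ?fM ?gN.
Qed.

Lemma bmZ c f : bounded_measurable f -> bounded_measurable (fun x => c * f x).
Proof. by apply: bmM; exact: bm_cst. Qed.

Lemma bmN f : bounded_measurable f -> bounded_measurable (fun x => - f x).
Proof. by move/(bmZ (-1)); under eq_fun do rewrite mulN1r. Qed.

Lemma bmB f g : bounded_measurable f -> bounded_measurable g ->
  bounded_measurable (fun x => f x - g x).
Proof. by move=> bf /bmN; exact: bmD. Qed.

Lemma bm_norm f : bounded_measurable f -> bounded_measurable (fun x => `|f x|).
Proof.
move=> [mf [M fM]]; split; first exact: measurableT_comp.
by exists M => x Dx; rewrite normr_id fM.
Qed.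

Lemma bm_sum (I : Type) (s : seq I) (f : I -> T -> R) :
  (forall i, bounded_measurable (f i)) ->
  bounded_measurable (fun x => \sum_(i <- s) f i x).
Proof.
move=> bf; elim: s => [|i s IHs].
  by under eq_fun do rewrite big_nil; exact: bm_cst.
by under eq_fun do rewrite big_cons; exact: bmD.
Qed.

Lemma bm_integrable f : bounded_measurable f -> mu.-integrable D (EFin \o f).
Proof. by move=> [mf [M fM]]; exact: bounded_measurable_integrable fM. Qed.

Lemma Rintegral_bmD f g : bounded_measurable f -> bounded_measurable g ->
  \int[mu]_(x in D) (f x + g x) = \int[mu]_(x in D) f x + \int[mu]_(x in D) g x.
Proof. by move=> bf bg; rewrite RintegralD//; exact: bm_integrable. Qed.

Lemma Rintegral_bmB f g : bounded_measurable f -> bounded_measurable g ->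
  \int[mu]_(x in D) (f x - g x) = \int[mu]_(x in D) f x - \int[mu]_(x in D) g x.
Proof. by move=> bf bg; rewrite RintegralB//; exact: bm_integrable. Qed.

Lemma Rintegral_bmZ c f : bounded_measurable f ->
  \int[mu]_(x in D) (c * f x) = c * \int[mu]_(x in D) f x.
Proof. by move=> bf; rewrite RintegralZl//; exact: bm_integrable. Qed.

Lemma Rintegral_bm_sum (I : Type) (s : seq I) (f : I -> T -> R) :
  (forall i, bounded_measurable (f i)) ->
  \int[mu]_(x in D) (\sum_(i <- s) f i x) =
  \sum_(i <- s) \int[mu]_(x in D) f i x.
Proof.
move=> bf; elim: s => [|i s IHs].
  rewrite big_nil; under eq_Rintegral do rewrite big_nil.
  by rewrite Rintegral_cst// mul0r.
rewrite big_cons -IHs -Rintegral_bmD//; last exact: bm_sum.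
by under eq_Rintegral do rewrite big_cons.
Qed.

Lemma le_Rintegral_bm f g : bounded_measurable f -> bounded_measurable g ->
  (forall x, D x -> f x <= g x) ->
  \int[mu]_(x in D) f x <= \int[mu]_(x in D) g x.
Proof. by move=> bf bg; apply: le_Rintegral => //; exact: bm_integrable. Qed.

Lemma norm_Rintegral_bm f g : bounded_measurable f -> bounded_measurable g ->
  (forall x, D x -> `|f x| <= g x) ->
  `|\int[mu]_(x in D) f x| <= \int[mu]_(x in D) g x.
Proof.
move=> bf bg fg.
apply: le_trans (le_normr_Rintegral mD (bm_integrable bf)) _.
by apply: le_Rintegral_bm => //; exact: bm_norm.
Qed.

End bounded_measurable.

Section bounded_measurable_test_fields.
Context {R : realType} {d : nat} (Omega : set 'rV[R]_d).
Variable p : 'rV[R]_d -> 'rV[R]_d.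
Hypothesis tp : test_field Omega p.

Lemma bm_divergence : bounded_measurable Omega (divergence p).
Proof.
have [M pM] := divergence_bounded tp; split; last by exists M.
apply: measurable_funTS; apply: continuous_rV_measurable.
exact: (@divergence_continuous _ _ _ _ tp).
Qed.

Lemma bm_test_field j : bounded_measurable Omega (fun x => p x 0 j).
Proof.
split; last by exists 1 => x _; exact: (test_field_le1 tp).
apply: measurable_funTS; apply: continuous_rV_measurable.
exact: (@test_field_continuous _ _ _ _ tp j).
Qed.

End bounded_measurable_test_fields.

Section fubini_swap.
Context {R : realType} {d1 d2 : measure_display}.
Context {T1 : measurableType d1} {T2 : measurableType d2}.
Variables (mu : {sigma_finite_measure set T1 -> \bar R}).
Variables (nu : {sigma_finite_measure set T2 -> \bar R}).
Variables (D : set T1) (E : set T2).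
Hypotheses (mD : measurable D) (muD : (mu D < +oo)%E) (mE : measurable E).
Variables (k : T1 -> T2 -> R) (w : T2 -> R).
Hypothesis mk : measurable_fun setT (fun p : T1 * T2 => k p.1 p.2).
Hypothesis iw : nu.-integrable E (EFin \o w).
Hypothesis kw : forall x t, D x -> E t -> `|k x t| <= w t.

Let mk1 t : measurable_fun setT (k ^~ t).
Proof. exact: (measurable_fun_pair1 t mk). Qed.

Let mk2 x : measurable_fun setT (k x).
Proof. exact: (measurable_fun_pair2 x mk). Qed.

Lemma kernel_integrable x : D x -> nu.-integrable E (EFin \o k x).
Proof.
move=> Dx; apply: le_integrable iw => //.
  by apply/measurable_EFinP; exact: measurable_funS (mk2 x).
by move=> t Et; rewrite lee_fin (le_trans (kw Dx Et))// ler_norm.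
Qed.

Section with_weight.
Variable q : T1 -> R.
Hypothesis bq : bounded_measurable D q.

(** Cutting off by [D] and [E] gives an integrand on the whole product, where Fubini's theorem is
    available; bounds on [q] and [k] hold only over [D] and [E]. *)
Let K (p : T1 * T2) : \bar R := ((q \_ D) p.1 * k p.1 p.2 * \1_E p.2)%:E.

Let mK : measurable_fun setT K.
Proof.
apply/measurable_EFinP; apply: measurable_funM; last first.
  by apply: measurableT_comp => //; exact: measurable_indic.
apply: measurable_funM => //.
have [/(measurable_restrictT _ mD) mq _] := bq.
exact: (measurableT_comp mq).
Qed.

Let bqk t : E t -> bounded_measurable D (fun x => q x * k x t).
Proof.
move=> Et; apply: bmM => //; split; first exact: measurable_funS (mk1 t).
by exists (w t) => x Dx; exact: kw.
Qed.

Let K2 t : (\int[mu]_x K (x, t))%E =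
  (((fun t => \int[mu]_(x in D) (q x * k x t)) \_ E) t)%:E.
Proof.
rewrite patchE; case: ifPn => [/set_mem Et|/negPf Et]; last first.
  by rewrite integral0_eq// => x _; rewrite /K/= indicE Et mulr0.
rewrite /Rintegral fineK; last first.
  by apply: integrable_fin_num => //; exact/bm_integrable/bqk.
rewrite [RHS]integral_mkcond; apply: eq_integral => x _.
rewrite /K/= indicE mem_set// mulr1 !patchE; case: ifPn => //.
by rewrite mul0r.
Qed.

Let K1 x : (\int[nu]_t K (x, t))%E =
  (((fun x => q x * \int[nu]_(t in E) k x t) \_ D) x)%:E.
Proof.
rewrite patchE; case: ifPn => [/set_mem Dx|/negPf Dx]; last first.
  by rewrite integral0_eq// => t _; rewrite /K/= patchE Dx !mul0r.
rewrite -RintegralZl//; last exact: kernel_integrable.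
rewrite /Rintegral fineK; last first.
  apply: integrable_fin_num => //.
  exact: eq_integrable (integrableZl mE (q x) (kernel_integrable Dx)).
rewrite [RHS]integral_mkcond; apply: eq_integral => t _.
rewrite /K/= indicE !patchE mem_set//; case: ifPn => /=; rewrite ?mulr1//.
by rewrite mulr0.
Qed.

Let iK : (mu \x nu)%E.-integrable setT K.
Proof.
apply/integrable21ltyP => //; have [mq [M qM]] := bq.
pose c t := `|M| * `|w t| * fine (mu D).
have cfin : mu D \is a fin_num by rewrite ge0_fin_numE.
have icE : nu.-integrable E (EFin \o c).
  have := integrableZl mE (`|M| * fine (mu D)) (integrable_norm iw).
  by apply: eq_integrable => // t _; rewrite /c/= -EFinM mulrAC.
have mc : measurable_fun E (EFin \o c) by exact: measurable_int icE.
apply: (@le_lt_trans _ _ (\int[nu]_(t in E) (c t)%:E)%E); last first.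
  move/integrableP : icE => [_]; apply: le_lt_trans.
  apply: ge0_le_integral => //.
  - by move=> t _; rewrite lee_fin !mulr_ge0 ?fine_ge0.
  - exact: measurableT_comp.
  - by move=> t _; rewrite lee_fin ler_norm.
rewrite [leRHS]integral_mkcond; apply: ge0_le_integral => //.
- by move=> t _; exact: integral_ge0.
- apply: (measurable_fun_fubini_tonelli_G (abse \o K)); first exact: measurableT_comp.
  by move=> x; exact: abse_ge0.
- exact: (measurable_restrictT _ mE).1.
move=> t _; rewrite patchE; case: ifPn => [/set_mem Et|/negPf Et]; last first.
  by rewrite integral0_eq// => x _; rewrite /K/= indicE Et mulr0 normr0.
rewrite /c EFinM fineK// -integral_cst// [leRHS]integral_mkcond.
apply: ge0_le_integral => //.
- by apply: measurableT_comp => //; exact: measurable_fun_pair1.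
- by apply/(measurable_restrictT _ mD).
move=> x _; rewrite patchE; case: ifPn => [/set_mem Dx|/negPf Dx]; last first.
  by rewrite /K/= patchE Dx !mul0r normr0.
rewrite /K/= patchE mem_set// indicE mem_set// mulr1 lee_fin normrM.
apply: ler_pM => //; first by rewrite (le_trans (qM x Dx))// ler_norm.
by rewrite (le_trans (kw Dx Et))// ler_norm.
Qed.

(** Serves twice: for the biases, with Lebesgue measure on [-1, 1] as [nu], and for the frequencies,
    with Lebesgue measure on R^d. *)
Lemma Rintegral_swap :
  \int[mu]_(x in D) (q x * \int[nu]_(t in E) k x t) =
  \int[nu]_(t in E) \int[mu]_(x in D) (q x * k x t).
Proof.
rewrite !(Rintegral_mkcond _ D) (Rintegral_mkcond _ E) /Rintegral.
under eq_integral do rewrite -K1.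
by under [in RHS]eq_integral do rewrite -K2; rewrite Fubini.
Qed.

Lemma measurable_kernel_weight :
  measurable_fun D (fun x => q x * \int[nu]_(t in E) k x t).
Proof.
apply/measurable_restrictT => //; apply/measurable_EFinP.
rewrite (_ : EFin \o _ = fun x => \int[nu]_t K (x, t))%E.
  exact: (measurable_fubini_F iK).
by apply/funext => x; rewrite /= K1.
Qed.

Lemma integrable_kernel_weight :
  nu.-integrable E (EFin \o (fun t => \int[mu]_(x in D) (q x * k x t))).
Proof.
have [mq [M qM]] := bq.
have iwM : nu.-integrable E (EFin \o (fun t => `|M| * fine (mu D) * `|w t|)) :=
  integrableZl mE (`|M| * fine (mu D)) (integrable_norm iw).
apply: le_integrable iwM => //.
  apply/(measurable_restrictT _ mE).
  rewrite (_ : _ \_ _ = fun t => \int[mu]_x K (x, t))%E.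
    exact: (measurable_fubini_G iK).
  by apply/funext => t; rewrite K2 restrict_EFin.
move=> t Et; rewrite lee_fin mulrAC [leRHS]ger0_norm; last first.
  by rewrite !mulr_ge0 ?fine_ge0.
rewrite -(Rintegral_cst mu mD); apply: norm_Rintegral_bm => //.
- exact: bqk.
- exact: bm_cst.
move=> x Dx; rewrite normrM; apply: ler_pM => //.
  by rewrite (le_trans (qM x Dx))// ler_norm.
by rewrite (le_trans (kw Dx Et))// ler_norm.
Qed.

End with_weight.

Lemma norm_kernel_le x : D x ->
  `|\int[nu]_(t in E) k x t| <= \int[nu]_(t in E) w t.
Proof.
move=> Dx; have ik := kernel_integrable Dx.
apply: le_trans (le_normr_Rintegral _ ik) _ => //.
apply: le_Rintegral => //; last by move=> t Et; exact: kw.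
exact: (integrable_norm ik).
Qed.

Lemma bm_kernel : bounded_measurable D (fun x => \int[nu]_(t in E) k x t).
Proof.
split; last by exists (\int[nu]_(t in E) w t); exact: norm_kernel_le.
have := measurable_kernel_weight (bm_cst D 1).
by under eq_fun do rewrite mul1r.
Qed.

End fubini_swap.

(** * Ridge functions and Barron functions *)

Section ridge_pairing.
Context {R : realType} {d : nat}.
Variable Omega : set 'rV[R]_d.
Hypothesis mO : measurable Omega.
Hypothesis Omega1 : forall x, Omega x -> forall j, `|x 0 j| <= 1.

Local Notation mu := (lebesgue_rV R d).
Local Notation bm := (bounded_measurable Omega).

Let muO : (mu Omega < +oo)%E.
Proof. exact: lebesgue_rV_bounded Omega1. Qed.

Lemma dotrV_le (w x : 'rV[R]_d) : Omega x -> `|dotrV w x| <= l1norm w.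
Proof.
move=> Ox; apply: le_trans (ler_norm_sum _ _ _) _; apply: ler_sum => j _.
by rewrite normrM ler_piMr// Omega1.
Qed.

Lemma bm_ridge (k : R -> R) (w : 'rV[R]_d) : continuous k ->
  bm (fun x => k (dotrV w x)).
Proof.
move=> ck; split.
  apply: measurable_funTS; apply: continuous_rV_measurable => x.
  by apply: continuous_comp; [exact: continuous_dotrV|exact: ck].
have /compact_bounded[M [_ kM]] : compact (k @` `[- l1norm w, l1norm w]).
  apply: continuous_compact; first exact: continuous_subspaceT.
  exact: segment_compact.
exists (`|M| + 1) => x Ox; apply: (kM (`|M| + 1)).
  by rewrite ltr_pwDr// ler_norm.
by exists (dotrV w x) => //; rewrite /= in_itv/= -ler_norml dotrV_le.
Qed.

Variables (q0 : 'rV[R]_d -> R) (q : 'I_d -> 'rV[R]_d -> R).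
Hypotheses (bq0 : bm q0) (bq : forall j, bm (q j)).

(** The inner product of pairs (function, gradient). With the accumulated error as weights it drives
    the greedy choice; with weights [divergence p] and [p], its vanishing for all test fields says
    that [G] is the weak gradient of [g]. *)
Definition pairing (g : 'rV[R]_d -> R) (G : 'I_d -> 'rV[R]_d -> R) : R :=
  \int[mu]_(x in Omega) (q0 x * g x + \sum_(j < d) q j x * G j x).

Definition ridge_pairing (w : 'rV[R]_d) (k k' : R -> R) : R :=
  pairing (fun x => k (dotrV w x)) (fun j x => w 0 j * k' (dotrV w x)).

Let Q (w x : 'rV[R]_d) : R := \sum_(j < d) q j x * w 0 j.

Lemma ridge_pairingE w k k' : ridge_pairing w k k' =
  \int[mu]_(x in Omega) (q0 x * k (dotrV w x) + Q w x * k' (dotrV w x)).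
Proof.
apply: eq_Rintegral => x _; congr (_ + _); rewrite /Q mulr_suml.
by apply: eq_bigr => j _; rewrite mulrA.
Qed.

Lemma bm_Q w : bm (Q w).
Proof. by apply: bm_sum => // j; apply: bmM => //; exact: bm_cst. Qed.

Variables (tau s Lambda : R).
Hypothesis tau0 : 0 < tau.
Hypothesis neuron_le : forall w b, l1norm w = 1 -> `|b| <= 1 ->
  `|ridge_pairing w (fun z => softplus tau (z + b)) (fun z => sigmoid tau (z + b))|
  <= s.
Hypothesis q_le : forall w, l1norm w = 1 ->
  \int[mu]_(x in Omega) (`|q0 x| + `|Q w x|) <= Lambda.

Variables (h h' h'' : R -> R) (M : R).
Hypothesis dh : forall z : R, is_derive z (1 : R) h (h' z).
Hypothesis dh' : forall z : R, is_derive z (1 : R) h' (h'' z).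
Hypothesis ch'' : continuous h''.
Hypothesis h''M : forall z, `|h'' z| <= M.

Let M0 : 0 <= M. Proof. exact: le_trans (h''M 0). Qed.

Let kernel_meas (k : R -> R) (w : 'rV[R]_d) : continuous k ->
  measurable_fun setT (fun p : 'rV[R]_d * R => h'' p.2 * k (dotrV w p.1 + -1 * p.2)).
Proof.
move=> ck; apply: measurable_funM.
  by apply: measurableT_comp => //; exact: continuous_measurable_fun.
apply: (measurableT_comp (f := k)); first exact: continuous_measurable_fun.
apply: measurable_funD.
  apply: (measurableT_comp (f := dotrV w)) => //.
  by apply: continuous_rV_measurable; exact: continuous_dotrV.
exact: measurable_funM.
Qed.

Let kernel_swap (k : R -> R) (w : 'rV[R]_d) (p : 'rV[R]_d -> R) :
  continuous k -> bm p ->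
  [/\ \int[mu]_(x in Omega) (p x * \int[lebesgue_measure]_(b in `[-1, 1])
        (h'' b * k (dotrV w x + -1 * b))) =
      \int[lebesgue_measure]_(b in `[-1, 1]) \int[mu]_(x in Omega)
        (p x * (h'' b * k (dotrV w x + -1 * b))),
      lebesgue_measure.-integrable `[-1, 1] (EFin \o (fun b =>
        \int[mu]_(x in Omega) (p x * (h'' b * k (dotrV w x + -1 * b))))) &
      bm (fun x => \int[lebesgue_measure]_(b in `[-1, 1])
        (h'' b * k (dotrV w x + -1 * b)))].
Proof.
move=> ck bp.
have [C kC] : exists C, forall z, `|z| <= l1norm w + 1 -> `|k z| <= C.
  have /compact_bounded[C [_ kC]] :
      compact (k @` `[- (l1norm w + 1), l1norm w + 1]).
    apply: continuous_compact; first exact: continuous_subspaceT.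
    exact: segment_compact.
  exists (`|C| + 1) => z zw; apply: (kC (`|C| + 1)).
    by rewrite ltr_pwDr// ler_norm.
  by exists z => //; rewrite /= in_itv/= -ler_norml.
have kw x b : Omega x -> `[-1, 1]%classic b ->
    `|h'' b * k (dotrV w x + -1 * b)| <= M * C.
  move=> Ox; rewrite /= in_itv/= -ler_norml => b1.
  rewrite normrM ler_pM// kC// (le_trans (ler_normD _ _))// lerD ?dotrV_le//.
  by rewrite mulN1r normrN.
have ic : lebesgue_measure.-integrable `[-1, 1] (EFin \o cst (M * C)).
  by apply: continuous_itv_integrable; exact: cst_continuous.
have mk := kernel_meas w ck; have mI : measurable (`[-1, 1]%classic : set R) by [].
pose kk x b := h'' b * k (dotrV w x + -1 * b).
split.
- exact: (@Rintegral_swap _ _ _ _ _ _ lebesgue_measure _ _ mO muO mI kk _ mk ic kw _ bp).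
- exact: (@integrable_kernel_weight _ _ _ _ _ _ lebesgue_measure _ _ mO muO mI kk _ mk ic kw _ bp).
- exact: (@bm_kernel _ _ _ _ _ _ lebesgue_measure _ _ mO muO mI kk _ mk ic kw).
Qed.

(** Without its constant part, [h] is a linear term, plus a superposition of neurons, plus a Taylor
    defect. The first two are controlled by [s]; the defect sees only the size [Lambda] of the
    weights, but carries a factor [tau^-1]. *)
Lemma ridge_pairing_le w : l1norm w = 1 ->
  `|ridge_pairing w (fun z => h z - (h (-1) + h' (-1))) h'|
  <= 2 * (`|h' (-1)| + M) * s + 2 * M / tau * Lambda.
Proof.
move=> w1.
have cSP : continuous (softplus tau) by exact: continuous_softplus.
have cSg : continuous (sigmoid tau) by exact: continuous_sigmoid.
have [swp0 ib0 bJ0] := kernel_swap w cSP bq0.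
have [swp1 ib1 bJ1] := kernel_swap w cSg (bm_Q w).
pose J0 x := \int[lebesgue_measure]_(b in `[-1, 1])
  (h'' b * softplus tau (dotrV w x + -1 * b)).
pose J1 x := \int[lebesgue_measure]_(b in `[-1, 1])
  (h'' b * sigmoid tau (dotrV w x + -1 * b)).
have {}bJ0 : bm J0 by exact: bJ0.
have {}bJ1 : bm J1 by exact: bJ1.
have bQ := bm_Q w.
have bz : bm (dotrV w) by exact: (@bm_ridge id w (fun z => cvg_id)).
have bh : bm (fun x => h (dotrV w x)).
  by apply: bm_ridge; exact: is_derive_continuous dh.
have bh' : bm (fun x => h' (dotrV w x)).
  by apply: bm_ridge; exact: is_derive_continuous dh'.
pose A x := q0 x * dotrV w x + Q w x.
pose B x := q0 x * J0 x + Q w x * J1 x.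
pose C x := q0 x * (h (dotrV w x) - (h (-1) + h' (-1)) - h' (-1) * dotrV w x - J0 x)
  + Q w x * (h' (dotrV w x) - h' (-1) - J1 x).
have bA : bm A by apply: bmD => //; exact: bmM.
have bB : bm B by apply: bmD; exact: bmM.
have bC : bm C.
  apply: bmD; apply: bmM => //; apply: bmB => //; apply: bmB => //.
  - by apply: bmB => //; exact: bm_cst.
  - exact: bmZ.
  - exact: bm_cst.
have -> : ridge_pairing w (fun z => h z - (h (-1) + h' (-1))) h' =
    h' (-1) * \int[mu]_(x in Omega) A x + \int[mu]_(x in Omega) B x
    + \int[mu]_(x in Omega) C x.
  have bhA : bm (fun x => h' (-1) * A x) by exact: bmZ.
  have bhAB : bm (fun x => h' (-1) * A x + B x) by exact: bmD.
  rewrite ridge_pairingE -Rintegral_bmZ// -!Rintegral_bmD//.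
  by apply: eq_Rintegral => x _; rewrite /A /B /C; ring.
have s0 : 0 <= s by apply: le_trans (neuron_le (b := 0) w1 _); rewrite ?normr0.
(* The linear ridge is the difference of the neurons of directions [w] and [- w] and bias 0: in
   value by [softplusB], in gradient by [sigmoidN]. *)
have A_le : `|\int[mu]_(x in Omega) A x| <= 2 * s.
  have Nw1 : l1norm (- w) = 1.
    by rewrite -w1; apply: eq_bigr => j _; rewrite mxE normrN.
  have zN x : dotrV (- w) x = - dotrV w x.
    by rewrite /dotrV -sumrN; apply: eq_bigr => j _; rewrite mxE mulNr.
  have QN x : Q (- w) x = - Q w x.
    by rewrite /Q -sumrN; apply: eq_bigr => j _; rewrite mxE mulrN.
  pose SP0 z := softplus tau (z + 0); pose Sg0 z := sigmoid tau (z + 0).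
  have cSP0 : continuous SP0 by rewrite /SP0; under eq_fun do rewrite addr0.
  have cSg0 : continuous Sg0 by rewrite /Sg0; under eq_fun do rewrite addr0.
  have bn v : bm (fun x => q0 x * SP0 (dotrV v x) + Q v x * Sg0 (dotrV v x)).
    by apply: bmD; apply: bmM; [|exact: bm_ridge|exact: bm_Q|exact: bm_ridge].
  have -> : \int[mu]_(x in Omega) A x =
      ridge_pairing w SP0 Sg0 - ridge_pairing (- w) SP0 Sg0.
    rewrite !ridge_pairingE -Rintegral_bmB//.
    apply: eq_Rintegral => x _; rewrite /A /SP0 /Sg0 zN QN !addr0 sigmoidN.
    by rewrite -{1}(softplusB tau0 (dotrV w x)); ring.
  rewrite mulr2n mulrDl mul1r (le_trans (ler_normB _ _))//.
  by apply: lerD; apply: neuron_le; rewrite ?normr0.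
(* After the exchange of integrals the integrand is [h'' b] times the pairing with the neuron of
   bias [- b]; the factor 2 is the length of [-1, 1]. *)
have B_le : `|\int[mu]_(x in Omega) B x| <= 2 * (M * s).
  rewrite Rintegral_bmD//; [|exact: bmM..].
  rewrite swp0 swp1.
  pose F0 b := \int[mu]_(x in Omega) (q0 x * (h'' b * softplus tau (dotrV w x + -1 * b))).
  pose F1 b := \int[mu]_(x in Omega) (Q w x * (h'' b * sigmoid tau (dotrV w x + -1 * b))).
  have mI : measurable (`[-1, 1]%classic : set R) by [].
  have iB : lebesgue_measure.-integrable `[-1, 1] (EFin \o (fun b => F0 b + F1 b)).
    exact: integrableD ib0 ib1.
  rewrite -[leLHS]/(`|\int[lebesgue_measure]_(b in `[-1, 1]) F0 b
    + \int[lebesgue_measure]_(b in `[-1, 1]) F1 b|) -RintegralD//.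
  apply: le_trans (le_normr_Rintegral _ iB) _ => //.
  rewrite (_ : 2 * (M * s) = M * s * (1 - -1)); last by ring.
  rewrite -Rintegral_itv_cst; last by lra.
  apply: le_Rintegral => //.
  - exact: (integrable_norm iB).
  - by apply: continuous_itv_integrable; exact: cst_continuous.
  move=> b; rewrite /= in_itv/= -ler_norml => b1.
  have cshift (k : R -> R) : continuous k -> continuous (fun z => k (z + -1 * b)).
    move=> ck z; apply: (@continuous_comp _ _ _ (fun z => z + -1 * b) k).
      by apply: cvgD; [exact: cvg_id|exact: cvg_cst].
    exact: ck.
  have -> : F0 b + F1 b = h'' b * ridge_pairing w
      (fun z => softplus tau (z + -1 * b)) (fun z => sigmoid tau (z + -1 * b)).
    have b0 : bm (fun x => softplus tau (dotrV w x + -1 * b)).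
      exact: (bm_ridge w (cshift _ cSP)).
    have b1' : bm (fun x => sigmoid tau (dotrV w x + -1 * b)).
      exact: (bm_ridge w (cshift _ cSg)).
    rewrite ridge_pairingE -Rintegral_bmZ//; last by apply: bmD; exact: bmM.
    rewrite /F0 /F1 -Rintegral_bmD//; [|by apply: bmM => //; exact: bmZ..].
    by apply: eq_Rintegral => x _; ring.
  by rewrite normrM ler_pM// neuron_le// mulN1r normrN.
have C_le : `|\int[mu]_(x in Omega) C x| <= 2 * M / tau * Lambda.
  apply: (@le_trans _ _ (2 * M / tau *
      \int[mu]_(x in Omega) (`|q0 x| + `|Q w x|))).
    have bqQ : bm (fun x => `|q0 x| + `|Q w x|) by apply: bmD; exact: bm_norm.
    rewrite -Rintegral_bmZ//; apply: norm_Rintegral_bm => //; first exact: bmZ.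
    move=> x Ox; have zx : -1 <= dotrV w x <= 1.
      by rewrite -ler_norml -w1 dotrV_le.
    rewrite mulrDr (le_trans (ler_normD _ _))// !normrM mulrC [in leRHS]addrC.
    rewrite [in leRHS]addrC.
    apply: lerD; last rewrite mulrC; apply: ler_wpM2r => //.
      exact: softplus_repr.
    exact: softplus_repr_deriv.
  by rewrite ler_wpM2l ?q_le// !mulr_ge0// invr_ge0 ltW.
rewrite (le_trans (ler_normD _ _))// lerD// (le_trans (ler_normD _ _))//.
rewrite mulrDr mulrDl -[2 * M * s]mulrA lerD//.
by rewrite normrM -mulrA mulrCA ler_wpM2l.
Qed.

End ridge_pairing.

(** * Plane waves as ridge functions *)

Section ridge_wave.
Context {R : realType}.
Variables (l A C : R).
Hypothesis l0 : 0 <= l.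

(** The real part of [exp (i l z) (A + i C)]: one frequency of l^1 norm [l], seen along its
    normalized direction. [amplitude] is the modulus of [A + i C]. *)
Definition wave (z : R) := cos (l * z) * A - sin (l * z) * C.
Definition wave' (z : R) := - l * (sin (l * z) * A + cos (l * z) * C).
Definition wave'' (z : R) := - l ^+ 2 * wave z.
Definition amplitude := Num.sqrt (A ^+ 2 + C ^+ 2).

Let dcos (z : R) : is_derive z (1 : R) (fun z => cos (l * z)) (- l * sin (l * z)).
Proof.
have := @is_derive_comp_affine R cos _ l 0 z (is_derive_cos _).
by under eq_fun do rewrite addr0; rewrite addr0 mulrN -mulNr.
Qed.

Let dsin (z : R) : is_derive z (1 : R) (fun z => sin (l * z)) (l * cos (l * z)).
Proof.
have := @is_derive_comp_affine R sin _ l 0 z (is_derive_sin _).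
by under eq_fun do rewrite addr0; rewrite addr0.
Qed.

Lemma is_derive_wave (z : R) : is_derive z (1 : R) wave (wave' z).
Proof.
have d := is_deriveB (is_deriveM (dcos z) (is_derive_cst A z (1 : R)))
  (is_deriveM (dsin z) (is_derive_cst C z (1 : R))).
by apply: (is_derive_eq d); rewrite /wave' /GRing.scale/=; ring.
Qed.

Lemma is_derive_wave' (z : R) : is_derive z (1 : R) wave' (wave'' z).
Proof.
have d := is_deriveZ (- l) (is_deriveD (is_deriveM (dsin z) (is_derive_cst A z (1 : R)))
  (is_deriveM (dcos z) (is_derive_cst C z (1 : R)))).
by apply: (is_derive_eq d); rewrite /wave'' /wave /GRing.scale/=; ring.
Qed.

Lemma continuous_wave'' : continuous wave''.
Proof.
apply: (@is_derive_continuous _ _ (fun z => - l ^+ 2 * wave' z)) => z.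
exact: is_deriveZ (is_derive_wave z).
Qed.

(** Cauchy-Schwarz in the plane, with defect [(c * v - s * u) ^+ 2]. *)
Let norm_rotation (c s u v : R) : c ^+ 2 + s ^+ 2 = 1 ->
  `|c * u + s * v| <= Num.sqrt (u ^+ 2 + v ^+ 2).
Proof.
move=> cs; rewrite -sqrtr_sqr ler_wsqrtr//.
rewrite -[leRHS]mul1r -cs -subr_ge0.
rewrite (_ : _ - _ = (c * v - s * u) ^+ 2) ?sqr_ge0//; ring.
Qed.

Lemma amplitude_ge0 : 0 <= amplitude. Proof. exact: sqrtr_ge0. Qed.

Lemma norm_wave z : `|wave z| <= amplitude.
Proof. by rewrite /wave -mulNr norm_rotation// sqrrN cos2Dsin2. Qed.

Lemma norm_wave' z : `|wave' z| <= l * amplitude.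
Proof.
rewrite /wave' normrM normrN (ger0_norm l0); apply: ler_wpM2l => //.
by apply: norm_rotation; rewrite addrC cos2Dsin2.
Qed.

Lemma norm_wave'' z : `|wave'' z| <= l ^+ 2 * amplitude.
Proof.
rewrite /wave'' normrM normrN (ger0_norm (sqr_ge0 l)).
by apply: ler_wpM2l; [exact: sqr_ge0|exact: norm_wave].
Qed.

End ridge_wave.

Section Rintegral_sum.
Context {R : realType} {dT : measure_display} {T : measurableType dT}.
Variables (mu : {measure set T -> \bar R}) (D : set T).
Hypothesis mD : measurable D.

Lemma integrable_Rsum (I : Type) (s : seq I) (f : I -> T -> R) :
  (forall i, mu.-integrable D (EFin \o f i)) ->
  mu.-integrable D (EFin \o (fun x => \sum_(i <- s) f i x)).
Proof.
move=> fi; have := integrable_sum mD s (P := xpredT) (fun i _ => fi i).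
by apply: eq_integrable => // x _; rewrite /= sumEFin.
Qed.

Lemma Rintegral_sum (I : Type) (s : seq I) (f : I -> T -> R) :
  (forall i, mu.-integrable D (EFin \o f i)) ->
  \int[mu]_(x in D) (\sum_(i <- s) f i x) =
  \sum_(i <- s) \int[mu]_(x in D) f i x.
Proof.
move=> fi; elim: s => [|i s IHs].
  rewrite big_nil; under eq_Rintegral do rewrite big_nil.
  by rewrite Rintegral_cst// mul0r.
rewrite big_cons -IHs -RintegralD//; last exact: integrable_Rsum.
by under eq_Rintegral do rewrite big_cons.
Qed.

End Rintegral_sum.

Section barron_pairing.
Context {R : realType} {d : nat}.
Hypothesis d0 : (0 < d)%N.
Local Notation mu := (lebesgue_rV R d).
Variables (A C : 'rV[R]_d -> R) (W : R).
Hypotheses (mA : measurable_fun setT A) (mC : measurable_fun setT C).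

Let rho w := amplitude (A w) (C w).
Let weight w := (1 + l1norm w) ^+ 2 * rho w.
Hypothesis weight_le : (\int[mu]_w (weight w)%:E <= W%:E)%E.

Let l1norm_ge0 (w : 'rV[R]_d) : 0 <= l1norm w. Proof. exact: sumr_ge0. Qed.

Let rho_ge0 w : 0 <= rho w. Proof. exact: amplitude_ge0. Qed.

Let weight_ge0 w : 0 <= weight w.
Proof. by rewrite mulr_ge0// sqr_ge0. Qed.

Let m_l1norm : measurable_fun setT (@l1norm R d).
Proof.
apply: measurable_sum => j; apply: measurableT_comp => //.
exact: measurable_fun_coord.
Qed.

Let m_weight : measurable_fun setT weight.
Proof.
apply: measurable_funM.
  by apply: measurable_funX; exact: measurable_funD.
apply: (measurableT_comp (f := @Num.sqrt R)).
  by apply: continuous_measurable_fun; exact: sqrt_continuous.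
by apply: measurable_funD; exact: measurable_funX.
Qed.

Let i_weight : mu.-integrable setT (EFin \o weight).
Proof.
apply/integrableP; split; first exact/measurable_EFinP.
under eq_integral do rewrite /= ger0_norm//.
exact: le_lt_trans weight_le (ltry _).
Qed.

Let Rint_weight : \int[mu]_w weight w <= W.
Proof.
rewrite -lee_fin /Rintegral fineK//; exact: integrable_fin_num i_weight.
Qed.

(* The waves are expanded at [-1], so that all biases lie in [-1, 1]; this is
   the constant part of [h (-1) + h' (-1) * (z + 1)]. *)
Definition barron_offset w :=
  wave (l1norm w) (A w) (C w) (-1) + wave' (l1norm w) (A w) (C w) (-1).

Definition barron_kernel (x w : 'rV[R]_d) :=
  cos (dotrV w x) * A w - sin (dotrV w x) * C w - barron_offset w.

Definition barron_kernel' (j : 'I_d) (x w : 'rV[R]_d) :=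
  - w 0 j * (sin (dotrV w x) * A w + cos (dotrV w x) * C w).

Definition barron_fun x := \int[mu]_w barron_kernel x w.
Definition barron_grad j x := \int[mu]_w barron_kernel' j x w.

(** The zero frequency has no direction, and any vector of l^1 norm 1 serves there, since only the
    product [l1norm w * dir w] enters the kernels; [d0] supplies one. *)
Let dir (w : 'rV[R]_d) : 'rV[R]_d :=
  if l1norm w == 0 then delta_mx 0 (Ordinal d0) else (l1norm w)^-1 *: w.

Let l1norm0 (w : 'rV[R]_d) : l1norm w = 0 -> forall j, w 0 j = 0.
Proof.
move=> /eqP; rewrite psumr_eq0// => /allP w0 j; apply/eqP.
by rewrite -normr_eq0; apply: (w0 j); rewrite mem_index_enum.
Qed.

Let l1norm_dir w : l1norm (dir w) = 1.
Proof.
rewrite /dir; case: ifPn => [_|w0]; first exact: l1norm_delta.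
rewrite /l1norm; under eq_bigr do rewrite mxE normrM.
by rewrite -mulr_sumr gtr0_norm ?mulVf// invr_gt0 lt_def w0 l1norm_ge0.
Qed.

Let dirE (w : 'rV[R]_d) (j : 'I_d) : l1norm w * dir w 0 j = w 0 j.
Proof.
rewrite /dir; case: ifPn => [/eqP w0|w0]; first by rewrite w0 mul0r l1norm0.
by rewrite mxE mulrA divff// mul1r.
Qed.

Let dotrV_dir w x : l1norm w * dotrV (dir w) x = dotrV w x.
Proof. by rewrite /dotrV mulr_sumr; apply: eq_bigr => j _; rewrite mulrA dirE. Qed.

Lemma barron_kernelE x w : barron_kernel x w =
  wave (l1norm w) (A w) (C w) (dotrV (dir w) x) - barron_offset w.
Proof. by rewrite /wave dotrV_dir. Qed.

Lemma barron_kernel'E j x w : barron_kernel' j x w =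
  dir w 0 j * wave' (l1norm w) (A w) (C w) (dotrV (dir w) x).
Proof. by rewrite /wave' dotrV_dir mulrA mulrN [dir w 0 j * _]mulrC dirE. Qed.

Lemma norm_barron_offset w : `|barron_offset w| <= weight w.
Proof.
rewrite (le_trans (ler_normD _ _))//.
have := norm_wave (l1norm w) (A w) (C w) (-1).
have := norm_wave' (A w) (C w) (l1norm_ge0 w) (-1).
rewrite -/(rho w) /weight; have := l1norm_ge0 w; have := rho_ge0 w.
by set r := rho w; set l := l1norm w => *; nra.
Qed.

Lemma norm_barron_kernel x w : `|barron_kernel x w| <= 2 * weight w.
Proof.
rewrite barron_kernelE (le_trans (ler_normB _ _))// mulr2n mulrDl mul1r.
rewrite lerD ?norm_barron_offset// (le_trans (norm_wave _ _ _ _))//.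
by rewrite -/(rho w) /weight; apply: ler_peMl => //; rewrite exprn_ege1// lerDl.
Qed.

Lemma norm_barron_kernel' j x (w : 'rV[R]_d) : `|barron_kernel' j x w| <= `|w 0 j| * rho w.
Proof.
rewrite /barron_kernel' normrM normrN ler_wpM2l//.
have := norm_wave' (A w) (C w) ler01 (dotrV w x).
by rewrite /wave' !mul1r mulN1r normrN.
Qed.

Let coord_le (w : 'rV[R]_d) (j : 'I_d) : `|w 0 j| <= l1norm w.
Proof. by rewrite /l1norm (bigD1 j)//= lerDl sumr_ge0. Qed.

Let l1rho_le w : l1norm w * rho w <= weight w.
Proof.
rewrite ler_wpM2r//; have := l1norm_ge0 w; nra.
Qed.

Let norm_barron_kernel'2 j x w : `|barron_kernel' j x w| <= 2 * weight w.
Proof.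
rewrite (le_trans (norm_barron_kernel' _ _ _))//.
apply: (@le_trans _ _ (weight w)); last by rewrite ler_peMl// ler1n.
by apply: le_trans (l1rho_le w); rewrite ler_wpM2r.
Qed.

Let m_dotrV : measurable_fun setT (fun p : 'rV[R]_d * 'rV[R]_d => dotrV p.2 p.1).
Proof.
apply: measurable_sum => j; apply: measurable_funM.
  by apply: (measurableT_comp (measurable_fun_coord j)).
by apply: (measurableT_comp (measurable_fun_coord j)).
Qed.

Let measurable_trig (k : R -> R) : continuous k ->
  measurable_fun setT (fun p : 'rV[R]_d * 'rV[R]_d => k (dotrV p.2 p.1)).
Proof.
by move=> ck; apply: (measurableT_comp (f := k)) => //; exact: continuous_measurable_fun.
Qed.

Let m_offset : measurable_fun setT barron_offset.
Proof.
have mcos : measurable_fun setT (fun w : 'rV[R]_d => cos (l1norm w * -1)).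
  apply: (measurableT_comp (f := cos)).
    by apply: continuous_measurable_fun; exact: continuous_cos.
  exact: measurable_funM.
have msin : measurable_fun setT (fun w : 'rV[R]_d => sin (l1norm w * -1)).
  apply: (measurableT_comp (f := sin)).
    by apply: continuous_measurable_fun; exact: continuous_sin.
  exact: measurable_funM.
have mN : measurable_fun setT (fun w : 'rV[R]_d => - l1norm w).
  exact: measurableT_comp.
apply: measurable_funD; first by apply: measurable_funB; exact: measurable_funM.
apply: measurable_funM => //.
by apply: measurable_funD; exact: measurable_funM.
Qed.

Let m_kernel : measurable_fun setT
  (fun p : 'rV[R]_d * 'rV[R]_d => barron_kernel p.1 p.2).
Proof.
apply: measurable_funB; last exact: (measurableT_comp m_offset).
apply: measurable_funB; apply: measurable_funM.
- by apply: measurable_trig; exact: continuous_cos.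
- exact: (measurableT_comp mA).
- by apply: measurable_trig; exact: continuous_sin.
- exact: (measurableT_comp mC).
Qed.

Let m_kernel' j : measurable_fun setT
  (fun p : 'rV[R]_d * 'rV[R]_d => barron_kernel' j p.1 p.2).
Proof.
apply: measurable_funM.
  apply: measurableT_comp => //.
  exact: (measurableT_comp (measurable_fun_coord j)).
apply: measurable_funD; apply: measurable_funM.
- by apply: measurable_trig; exact: continuous_sin.
- exact: (measurableT_comp mA).
- by apply: measurable_trig; exact: continuous_cos.
- exact: (measurableT_comp mC).
Qed.

Let i_weight2 : mu.-integrable setT (EFin \o (fun w => 2 * weight w)).
Proof. exact: (integrableZl measurableT 2 i_weight). Qed.

Let i_kernel x : mu.-integrable setT (EFin \o barron_kernel x).
Proof.
exact: (@kernel_integrable _ _ _ _ _ mu setT setT measurableT barron_kernel _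
  m_kernel i_weight2 (fun x w _ _ => norm_barron_kernel x w) x I).
Qed.

Let i_kernel' j x : mu.-integrable setT (EFin \o barron_kernel' j x).
Proof.
exact: (@kernel_integrable _ _ _ _ _ mu setT setT measurableT (barron_kernel' j) _
  (m_kernel' j) i_weight2 (fun x w _ _ => norm_barron_kernel'2 j x w) x I).
Qed.

Lemma norm_barron_fun x : `|barron_fun x| <= 2 * W.
Proof.
apply: le_trans (le_normr_Rintegral measurableT (i_kernel x)) _.
apply: (@le_trans _ _ (\int[mu]_w (2 * weight w))).
  by apply: le_Rintegral => // [|w _]; [exact: (integrable_norm (i_kernel x))|
    exact: norm_barron_kernel].
by rewrite RintegralZl// ler_wpM2l.
Qed.

(** The sum over [j] is taken under the integral, where it yields [l1norm w * rho w]; bounding each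
    component by [W] would cost a factor [d]. *)
Lemma sum_norm_barron_grad x : \sum_(j < d) `|barron_grad j x| <= W.
Proof.
have i_rho j : mu.-integrable setT (EFin \o (fun w : 'rV[R]_d => `|w 0 j| * rho w)).
  apply: le_integrable i_weight => //.
    apply/measurable_EFinP; apply: measurable_funM.
      by apply: measurableT_comp => //; exact: measurable_fun_coord.
    apply: (measurableT_comp (f := @Num.sqrt R)).
      by apply: continuous_measurable_fun; exact: sqrt_continuous.
    by apply: measurable_funD; exact: measurable_funX.
  move=> w _; rewrite lee_fin (ger0_norm (weight_ge0 w)) normrM normr_id.
  rewrite (ger0_norm (rho_ge0 w)).
  by apply: le_trans (l1rho_le w); rewrite ler_wpM2r.
apply: (@le_trans _ _ (\sum_(j < d) \int[mu]_w (`|w 0 j| * rho w))).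
  apply: ler_sum => j _.
  apply: le_trans (le_normr_Rintegral measurableT (i_kernel' j x)) _.
  by apply: le_Rintegral => // [|w _]; [exact: (integrable_norm (i_kernel' j x))|
    exact: norm_barron_kernel'].
rewrite -Rintegral_sum//; apply: le_trans Rint_weight.
apply: le_Rintegral => //; first exact: integrable_Rsum.
by move=> w _; rewrite -mulr_suml; exact: l1rho_le.
Qed.

Lemma barron_offset_integrable : mu.-integrable setT (EFin \o barron_offset).
Proof.
apply: le_integrable i_weight => //; first exact/measurable_EFinP.
move=> w _; rewrite lee_fin (le_trans (norm_barron_offset w))// ler_norm//.
Qed.

Lemma norm_Rintegral_offset : `|\int[mu]_w barron_offset w| <= W.
Proof.
apply: le_trans (le_normr_Rintegral measurableT barron_offset_integrable) _.
apply: le_trans Rint_weight; apply: le_Rintegral => //.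
  exact: (integrable_norm barron_offset_integrable).
by move=> w _; exact: norm_barron_offset.
Qed.

Lemma barron_funE x : \int[mu]_w (cos (dotrV w x) * A w - sin (dotrV w x) * C w)
  = \int[mu]_w barron_offset w + barron_fun x.
Proof.
rewrite addrC -RintegralD//; last exact: barron_offset_integrable.
by apply: eq_Rintegral => w _; rewrite /barron_kernel subrK.
Qed.

Section on_domain.
Variable Omega : set 'rV[R]_d.
Hypothesis mO : measurable Omega.
Hypothesis Omega1 : forall x, Omega x -> forall j, `|x 0 j| <= 1.
Local Notation bm := (bounded_measurable Omega).

Let muO : (mu Omega < +oo)%E.
Proof. exact: lebesgue_rV_bounded Omega1. Qed.

Lemma bm_barron_fun : bm barron_fun.
Proof.
exact: (@bm_kernel _ _ _ _ _ mu mu Omega setT mO muO measurableT barron_kernel _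
  m_kernel i_weight2 (fun x w _ _ => norm_barron_kernel x w)).
Qed.

Lemma bm_barron_grad j : bm (barron_grad j).
Proof.
exact: (@bm_kernel _ _ _ _ _ mu mu Omega setT mO muO measurableT (barron_kernel' j) _
  (m_kernel' j) i_weight2 (fun x w _ _ => norm_barron_kernel'2 j x w)).
Qed.

Variables (q0 : 'rV[R]_d -> R) (q : 'I_d -> 'rV[R]_d -> R).
Hypotheses (bq0 : bm q0) (bq : forall j, bm (q j)).

Let rp w := ridge_pairing Omega q0 q (dir w)
  (fun z => wave (l1norm w) (A w) (C w) z - barron_offset w)
  (wave' (l1norm w) (A w) (C w)).

Let rpE w : rp w = \int[mu]_(x in Omega) (q0 x * barron_kernel x w) +
  \sum_(j < d) \int[mu]_(x in Omega) (q j x * barron_kernel' j x w).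
Proof.
have bk0 : bm (fun x => barron_kernel x w).
  split; last by exists (2 * weight w) => x _; exact: norm_barron_kernel.
  by apply: measurable_funTS; exact: (measurable_fun_pair1 w m_kernel).
have bk j : bm (fun x => barron_kernel' j x w).
  split; last by exists (2 * weight w) => x _; exact: norm_barron_kernel'2.
  by apply: measurable_funTS; exact: (measurable_fun_pair1 w (m_kernel' j)).
rewrite -Rintegral_bm_sum//; last by move=> j; exact: bmM.
rewrite -Rintegral_bmD//; last 2 first.
- exact: bmM.
- by apply: bm_sum => // j; exact: bmM.
apply: eq_Rintegral => x _; rewrite barron_kernelE; congr (_ + _).
by apply: eq_bigr => j _; rewrite barron_kernel'E.
Qed.

Let swap0 := (@Rintegral_swap _ _ _ _ _ mu mu Omega setT mO muO measurableT
  barron_kernel _ m_kernel i_weight2 (fun x w _ _ => norm_barron_kernel x w) _ bq0).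
Let iswap0 := (@integrable_kernel_weight _ _ _ _ _ mu mu Omega setT mO muO measurableT
  barron_kernel _ m_kernel i_weight2 (fun x w _ _ => norm_barron_kernel x w) _ bq0).
Let swapj j := (@Rintegral_swap _ _ _ _ _ mu mu Omega setT mO muO measurableT
  (barron_kernel' j) _ (m_kernel' j) i_weight2
  (fun x w _ _ => norm_barron_kernel'2 j x w) _ (bq j)).
Let iswapj j := (@integrable_kernel_weight _ _ _ _ _ mu mu Omega setT mO muO measurableT
  (barron_kernel' j) _ (m_kernel' j) i_weight2
  (fun x w _ _ => norm_barron_kernel'2 j x w) _ (bq j)).

Let i_rp : mu.-integrable setT (EFin \o rp).
Proof.
have := integrableD measurableT iswap0 (integrable_Rsum measurableT (index_enum 'I_d) iswapj).
by apply: eq_integrable => // w _; rewrite /= rpE.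
Qed.

Lemma barron_pairingE :
  pairing Omega q0 q barron_fun barron_grad = \int[mu]_w rp w.
Proof.
transitivity (\int[mu]_(x in Omega) (q0 x * barron_fun x) +
    \sum_(j < d) \int[mu]_(x in Omega) (q j x * barron_grad j x)).
  rewrite -Rintegral_bm_sum//; last by move=> j; apply: bmM => //; exact: bm_barron_grad.
  rewrite -Rintegral_bmD//; first by apply: bmM => //; exact: bm_barron_fun.
  by apply: bm_sum => // j; apply: bmM => //; exact: bm_barron_grad.
rewrite [X in X + _]swap0; under eq_bigr do rewrite swapj.
rewrite -Rintegral_sum// -RintegralD//; last exact: integrable_Rsum.
by apply: eq_Rintegral => w _; rewrite rpE.
Qed.

(** The support function inequality. It stands for membership, up to an error in [tau^-1], in
    [2 * W] times the symmetric closed convex hull of the neurons of amplitude 1. *)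
Lemma barron_pairing_le (tau s Lambda : R) : 0 < tau ->
  (forall w b, l1norm w = 1 -> `|b| <= 1 ->
    `|ridge_pairing Omega q0 q w (fun z => softplus tau (z + b))
      (fun z => sigmoid tau (z + b))| <= s) ->
  (forall w : 'rV[R]_d, l1norm w = 1 ->
    \int[mu]_(x in Omega) (`|q0 x| + `|\sum_(j < d) q j x * w 0 j|) <= Lambda) ->
  `|pairing Omega q0 q barron_fun barron_grad| <= W * (2 * s + 2 / tau * Lambda).
Proof.
move=> tau0 neuron_le q_le.
have s0 : 0 <= s.
  by apply: le_trans (neuron_le (dir 0) 0 (l1norm_dir 0) _); rewrite ?normr0.
have L0 : 0 <= Lambda.
  by apply: le_trans (q_le (dir 0) (l1norm_dir 0)); apply: Rintegral_ge0 => x _.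
have K0 : 0 <= 2 * s + 2 / tau * Lambda.
  by rewrite addr_ge0// !mulr_ge0// invr_ge0 ltW.
rewrite barron_pairingE.
apply: le_trans (le_normr_Rintegral measurableT i_rp) _.
apply: (@le_trans _ _ (\int[mu]_w (weight w * (2 * s + 2 / tau * Lambda)))); last first.
  by rewrite RintegralZr// ler_wpM2r.
apply: le_Rintegral => //; first exact: (integrable_norm i_rp).
  exact: (integrableZr measurableT (2 * s + 2 / tau * Lambda) i_weight).
move=> w _; pose M := l1norm w ^+ 2 * rho w.
have := @ridge_pairing_le _ _ Omega mO Omega1 q0 q bq0 bq tau s Lambda tau0
  neuron_le q_le _ _ _ M (is_derive_wave (l1norm w) (A w) (C w))
  (is_derive_wave' (l1norm w) (A w) (C w)) (@continuous_wave'' _ _ _ _)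
  (norm_wave'' _ _ _) (dir w) (l1norm_dir w).
move/le_trans; apply.
(* Slope at most [l * rho] and curvature at most [l ^+ 2 * rho]: the square in the Barron weight
   pays for the second derivative. *)
have h1 : `|wave' (l1norm w) (A w) (C w) (-1)| + M <= weight w.
  rewrite (le_trans (lerD (norm_wave' _ _ (l1norm_ge0 w) _) (lexx _)))//.
  rewrite /M /weight -/(rho w); have := l1norm_ge0 w; have := rho_ge0 w.
  by set r := rho w; set l := l1norm w => *; nra.
have h2 : M <= weight w by apply: le_trans h1; rewrite lerDr.
rewrite [leRHS]mulrDr; apply: lerD.
  rewrite (_ : weight w * (2 * s) = 2 * weight w * s); last by ring.
  by rewrite ler_wpM2r// ler_wpM2l.
rewrite (_ : weight w * (2 / tau * Lambda) = 2 * weight w / tau * Lambda); last by ring.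
apply: ler_wpM2r => //; apply: ler_wpM2r; first by rewrite invr_ge0 ltW.
by rewrite ler_wpM2l.
Qed.

End on_domain.

Lemma barron_pairing_test (Omega : set 'rV[R]_d) (p : 'rV[R]_d -> 'rV[R]_d) :
  open Omega -> (forall x, Omega x -> forall j, `|x 0 j| <= 1) ->
  test_field Omega p ->
  pairing Omega (divergence p) (fun j x => p x 0 j) barron_fun barron_grad = 0.
Proof.
move=> oO Omega1 tp; have mO : measurable Omega by exact: open_rV_measurable.
rewrite (barron_pairingE mO Omega1).
- transitivity (\int[mu]_w (0 : R)); last by rewrite Rintegral_cst// mul0r.
  apply: eq_Rintegral => w _.
  rewrite ridge_pairingE.
  apply: (@ridge_ibp _ _ (fun z => wave (l1norm w) (A w) (C w) z - barron_offset w)) => //.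
    move=> z; have dz := is_deriveB (is_derive_wave (l1norm w) (A w) (C w) z)
      (is_derive_cst (barron_offset w) z (1 : R)).
    by apply: (is_derive_eq dz); rewrite subr0.
  exact: is_derive_continuous (is_derive_wave' _ _ _).
- exact: bm_divergence tp.
- by move=> j; exact: (bm_test_field tp j).
Qed.

End barron_pairing.

(** * Greedy choice of the neurons *)

Section sums.
Context {R : realType}.

Lemma sum_sqr_le n (v : 'I_n -> R) : \sum_j v j ^+ 2 <= (\sum_j `|v j|) ^+ 2.
Proof.
rewrite [leRHS]expr2 mulr_suml; apply: ler_sum => j _.
rewrite -real_normK ?num_real// expr2 ler_wpM2l//.
by rewrite (bigD1 j)//= lerDl sumr_ge0.
Qed.

(** Replaces Cauchy-Schwarz on a domain of measure 1: integrated with [T] a bound on the L^2 norm,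
    it bounds the L^1 norm by [T]. *)
Lemma norm_le_amgm (u T : R) : 0 < T -> `|u| <= (u ^+ 2 / T + T) / 2.
Proof.
move=> T0; rewrite ler_pdivlMr// -(ler_pM2r T0) mulrDl divfK ?gt_eqF//.
rewrite -[u ^+ 2]real_normK ?num_real// -subr_ge0.
by rewrite (_ : _ - _ = (`|u| - T) ^+ 2) ?sqr_ge0//; ring.
Qed.

(** The product is at most the l^1 norm of [w] times the sup norm of [v], and the latter is at most
    the l^2 norm. *)
Lemma dotrV_sqr_le d (w v : 'rV[R]_d) : l1norm w = 1 ->
  dotrV w v ^+ 2 <= \sum_(j < d) v 0 j ^+ 2.
Proof.
move=> w1; set r := \sum_(j < d) _.
have r0 : 0 <= r by apply: sumr_ge0 => j _; exact: sqr_ge0.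
have vr j : `|v 0 j| <= Num.sqrt r.
  rewrite -sqrtr_sqr ler_wsqrtr// /r (bigD1 j)//= lerDl sumr_ge0// => k _.
  exact: sqr_ge0.
rewrite -(sqr_sqrtr r0) -[dotrV w v ^+ 2]real_normK ?num_real//.
rewrite ler_sqr ?nnegrE ?sqrtr_ge0//.
rewrite -[leRHS]mul1r -w1 /l1norm mulr_suml.
apply: le_trans (ler_norm_sum _ _ _) _; apply: ler_sum => j _.
by rewrite normrM ler_wpM2l.
Qed.

End sums.

Section greedy.
Context {R : realType} {d : nat}.
Hypothesis d0 : (0 < d)%N.
Local Notation mu := (lebesgue_rV R d).
Variable Omega : set 'rV[R]_d.
Hypothesis mO : measurable Omega.
Hypothesis Omega1 : forall x, Omega x -> forall j, `|x 0 j| <= 1.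
Hypothesis vol1 : mu Omega = 1%E.
Local Notation bm := (bounded_measurable Omega).

Let muO : (mu Omega < +oo)%E. Proof. by rewrite vol1 ltry. Qed.

Variables (m : nat) (W : R).
Hypotheses (m0 : (0 < m)%N) (W0 : 0 < W).
Let tau : R := Num.sqrt m%:R.

Let tau1 : 1 <= tau.
Proof. by rewrite -[leLHS]sqrtr1 ler_wsqrtr// ler1n. Qed.

Let tau0 : 0 < tau. Proof. exact: lt_le_trans tau1. Qed.

Variables (f : 'rV[R]_d -> R) (U : 'I_d -> 'rV[R]_d -> R).
Hypotheses (bf : bm f) (bU : forall j, bm (U j)).
Hypotheses (f_le : forall x, `|f x| <= 2 * W)
  (U_le : forall x, \sum_(j < d) `|U j x| <= W).
Hypothesis f_pairing : forall (q0 : 'rV[R]_d -> R) (q : 'I_d -> 'rV[R]_d -> R) (s Lambda : R),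
  bm q0 -> (forall j, bm (q j)) ->
  (forall w b, l1norm w = 1 -> `|b| <= 1 ->
    `|ridge_pairing Omega q0 q w (fun z => softplus tau (z + b))
      (fun z => sigmoid tau (z + b))| <= s) ->
  (forall w : 'rV[R]_d, l1norm w = 1 ->
    \int[mu]_(x in Omega) (`|q0 x| + `|\sum_(j < d) q j x * w 0 j|) <= Lambda) ->
  `|pairing Omega q0 q f U| <= W * (2 * s + 2 / tau * Lambda).

Local Notation neuron := (R * 'rV[R]_d * R)%type.

Definition neuron_val (t : neuron) x := t.1.1 * softplus tau (dotrV t.1.2 x + t.2).
Definition neuron_grad (t : neuron) j x :=
  t.1.1 * (t.1.2 0 j * sigmoid tau (dotrV t.1.2 x + t.2)).

Definition neuron_ok (t : neuron) :=
  [/\ `|t.1.1| = 3 * W, l1norm t.1.2 = 1 & `|t.2| <= 1].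

(** The errors are summed, not averaged, so that each neuron adds at most a fixed multiple of
    [W ^+ 2] to the energy; the division by [m] comes at the end. *)
Definition gap (s : seq neuron) x := \sum_(t <- s) (neuron_val t x - f x).
Definition gap_grad (s : seq neuron) j x := \sum_(t <- s) (neuron_grad t j x - U j x).
Definition gap_energy (s : seq neuron) :=
  \int[mu]_(x in Omega) (gap s x ^+ 2 + \sum_(j < d) gap_grad s j x ^+ 2).

Let bm_shift (k : R -> R) w b : continuous k -> bm (fun x => k (dotrV w x + b)).
Proof.
move=> ck; apply: (@bm_ridge _ _ _ Omega1 (fun z => k (z + b))) => z.
apply: (@continuous_comp _ _ _ (fun z => z + b)); last exact: ck.
by apply: cvgD; [exact: cvg_id|exact: cvg_cst].
Qed.

Lemma bm_neuron_val t : bm (neuron_val t).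
Proof. by apply: bmZ => //; apply: bm_shift; exact: continuous_softplus. Qed.

Lemma bm_neuron_grad t j : bm (neuron_grad t j).
Proof.
apply: bmZ => //; apply: bmZ => //; apply: bm_shift; exact: continuous_sigmoid.
Qed.

Lemma bm_gap s : bm (gap s).
Proof. by apply: bm_sum => // t; apply: bmB => //; exact: bm_neuron_val. Qed.

Lemma bm_gap_grad s j : bm (gap_grad s j).
Proof. by apply: bm_sum => // t; apply: bmB => //; exact: bm_neuron_grad. Qed.

Lemma bm_sqr (g : 'rV[R]_d -> R) : bm g -> bm (fun x => g x ^+ 2).
Proof. by move=> bg; under eq_fun do rewrite expr2; exact: bmM. Qed.

Lemma bm_gap_energy s :
  bm (fun x => gap s x ^+ 2 + \sum_(j < d) gap_grad s j x ^+ 2).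
Proof.
apply: bmD => //; first by apply: bm_sqr; exact: bm_gap.
by apply: bm_sum => // j; apply: bm_sqr; exact: bm_gap_grad.
Qed.

(** 137 = 11^2 + 4^2. As [tau^-1 <= 1], softplus is at most 2 + 1 here, so values differ by at most
    3 W times 3, plus 2 W; gradients differ in l^1 norm by at most 3 W + W. *)
Lemma neuron_gap_le t x : neuron_ok t -> Omega x ->
  (neuron_val t x - f x) ^+ 2 + \sum_(j < d) (neuron_grad t j x - U j x) ^+ 2
  <= 137 * W ^+ 2.
Proof.
move=> [t1 t2 t3] Ox; have W30 : 0 <= 3 * W by rewrite mulr_ge0// ltW.
have z2 : `|dotrV t.1.2 x + t.2| <= 2.
  by rewrite (le_trans (ler_normD _ _))// [leRHS](_ : 2 = 1 + 1)// lerD// -t2; apply: (dotrV_le Omega1).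
have v_le : `|neuron_val t x - f x| <= 11 * W.
  rewrite (le_trans (ler_normB _ _))// [leRHS](_ : _ = 3 * W * 3 + 2 * W); last by ring.
  rewrite lerD// normrM t1 ler_wpM2l//.
  rewrite ger0_norm ?softplus_ge0// (le_trans (softplus_le tau0 _))//.
  have : tau^-1 <= 1 by rewrite invf_le1.
  by move: z2; set z := `|_|; set u := tau^-1; lra.
have g_le : \sum_(j < d) `|neuron_grad t j x - U j x| <= 4 * W.
  apply: (@le_trans _ _ (\sum_(j < d) (`|neuron_grad t j x| + `|U j x|))).
    by apply: ler_sum => j _; exact: ler_normB.
  rewrite big_split/= [leRHS](_ : _ = 3 * W * l1norm t.1.2 + W); last by rewrite t2; ring.
  apply: lerD => //; rewrite /l1norm mulr_sumr; apply: ler_sum => j _.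
  rewrite normrM t1 ler_wpM2l// normrM ler_piMr//.
  by rewrite ger0_norm ?sigmoid_ge0// sigmoid_le1.
rewrite (_ : 137 * W ^+ 2 = (11 * W) ^+ 2 + (4 * W) ^+ 2); last by ring.
apply: lerD; first by rewrite -real_normK ?num_real// ler_sqr ?nnegrE// mulr_ge0// ltW.
apply: le_trans (sum_sqr_le _) _.
by rewrite ler_sqr ?nnegrE ?sumr_ge0// mulr_ge0// ltW.
Qed.

Let bm_pairing (q0 g : 'rV[R]_d -> R) (q G : 'I_d -> 'rV[R]_d -> R) :
  bm q0 -> (forall j, bm (q j)) -> bm g -> (forall j, bm (G j)) ->
  bm (fun x => q0 x * g x + \sum_(j < d) q j x * G j x).
Proof.
by move=> b1 b2 b3 b4; apply: bmD => //; [exact: bmM|apply: bm_sum => // j; exact: bmM].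
Qed.

Lemma pairing_neuron (q0 : 'rV[R]_d -> R) (q : 'I_d -> 'rV[R]_d -> R) t :
  bm q0 -> (forall j, bm (q j)) ->
  pairing Omega q0 q (neuron_val t) (neuron_grad t) =
  t.1.1 * ridge_pairing Omega q0 q t.1.2 (fun z => softplus tau (z + t.2))
    (fun z => sigmoid tau (z + t.2)).
Proof.
move=> bq0 bq; rewrite /ridge_pairing /pairing -Rintegral_bmZ//; last first.
  apply: bm_pairing => // [|j]; first by apply: bm_shift; exact: continuous_softplus.
  by apply: bmZ => //; apply: bm_shift; exact: continuous_sigmoid.
apply: eq_Rintegral => x _; rewrite mulrDr mulr_sumr mulrCA; congr (_ + _).
by apply: eq_bigr => j _; rewrite mulrCA.
Qed.

Lemma pairingB (q0 g g' : 'rV[R]_d -> R) (q G G' : 'I_d -> 'rV[R]_d -> R) :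
  bm q0 -> (forall j, bm (q j)) ->
  bm g -> (forall j, bm (G j)) -> bm g' -> (forall j, bm (G' j)) ->
  pairing Omega q0 q (fun x => g x - g' x) (fun j x => G j x - G' j x) =
  pairing Omega q0 q g G - pairing Omega q0 q g' G'.
Proof.
move=> bq0 bq bg bG bg' bG'; rewrite /pairing -Rintegral_bmB//; [|exact: bm_pairing..].
apply: eq_Rintegral => x _; rewrite opprD addrACA -mulrBr; congr (_ + _).
by rewrite -sumrB; apply: eq_bigr => j _; rewrite mulrBr.
Qed.

(** [norm_le_amgm] is applied to both terms: each brings a constant [T / 2], and their squares
    together are at most the energy, which brings the third [T / 2]. *)
Lemma gap_le s (T : R) w : 0 < T -> gap_energy s <= T ^+ 2 -> l1norm w = 1 ->
  \int[mu]_(x in Omega) (`|gap s x| + `|\sum_(j < d) gap_grad s j x * w 0 j|)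
  <= 3 / 2 * T.
Proof.
move=> T0 sT w1.
have bE := bm_gap_energy s; set e := (fun x => gap s x ^+ 2 + _) in bE.
have be : bm (fun x => (2 * T)^-1 * e x) by exact: bmZ.
have bc : bm (cst T) by exact: bm_cst.
apply: (@le_trans _ _ (\int[mu]_(x in Omega) ((2 * T)^-1 * e x + cst T x))).
  apply: le_Rintegral_bm => //.
  - apply: bmD => //; first by apply: bm_norm => //; exact: bm_gap.
    apply: bm_norm => //; apply: bm_sum => // j.
    by apply: bmM => //; [exact: bm_gap_grad|exact: bm_cst].
  - exact: bmD.
  move=> x Ox; pose v : 'rV[R]_d := \row_j gap_grad s j x.
  have -> : \sum_(j < d) gap_grad s j x * w 0 j = dotrV w v.
    by apply: eq_bigr => j _; rewrite mxE mulrC.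
  have := norm_le_amgm (gap s x) T0; have := norm_le_amgm (dotrV w v) T0.
  have := dotrV_sqr_le v w1.
  have -> : \sum_(j < d) v 0 j ^+ 2 = \sum_(j < d) gap_grad s j x ^+ 2.
    by apply: eq_bigr => j _; rewrite mxE.
  move=> h1 h2 h3; apply: le_trans (lerD h3 h2) _.
  rewrite /e /cst [leLHS](_ : _ = (2 * T)^-1 * (gap s x ^+ 2 + dotrV w v ^+ 2) + T).
    by rewrite lerD2r ler_wpM2l ?lerD2l// invr_ge0 mulr_ge0// ltW.
  by field; rewrite gt_eqF.
rewrite Rintegral_bmD// Rintegral_bmZ// Rintegral_cst//.
have -> : fine (mu Omega) = 1 by rewrite vol1.
rewrite (_ : 3 / 2 * T = (2 * T)^-1 * T ^+ 2 + T * 1); last first.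
  by field; rewrite gt_eqF.
by rewrite lerD2r ler_wpM2l// invr_ge0 mulr_ge0// ltW.
Qed.

(* [f] is an average of neurons of total mass at most [2 * W]: any amplitude above
   that, here [3 * W], contradicts [f_pairing] if no neuron is suitable. *)
Lemma greedy_choice s (T : R) : 0 < T -> gap_energy s <= T ^+ 2 ->
  exists2 t, neuron_ok t &
  pairing Omega (gap s) (gap_grad s) (neuron_val t) (neuron_grad t) <=
  pairing Omega (gap s) (gap_grad s) f U + 3 * W * T / tau.
Proof.
move=> T0 sT; set P := pairing _ _ _ f U; set eps := 3 * W * T / tau.
have bg := bm_gap s; have bgg := bm_gap_grad s.
apply: contrapT => H.
have lt_neuron t : neuron_ok t -> P + eps <
    t.1.1 * ridge_pairing Omega (gap s) (gap_grad s) t.1.2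
      (fun z => softplus tau (z + t.2)) (fun z => sigmoid tau (z + t.2)).
  move=> tok; rewrite -pairing_neuron// ltNge; apply/negP => le_t.
  by apply: H; exists t.
pose r w b := ridge_pairing Omega (gap s) (gap_grad s) w
  (fun z => softplus tau (z + b)) (fun z => sigmoid tau (z + b)).
(* Both signs of the amplitude are allowed, which yields the absolute value. *)
have r_lt w b : l1norm w = 1 -> `|b| <= 1 -> 3 * W * `|r w b| < - (P + eps).
  move=> w1 b1; have W30 : 0 <= 3 * W by rewrite mulr_ge0// ltW.
  have := lt_neuron (3 * W, w, b); have := lt_neuron (- (3 * W), w, b).
  rewrite /neuron_ok/= normrN ger0_norm// => /(_ (And3 erefl w1 b1)) + /(_ (And3 erefl w1 b1)).
  rewrite -/(r w b) mulNr => h1 h2.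
  by rewrite -[3 * W]ger0_norm// -normrM ltr_norml; lra.
pose e0 : 'rV[R]_d := delta_mx 0 (Ordinal d0).
have e01 : l1norm e0 = 1 by exact: l1norm_delta.
have t00 : 0 < - (P + eps).
  apply: le_lt_trans (r_lt e0 0 e01 _); last by rewrite normr0.
  by rewrite !mulr_ge0// ltW.
(* Since [W * (2 / tau) * (3 / 2 * T)] is [eps], the bound reads [|P| <= 2 / 3 * - (P + eps) + eps].
   Hence [- P <= eps], against [t00]. *)
have := @f_pairing _ _ (- (P + eps) / (3 * W)) (3 / 2 * T) bg bgg _
  (fun w => @gap_le s T w T0 sT).
have W30 : 0 < 3 * W by rewrite mulr_gt0.
move=> /(_ _)/wrap[w b w1 b1|].
  by rewrite ler_pdivlMr// mulrC; apply: ltW; exact: r_lt.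
rewrite -/P (_ : W * _ = 2 / 3 * (- (P + eps)) + eps); last first.
  by rewrite /eps; field; rewrite !gt_eqF.
rewrite ler_norml => /andP[+ _]; lra.
Qed.

(** Expansion of the square: the cross term is twice the pairing with the new error, bounded by
    [greedy_choice]. *)
Lemma greedy_step s (T : R) : 0 < T -> gap_energy s <= T ^+ 2 ->
  exists2 t, neuron_ok t &
  gap_energy (t :: s) <= gap_energy s + 6 * W * T / tau + 137 * W ^+ 2.
Proof.
move=> T0 sT; have [t tok tP] := greedy_choice T0 sT; exists t => //.
have bg := bm_gap s; have bgg := bm_gap_grad s.
pose v0 x := neuron_val t x - f x; pose v j x := neuron_grad t j x - U j x.
have bv0 : bm v0 by apply: bmB => //; exact: bm_neuron_val.
have bv j : bm (v j) by apply: bmB => //; exact: bm_neuron_grad.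
pose e1 x := gap s x ^+ 2 + \sum_(j < d) gap_grad s j x ^+ 2.
pose e2 x := gap s x * v0 x + \sum_(j < d) gap_grad s j x * v j x.
pose e3 x := v0 x ^+ 2 + \sum_(j < d) v j x ^+ 2.
have be1 : bm e1 by exact: bm_gap_energy.
have be2 : bm e2 by exact: bm_pairing.
have be22 : bm (fun x => 2 * e2 x) by exact: bmZ.
have be3 : bm e3.
  by apply: bmD => //; [exact: bm_sqr|apply: bm_sum => // j; exact: bm_sqr].
have be12 : bm (fun x => e1 x + 2 * e2 x) by exact: bmD.
have -> : gap_energy (t :: s) = \int[mu]_(x in Omega) e1 x +
    2 * \int[mu]_(x in Omega) e2 x + \int[mu]_(x in Omega) e3 x.
  rewrite -Rintegral_bmZ// -!Rintegral_bmD//; apply: eq_Rintegral => x _.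
  rewrite /gap big_cons -/(v0 x) -/(gap s x) /e1 /e2 /e3.
  have -> : \sum_(j < d) gap_grad (t :: s) j x ^+ 2 =
      \sum_(j < d) gap_grad s j x ^+ 2 + 2 * \sum_(j < d) gap_grad s j x * v j x
      + \sum_(j < d) v j x ^+ 2.
    rewrite mulr_sumr -!big_split/=; apply: eq_bigr => j _.
    by rewrite /gap_grad big_cons -/(v j x) -/(gap_grad s j x); ring.
  by ring.
apply: lerD.
  apply: lerD => //.
  have -> : \int[mu]_(x in Omega) e2 x = pairing Omega (gap s) (gap_grad s) v0 v by [].
  rewrite pairingB//; [|exact: bm_neuron_val|exact: bm_neuron_grad].
  rewrite (_ : 6 * W * T / tau = 2 * (3 * W * T / tau)); last by ring.
  by rewrite ler_wpM2l// lerBlDl.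
rewrite -[leRHS]mulr1 -[X in _ <= _ * X](_ : fine (mu Omega) = 1); last by rewrite vol1.
rewrite -(Rintegral_cst mu mO); apply: le_Rintegral_bm => //; first exact: bm_cst.
by move=> x Ox; exact: neuron_gap_le.
Qed.

Lemma greedy : exists s, [/\ size s = m, {in s, forall t, neuron_ok t} &
  gap_energy s <= 289 * W ^+ 2 * m%:R].
Proof.
suff : forall n, (n <= m)%N -> exists s, [/\ size s = n,
    {in s, forall t, neuron_ok t} & gap_energy s <= 289 * W ^+ 2 * n%:R].
  by apply.
elim=> [_|n IHn nm].
  exists [::]; split => //; rewrite mulr0 /gap_energy.
  rewrite (_ : (fun x => _) = cst 0) ?Rintegral_cst ?mul0r//.
  apply/funext => x; rewrite /gap /gap_grad !big_nil expr0n/= add0r big1// => j _.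
  by rewrite big_nil expr0n.
have [s [sn sok sE]] := IHn (ltnW nm).
have W20 : 0 < W ^+ 2 by rewrite exprn_gt0.
have tau2 : tau ^+ 2 = m%:R by rewrite sqr_sqrtr.
(* One [T] serves all steps, as [n <= m = tau ^+ 2]. The [tau] in it cancels the [tau^-1] of the
   softplus error, and the increment is [(102 + 137) * W ^+ 2], below [289 * W ^+ 2]. *)
have T0 : 0 < 17 * W * tau by rewrite !mulr_gt0.
have sT : gap_energy s <= (17 * W * tau) ^+ 2.
  apply: (le_trans sE).
  rewrite (_ : (17 * W * tau) ^+ 2 = 289 * W ^+ 2 * tau ^+ 2); last by ring.
  by rewrite tau2; apply: ler_wpM2l; [rewrite mulr_ge0// ltW|rewrite ler_nat ltnW].
have [t tok tE] := greedy_step T0 sT.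
exists (t :: s); split => [|u|]; [by rewrite /= sn|by rewrite inE => /predU1P[->//|/sok]|].
apply: (le_trans tE); rewrite -[n.+1%:R]natr1 [leRHS]mulrDr mulr1.
rewrite -addrA lerD// (_ : 6 * W * _ / tau = 102 * W ^+ 2); last first.
  by field; rewrite gt_eqF.
by rewrite -mulrDl ler_wpM2r// ?ltW//; lra.
Qed.

End greedy.

(** * Total variation and the volume of the domain *)

Section iid_samples.
Context {R : realType} {d : nat}.

Definition RV_of (d1 d2 : measure_display) (T1 : measurableType d1)
    (T2 : measurableType d2) (P : probability T1 R) (f : T1 -> T2)
    (mf : measurable_fun setT f) : {RV P >-> T2} :=
  MeasurableFun.Pack (MeasurableFun.Class (isMeasurableFun.Build _ _ _ _ f mf)).

(** The volume argument needs samples of every size, built from one uniform variable: the product of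
    its space with one carrying [N] copies carries [N + 1] copies. *)
Lemma iid_sample_exists (disp : measure_display) (T : measurableType disp)
    (P : probability T R) (Omega : set 'rV[R]_d) (X0 : {RV P >-> 'rV[R]_d}) (N : nat) :
  uniform_on Omega X0 ->
  exists (disp' : measure_display) (T' : measurableType disp')
    (P' : probability T' R) (X : 'I_N -> {RV P' >-> 'rV[R]_d}), iid_sample Omega X.
Proof.
move=> [XO Xu].
(* Uniformity is replaced by equality in law with [X0], which passes directly to products. *)
suff [disp' [T' [P' [X [Xind [XO' Xdist]]]]]] :
  exists (disp' : measure_display) (T' : measurableType disp')
    (P' : probability T' R) (X : 'I_N -> {RV P' >-> 'rV[R]_d}),
    independent_rVs X /\ (forall i t, Omega (X i t)) /\
    forall i A, measurable A -> P' (X i @^-1` A) = P (X0 @^-1` A).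
  exists disp', T', P', X; split=> // i; split; first exact: XO'.
  by move=> A mA; rewrite -Xu// /distribution /pushforward/= Xdist.
elim: N => [|N [disp' [T' [P' [X [Xind [XO' Xdist]]]]]]].
  exists disp, T, P, (fun=> X0); split; last by split; case.
  move=> A _; rewrite big_ord0 (_ : \bigcap_i _ = setT) ?probability_setT//.
  by apply/seteqP; split => // t _ [].
have mX0 : measurable_fun setT (fun p : T * T' => X0 p.1).
  exact: (measurableT_comp (f := X0)).
have mX i : measurable_fun setT (fun p : T * T' => X i p.2).
  exact: (measurableT_comp (f := X i)).
pose Q : probability (T * T')%type R := (P \x P')%E.
pose Y (i : 'I_N.+1) : {RV Q >-> 'rV[R]_d} :=
  if unlift ord0 i is Some k then RV_of Q (mX k) else RV_of Q mX0.
have Y0 : Y ord0 = RV_of Q mX0 by rewrite /Y unlift_none.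
have YS k : Y (lift ord0 k) = RV_of Q (mX k) by rewrite /Y liftK.
have mpre (dd : measure_display) (TT : measurableType dd) (PP : probability TT R)
    (Z : {RV PP >-> 'rV[R]_d}) A : measurable A -> measurable (Z @^-1` A).
  by move=> mA; rewrite -[X in measurable X]setTI; exact: measurable_funP.
have QE A B : measurable A -> measurable B -> Q (A `*` B) = (P A * P' B)%E.
  by move=> mA mB; rewrite /Q/= product_measure1E.
have dist0 A : measurable A -> Q (Y ord0 @^-1` A) = P (X0 @^-1` A).
  move=> mA; rewrite Y0 (_ : _ @^-1` _ = (X0 @^-1` A) `*` setT).
    by rewrite QE// ?probability_setT ?mule1//; exact: mpre.
  by apply/seteqP; split => -[a b] //= [].
have distS k A : measurable A -> Q (Y (lift ord0 k) @^-1` A) = P' (X k @^-1` A).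
  move=> mA; rewrite YS (_ : _ @^-1` _ = setT `*` (X k @^-1` A)).
    by rewrite QE// ?probability_setT ?mul1e//; exact: mpre.
  by apply/seteqP; split => -[a b] //= [].
exists _, (T * T')%type, Q, Y; split; [|split].
- move=> A mA; rewrite big_ord_recl dist0//.
  under eq_bigr do rewrite distS//.
  rewrite -(Xind (fun k => A (lift ord0 k)))// -QE//; last 2 first.
  + exact: mpre.
  + by apply: fin_bigcap_measurable => [|k _]; [exact: finite_finset|exact: mpre].
  congr (Q _); apply/seteqP; split => -[a b] /= Aab.
  + split=> [|k _]; first by have := Aab ord0 I; rewrite /= Y0.
    by have := Aab (lift ord0 k) I; rewrite /= YS.
  + move=> i _; have [k ->|->] := unliftP ord0 i.
      by rewrite /= YS; exact: Aab.2.
    by rewrite /= Y0; exact: Aab.1.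
- move=> i t; have [k ->|->] := unliftP ord0 i; first by rewrite YS; exact: XO'.
  by rewrite Y0; exact: XO.
- move=> i A mA; have [k ->|->] := unliftP ord0 i; last exact: dist0.
  by rewrite distS// Xdist.
Qed.

End iid_samples.

(** Cauchy-Schwarz from [2 a b <= S a ^+ 2 + b ^+ 2 / S] with [S] the norm of [v], which requires
    [S != 0]. *)
Lemma norm_dot_l2 (R : realType) (d : nat) (v : 'I_d -> R) (p : 'rV[R]_d) :
  l2norm p <= 1 -> `|\sum_(j < d) p 0 j * v j| <= Num.sqrt (\sum_(j < d) v j ^+ 2).
Proof.
move=> p1; set s2 := \sum_(j < d) v j ^+ 2.
have s20 : 0 <= s2 by apply: sumr_ge0 => j _; exact: sqr_ge0.
have p21 : \sum_(j < d) p 0 j ^+ 2 <= 1.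
  rewrite -[leRHS](expr1n _ 2) -(@ler_sqrt _ _ (1 ^+ 2))// ?expr1n//.
  by rewrite sqrtr1.
have [s0|s0] := eqVneq s2 0.
  rewrite s0 sqrtr0 big1 ?normr0// => j _.
  have /eqP := s0; rewrite psumr_eq0 => [/allP/(_ j)|k _]; last exact: sqr_ge0.
  by rewrite mem_index_enum sqrf_eq0 => /(_ isT)/eqP ->; rewrite mulr0.
have S0 : 0 < Num.sqrt s2 by rewrite sqrtr_gt0 lt_def s0.
apply: le_trans (ler_norm_sum _ _ _) _.
apply: (@le_trans _ _ (\sum_(j < d)
    (Num.sqrt s2 * p 0 j ^+ 2 + v j ^+ 2 / Num.sqrt s2) / 2)).
  apply: ler_sum => j _.
  rewrite ler_pdivlMr// -(ler_pM2r S0) mulrDl divfK ?gt_eqF// -subr_ge0.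
  rewrite -[p 0 j ^+ 2]real_normK ?num_real// -[v j ^+ 2]real_normK ?num_real//.
  rewrite normrM (_ : _ - _ = (Num.sqrt s2 * `|p 0 j| - `|v j|) ^+ 2) ?sqr_ge0//.
  by ring.
rewrite -mulr_suml big_split/= -mulr_sumr -mulr_suml -/s2.
rewrite ler_pdivrMr// mulr_natr mulr2n lerD//.
  by rewrite ler_piMr// ltW.
by rewrite -{1}(sqr_sqrtr s20) expr2 mulfK// gt_eqF.
Qed.

Lemma bm_sqrt (R : realType) (dT : measure_display) (T : measurableType dT)
    (D : set T) (f : T -> R) :
  bounded_measurable D f -> bounded_measurable D (fun x => Num.sqrt (f x)).
Proof.
move=> [mf [M fM]]; split.
  apply: (measurableT_comp (f := @Num.sqrt R)) => //.
  by apply: continuous_measurable_fun; exact: sqrt_continuous.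
exists (Num.sqrt M) => x Dx; rewrite ger0_norm ?sqrtr_ge0// ler_wsqrtr//.
by rewrite (le_trans (ler_norm _))// fM.
Qed.

Section total_variation_facts.
Context {R : realType} {d : nat}.
Variable Omega : set 'rV[R]_d.
Hypothesis oO : open Omega.
Hypothesis Omega1 : forall x, Omega x -> forall j, `|x 0 j| <= 1.
Local Notation mu := (lebesgue_rV R d).
Local Notation bm := (bounded_measurable Omega).

Let mO : measurable Omega. Proof. exact: open_rV_measurable. Qed.
Let muO : (mu Omega < +oo)%E. Proof. exact: lebesgue_rV_bounded Omega1. Qed.

Lemma test_field0 : test_field Omega (cst 0).
Proof.
have d0 (i j : 'I_d) : partial j (fun z => (cst 0 : 'rV[R]_d -> 'rV[R]_d) z 0 i) = cst 0.
  apply/funext => x; rewrite /partial (_ : (fun z => _) = cst 0) ?derive_cst//.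
  by apply/funext => z; rewrite mxE.
split.
- move=> i j x; rewrite (_ : (fun z => _) = cst 0); first exact: derivable_cst.
  by apply/funext => z; rewrite mxE.
- by move=> i j; rewrite d0 => x; exact: cst_continuous.
- rewrite (_ : [set x | _] = set0); last first.
    by apply/seteqP; split => // x /=; rewrite eqxx.
  by rewrite closure0; split => //; exact: compact0.
- move=> x; rewrite /l2norm big1 ?sqrtr0// => j _.
  by rewrite mxE expr0n.
Qed.

Lemma EFin_Rintegral_bm (g : 'rV[R]_d -> R) : bm g ->
  (\int[mu]_(x in Omega) (g x)%:E = (\int[mu]_(x in Omega) g x)%:E)%E.
Proof.
move=> bg; rewrite /Rintegral fineK//.
by apply: integrable_fin_num => //; exact: bm_integrable.
Qed.

Lemma total_variation_ge0 u : (0 <= Defs.total_variation Omega u)%E.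
Proof.
apply: ereal_sup_ubound; exists (cst 0); first exact: test_field0.
rewrite integral0_eq// => x _; rewrite /divergence big1 ?mulr0// => j _.
rewrite /partial (_ : (fun z => _) = cst 0) ?derive_cst//.
by apply/funext => z; rewrite mxE.
Qed.

(** A constant is a ridge function of direction 0 with zero derivative. *)
Lemma total_variation_cst c : Defs.total_variation Omega (cst c) = 0%E.
Proof.
apply/eqP; rewrite eq_le total_variation_ge0 andbT.
apply: ge_ereal_sup => _ [p tp <-].
have dc (z : R) : is_derive z (1 : R) (cst c) (cst 0 z) by exact: is_derive_cst.
have := ridge_ibp 0 dc oO (@cst_continuous _ _ 0) tp.
under eq_Rintegral do rewrite mulr0 addr0 mulrC.
move=> e; rewrite EFin_Rintegral_bm ?e//.
by apply: bmM; [exact: bm_cst|exact: bm_divergence].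
Qed.

(* The distributional gradient of f is only tested against test fields, through
   the hypothesis on [pairing]. *)
Lemma total_variation_le (u f : 'rV[R]_d -> R) (U : 'I_d -> 'rV[R]_d -> R) :
  bm u -> bm f -> (forall j, bm (U j)) ->
  (forall p, test_field Omega p ->
    pairing Omega (divergence p) (fun j x => p x 0 j) f U = 0) ->
  (Defs.total_variation Omega (fun x => u x + f x)%R
   <= Defs.total_variation Omega u
      + (\int[mu]_(x in Omega) Num.sqrt (\sum_(j < d) U j x ^+ 2))%R%:E)%E.
Proof.
move=> bu bf bU fU; apply: ge_ereal_sup => _ [p tp <-].
have bdiv := bm_divergence tp; have bp j := bm_test_field tp j.
have bUp : bm (fun x => \sum_(j < d) p x 0 j * U j x).
  by apply: bm_sum => // j; exact: bmM.
have bsq : bm (fun x => Num.sqrt (\sum_(j < d) U j x ^+ 2)).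
  by apply: bm_sqrt; apply: bm_sum => // j; under eq_fun do rewrite expr2; exact: bmM.
have be (g : 'rV[R]_d -> R) : bm g -> bm (fun x => g x * divergence p x).
  by move=> bg; exact: bmM.
under eq_integral do rewrite mulrDl.
rewrite EFin_Rintegral_bm ?Rintegral_bmD//; [|exact: be..|]; last by apply: bmD => //; exact: be.
rewrite EFinD; apply: leeD.
  rewrite -EFin_Rintegral_bm; last exact: be.
  by apply: ereal_sup_ubound; exists p.
rewrite lee_fin.
have := fU p tp; rewrite /pairing Rintegral_bmD//; last exact: bmM.
move=> /eqP; rewrite addr_eq0 => /eqP fp.
rewrite (_ : \int[mu]_(x in Omega) (f x * divergence p x) =
    - \int[mu]_(x in Omega) (\sum_(j < d) p x 0 j * U j x)); last first.
  by rewrite -fp; apply: eq_Rintegral => x _; rewrite mulrC.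
apply: le_trans (ler_norm _) _; rewrite normrN.
apply: norm_Rintegral_bm => // x Ox; rewrite ler_norml.
have [_ _ _ /(_ x) p1] := tp.
have pU := norm_dot_l2 (fun j => U j x) p1.
by rewrite -ler_norml.
Qed.

End total_variation_facts.

Section volume.
Context {R : realType} {d : nat}.
Hypothesis d0 : (0 < d)%N.
Variable Omega : set 'rV[R]_d.
Hypothesis oO : open Omega.
Hypothesis Omega1 : forall x, Omega x -> forall j, `|x 0 j| <= 1.
Local Notation mu := (lebesgue_rV R d).
Local Notation bm := (bounded_measurable Omega).

Let mO : measurable Omega. Proof. exact: open_rV_measurable. Qed.
Let muO : (mu Omega < +oo)%E. Proof. exact: lebesgue_rV_bounded Omega1. Qed.

Variables (y : 'rV[R]_d -> R) (B : R).
Hypotheses (bmy : bm y) (B0 : 0 < B).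

Lemma L_TV_cst c : L_TV Omega y (cst c) =
  (c ^+ 2 * fine (mu Omega) - 2 * c * \int[mu]_(x in Omega) y x)%:E.
Proof.
rewrite /L_TV total_variation_cst// adde0.
have bc : bm (cst (c ^+ 2)) by exact: bm_cst.
have bcy : bm (fun x => 2 * c * y x) by exact: bmZ.
rewrite EFin_Rintegral_bm//; last exact: bmB.
by rewrite Rintegral_bmB// -(Rintegral_bmZ mO muO (2 * c) bmy) -(Rintegral_cst mu mO (c ^+ 2)).
Qed.

Lemma L_TV_emp_cst N (x : 'I_N -> 'rV[R]_d) c : (0 < N)%N ->
  L_TV_emp y x (cst c) = c ^+ 2 - 2 * c * (N%:R^-1 * \sum_(i < N) y (x i)).
Proof.
move=> N0; have N0' : N%:R != 0 :> R by rewrite pnatr_eq0 -lt0n.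
have g0 z : l2norm (gradient (cst c : 'rV[R]_d -> R) z) = 0.
  rewrite /l2norm big1 ?sqrtr0// => j _.
  by rewrite mxE /partial derive_cst expr0n.
rewrite /L_TV_emp; under eq_bigr do rewrite g0 addr0 /=.
rewrite sumrB sumr_const card_ord -mulr_sumr mulrBr.
by rewrite -[c ^+ 2 *+ N]mulr_natl mulKf// mulrCA.
Qed.

Lemma softplus_nets_cst m c : `|c| <= 2 * B -> softplus_nets d m B (cst c).
Proof.
(* A direction must have l^1 norm 1 even where the amplitude is 0. *)
move=> cB; exists c, (fun=> 0), (fun=> delta_mx 0 (Ordinal d0)), (fun=> 0).
split => // [k|x]; last by rewrite big1 ?mulr0 ?addr0// => k _; rewrite mul0r.
by rewrite !normr0 mulr_ge0 ?ltW// l1norm_delta.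
Qed.

(* Constant networks have no variance in the limit N -> oo, so that the
   quadrature estimate at c = 2 B and c = - 2 B compares c ^+ 2 with
   c ^+ 2 * |Omega|. *)
Lemma quadrature_volume (disp : measure_display) (T : measurableType disp)
    (P : probability T R) (X0 : {RV P >-> 'rV[R]_d}) (Z1 Z2 M1 : R) :
  uniform_on Omega X0 -> quadrature_estimate Omega y B Z1 Z2 M1 ->
  mu Omega = 1%E.
Proof.
move=> uX0 quad; set V := fine (mu Omega).
have VE : mu Omega = V%:E by rewrite fineK// ge0_fin_numE.
(* [sqrt N] times the quadrature bound at confidence level 1 / 2 and width 1, where [ln 1 = 0]
   removes [Z2]. *)
pose kappa := 2 * Z1 + M1 * Num.sqrt (- 2 * ln (2^-1)).
have bound N : (0 < N)%N -> 4 * B ^+ 2 * `|1 - V| <= kappa / Num.sqrt N%:R.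
  move=> N0; have [disp' [T' [P' [X iidX]]]] := iid_sample_exists N uX0.
  have half : 0 < (2^-1 : R) < 1 by rewrite invr_gt0 ltr0n invf_lt1// ltr1n.
  have [A [mA AE PA]] := quad _ _ P' 1 N X 2^-1 isT N0 iidX half.
  (* The inequality sought does not depend on the sample, so one good sample is enough; an event of
     probability at least 1 / 2 provides it. *)
  have [t At] : A !=set0.
    apply/set0P/eqP => A0; move: PA; rewrite A0 measure0 lee_fin.
    by apply/negP; rewrite -ltNge; lra.
  have := AE _ At => /= sup_le.
  have net_le c : `|c| <= 2 * B ->
      `|c ^+ 2 - 2 * c * (N%:R^-1 * \sum_(i < N) y (X i t)) -
        (c ^+ 2 * V - 2 * c * \int[mu]_(x in Omega) y x)| <= kappa / Num.sqrt N%:R.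
    move=> cB; have : (`|(L_TV_emp y (fun i => X i t) (cst c))%:E - L_TV Omega y (cst c)|
        <= (quadrature_bound Z1 Z2 M1 2^-1 1 N)%:E)%E.
      apply: le_trans sup_le; apply: ereal_sup_ubound.
      by exists (cst c) => //; exact: softplus_nets_cst.
    rewrite L_TV_cst L_TV_emp_cst// -EFinB /= lee_fin; move/le_trans; apply.
    rewrite /quadrature_bound ln1 sqrtr0 sqrtr1 mulr0 addr0 /kappa.
    by rewrite le_eqVlt; apply/orP; left; apply/eqP; ring.
  (* The two constants have the same square; averaging the two inequalities eliminates the terms
     linear in [y]. *)
  have := net_le (2 * B); have := net_le (- (2 * B)).
  have B2 : 0 <= 2 * B by rewrite mulr_ge0// ltW.
  have B4 : 0 <= 4 * B ^+ 2 by rewrite mulr_ge0// sqr_ge0.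
  rewrite normrN (ger0_norm B2) => /(_ (lexx _)) + /(_ (lexx _)).
  rewrite -(ger0_norm B4) -normrM !ler_norml.
  set a := N%:R^-1 * _; set b := \int[mu]_(_ in _) _.
  move=> /andP[h1 h2] /andP[h3 h4]; apply/andP; split; nra.
rewrite VE; suff -> : V = 1 by [].
have B20 : 0 < 4 * B ^+ 2 by rewrite mulr_gt0// exprn_gt0.
apply/eqP; apply: contrapT => /negP V1.
have dpos : 0 < 4 * B ^+ 2 * `|1 - V|.
  by rewrite mulr_gt0// normr_gt0 subr_eq0 eq_sym.
set delta := 4 * B ^+ 2 * _ in bound dpos.
(* At sample size [k ^ 2] the bound is [kappa / k], which is less than [delta]. *)
pose k := (Num.truncn (`|kappa / delta|)).+1.
have := bound (k ^ 2)%N; rewrite expn_gt0/= => /(_ isT).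
rewrite natrX sqrtr_sqr ger0_norm// ler_pdivlMr ?ltr0n//.
apply/negP; rewrite -ltNge mulrC -ltr_pdivrMr//.
by apply: le_lt_trans (ler_norm _) _; exact: truncnS_gt.
Qed.

End volume.

(** * Approximation and the main estimate *)

Section approximation.
Context {R : realType} {d : nat}.
Hypothesis d0 : (0 < d)%N.
Variable Omega : set 'rV[R]_d.
Hypothesis oO : open Omega.
Hypothesis Omega1 : forall x, Omega x -> forall j, `|x 0 j| <= 1.
Local Notation mu := (lebesgue_rV R d).
Hypothesis vol1 : mu Omega = 1%E.
Local Notation bm := (bounded_measurable Omega).

Let mO : measurable Omega. Proof. exact: open_rV_measurable. Qed.
Let muO : (mu Omega < +oo)%E. Proof. by rewrite vol1 ltry. Qed.

(** The Barron representation identifies [uhat] on [Omega] only. *)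
Lemma L_TV_congr (y u v : 'rV[R]_d -> R) : (forall x, Omega x -> u x = v x) ->
  L_TV Omega y u = L_TV Omega y v.
Proof.
move=> uv; rewrite /L_TV; congr (_ + _)%E.
  by apply: eq_integral => x /set_mem Ox; rewrite uv.
rewrite /Defs.total_variation; congr ereal_sup; apply: eq_imagel => p _.
by apply: eq_integral => x /set_mem Ox; rewrite uv.
Qed.

Lemma pairing_sum (I : Type) (r : seq I) (q0 : 'rV[R]_d -> R) q
    (g : I -> 'rV[R]_d -> R) (G : I -> 'I_d -> 'rV[R]_d -> R) c :
  bm q0 -> (forall j, bm (q j)) -> (forall i, bm (g i)) ->
  (forall i j, bm (G i j)) ->
  pairing Omega q0 q (fun x => c * \sum_(i <- r) g i x)
    (fun j x => c * \sum_(i <- r) G i j x) =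
  c * \sum_(i <- r) pairing Omega q0 q (g i) (G i).
Proof.
move=> bq0 bq bg bG.
have bi i : bm (fun x => q0 x * g i x + \sum_(j < d) q j x * G i j x).
  by apply: bmD => //; [exact: bmM|apply: bm_sum => // j; exact: bmM].
rewrite /pairing -Rintegral_bm_sum// -Rintegral_bmZ//; last exact: bm_sum.
apply: eq_Rintegral => x _; rewrite big_split/= [RHS]mulrDr; congr (_ + _).
  by rewrite mulrCA mulr_sumr.
rewrite [in RHS]exchange_big/= mulr_sumr.
by apply: eq_bigr => j _; rewrite mulrCA mulr_sumr.
Qed.

Variables (m : nat) (B W Y : R) (y uhat : 'rV[R]_d -> R).
Hypotheses (m0 : (0 < m)%N) (W0 : 0 < W) (WB : W < B) (Y0 : 0 < Y).
Hypotheses (my : measurable_fun Omega y) (yY : forall x, Omega x -> `|y x| <= Y).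
Variables (A C : 'rV[R]_d -> R).
Hypotheses (mA : measurable_fun setT A) (mC : measurable_fun setT C).
Hypothesis weight_le :
  (\int[mu]_w ((1 + l1norm w) ^+ 2 * amplitude (A w) (C w))%:E <= W%:E)%E.
Hypothesis uhatE : forall x, Omega x ->
  uhat x = \int[mu]_w (cos (dotrV w x) * A w - sin (dotrV w x) * C w).

Let tau : R := Num.sqrt m%:R.
Let tau1 : 1 <= tau.
Proof. by rewrite -[leLHS]sqrtr1 ler_wsqrtr// ler1n. Qed.
Let tau0 : 0 < tau. Proof. exact: lt_le_trans tau1. Qed.

Let f := barron_fun A C.
Let U := barron_grad A C.
Let c := \int[mu]_w barron_offset A C w.

Let bf : bm f. Proof. exact: (bm_barron_fun d0 mA mC weight_le mO Omega1). Qed.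
Let bU j : bm (U j). Proof. exact: (bm_barron_grad mA mC weight_le mO Omega1). Qed.

Lemma softplus_net_approximation : exists2 phi, softplus_nets d m B phi &
  (L_TV Omega y phi <= L_TV Omega y uhat + ((2 * Y + 18 * B + 1) * (17 * W / tau))%:E)%E.
Proof.
have c_le : `|c| <= W by exact: (norm_Rintegral_offset mA mC weight_le).
have f_le x : `|f x| <= 2 * W by exact: (norm_barron_fun d0 mA mC weight_le).
have U_le x : \sum_(j < d) `|U j x| <= W.
  exact: (sum_norm_barron_grad mA mC weight_le).
have [s [sm sok sE]] := greedy d0 mO Omega1 vol1 m0 W0 bf bU f_le U_le
  (fun q0 q s Lambda bq0 bq => barron_pairing_le d0 mA mC weight_le mO Omega1 bq0 bq tau0).
pose val := @neuron_val R d m; pose grad := @neuron_grad R d m.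
pose g x := m%:R^-1 * gap m f s x; pose G j x := m%:R^-1 * gap_grad m U s j x.
(* [u] equals [uhat] on [Omega]. The copies of [f] in the averaged gap cancel against the one in
   [u], so [phi] is a network on all of R^d. *)
pose u x := c + f x; pose phi x := u x + g x.
have uE x : Omega x -> uhat x = u x.
  by move=> Ox; rewrite uhatE// (barron_funE d0 mA mC weight_le).
have m_neq0 : m%:R != 0 :> R by rewrite pnatr_eq0 -lt0n.
have phiE x : phi x = c + m%:R^-1 * \sum_(t <- s) val t x.
  rewrite /phi /u /g /gap sumrB big_const_seq count_predT sm iter_addr_0.
  rewrite mulrBr -[f x *+ m]mulr_natl mulKf// -addrA; congr (_ + _).
  by rewrite addrC subrK.
exists phi.
  pose t0 : R * 'rV[R]_d * R := (0, 0, 0).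
  exists c, (fun k : 'I_m => (nth t0 s k).1.1), (fun k => (nth t0 s k).1.2),
    (fun k => (nth t0 s k).2); split.
  - by rewrite (le_trans c_le)//; move: W0 WB; lra.
  - move=> k; have /sok[n1 n2 n3] : nth t0 s k \in s by rewrite mem_nth// sm.
    by split => //; rewrite n1; move: W0 WB; lra.
  - by move=> x; rewrite phiE (big_nth t0) big_mkord sm.
pose eta := 17 * W / tau; have eta0 : 0 < eta by rewrite !mulr_gt0// invr_gt0.
have bmy : bm y by split => //; exists Y.
have bgap := bm_gap Omega1 m0 bf s; have bggap := bm_gap_grad Omega1 m bU s.
have bu : bm u by apply: bmD => //; exact: bm_cst.
have bg : bm g by exact: bmZ.
have bG j : bm (G j) by exact: bmZ.
pose e x := g x ^+ 2 + \sum_(j < d) G j x ^+ 2.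
have be : bm e by apply: bmD => //; [exact: bm_sqr|apply: bm_sum => // j; exact: bm_sqr].
have e_le : \int[mu]_(x in Omega) e x <= eta ^+ 2.
  have -> : \int[mu]_(x in Omega) e x = m%:R^-1 ^+ 2 * gap_energy Omega m f U s.
    rewrite /gap_energy -Rintegral_bmZ//; last exact: bm_gap_energy.
    apply: eq_Rintegral => x _; rewrite /e /g /G mulrDr exprMn; congr (_ + _).
    by rewrite mulr_sumr; apply: eq_bigr => j _; rewrite exprMn.
  apply: le_trans (_ : m%:R^-1 ^+ 2 * (289 * W ^+ 2 * m%:R) <= _).
    by rewrite ler_wpM2l ?sqr_ge0.
  have tau2 : tau ^+ 2 = m%:R by rewrite sqr_sqrtr.
  rewrite le_eqVlt; apply/orP; left; apply/eqP; rewrite /eta -tau2.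
  by field; rewrite gt_eqF.
(* [norm_le_amgm] at [T = eta] on a domain of measure 1 gives [eta / 2 + eta / 2]. *)
have L1_le k : bm k -> (forall x, Omega x -> k x ^+ 2 <= e x) ->
    \int[mu]_(x in Omega) `|k x| <= eta.
  move=> bk ke; have bee : bm (fun x => (2 * eta)^-1 * e x) by exact: bmZ.
  have bc : bm (cst (eta / 2)) by exact: bm_cst.
  apply: (@le_trans _ _ (\int[mu]_(x in Omega) ((2 * eta)^-1 * e x + cst (eta / 2) x))).
    apply: le_Rintegral_bm => //; [exact: bm_norm|exact: bmD|].
    move=> x Ox; apply: le_trans (norm_le_amgm (k x) eta0) _.
    rewrite /cst [leLHS](_ : _ = (2 * eta)^-1 * k x ^+ 2 + eta / 2); last first.
      by field; rewrite gt_eqF.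
    by rewrite lerD2r ler_wpM2l ?ke// invr_ge0 mulr_ge0// ltW.
  rewrite Rintegral_bmD// Rintegral_bmZ// Rintegral_cst//.
  have -> : fine (mu Omega) = 1 by rewrite vol1.
  rewrite [leRHS](_ : _ = (2 * eta)^-1 * eta ^+ 2 + eta / 2 * 1); last first.
    by field; rewrite gt_eqF.
  by rewrite lerD2r ler_wpM2l// invr_ge0 mulr_ge0// ltW.
have g_le : \int[mu]_(x in Omega) `|g x| <= eta.
  by apply: L1_le => // x _; rewrite lerDl sumr_ge0// => j _; exact: sqr_ge0.
have G_le : \int[mu]_(x in Omega) Num.sqrt (\sum_(j < d) G j x ^+ 2) <= eta.
  have bS : bm (fun x => \sum_(j < d) G j x ^+ 2).
    by apply: bm_sum => // j; exact: bm_sqr.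
  apply: (@le_trans _ _ (\int[mu]_(x in Omega) `|Num.sqrt (\sum_(j < d) G j x ^+ 2)|)).
    apply: le_Rintegral_bm => //; [exact: bm_sqrt|by apply: bm_norm; exact: bm_sqrt|].
    by move=> x _; exact: ler_norm.
  apply: L1_le; first exact: bm_sqrt.
  move=> x _; rewrite sqr_sqrtr ?lerDr ?sqr_ge0//.
  by apply: sumr_ge0 => j _; exact: sqr_ge0.
have TV_le : (Defs.total_variation Omega phi <=
    Defs.total_variation Omega u + eta%:E)%E.
  apply: le_trans (total_variation_le oO Omega1 bu bg bG _) _; last first.
    by rewrite leeD2l// lee_fin.
  (* In each summand of [g], the [f] part pairs to 0 by [barron_pairing_test] and the neuron by
     [ridge_ibp]. *)
  move=> p tp; have bdiv := bm_divergence tp; have bp j := bm_test_field tp j.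
  rewrite [LHS]pairing_sum//; last 2 first.
  - by move=> t; apply: bmB => //; exact: bm_neuron_val.
  - by move=> t j; apply: bmB => //; exact: bm_neuron_grad.
  rewrite big1 ?mulr0// => t _.
  rewrite pairingB//; [|exact: bm_neuron_val|exact: bm_neuron_grad].
  rewrite (barron_pairing_test d0 mA mC weight_le oO Omega1 tp) subr0.
  rewrite (pairing_neuron mO Omega1 vol1 m0)// ridge_pairingE.
  set I := Rintegral _ _ _; suff -> : I = 0 by rewrite mulr0.
  apply: (@ridge_ibp _ _ (fun z => softplus tau (z + t.2))
    (fun z => sigmoid tau (z + t.2))) => //.
  + move=> z; have dz := is_derive_softplus tau0 (1 * z + t.2).
    have := is_derive_comp_affine dz; rewrite !mul1r.
    by under eq_fun do rewrite mul1r.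
  + move=> z; apply: (@continuous_comp _ _ _ (fun z => z + t.2)).
      by apply: cvgD; [exact: cvg_id|exact: cvg_cst].
    exact: continuous_sigmoid.
(* 12 is a rounded square root of 137. With twice [|u| <= 3 * W] it makes the 18 of [uphi]. *)
have g12 x : Omega x -> `|g x| <= 12 * W.
  move=> Ox; rewrite /g normrM ger0_norm ?invr_ge0// mulrC ler_pdivrMr ?ltr0n//.
  apply: le_trans (ler_norm_sum _ _ _) _.
  apply: (@le_trans _ _ (\sum_(t <- s) 12 * W)); last first.
    by rewrite big_const_seq count_predT sm iter_addr_0 mulr_natr.
  rewrite big_seq [leRHS]big_seq; apply: ler_sum => t ts.
  have W12 : 0 <= 12 * W by rewrite mulr_ge0// ltW.
  rewrite -ler_sqr ?nnegrE// real_normK ?num_real//.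
  apply: (@le_trans _ _ (137 * W ^+ 2)).
    apply: le_trans (neuron_gap_le Omega1 m0 W0 f_le U_le (sok _ ts) Ox).
    by rewrite lerDl sumr_ge0// => j _; exact: sqr_ge0.
  rewrite (_ : (12 * W) ^+ 2 = 144 * W ^+ 2); last by ring.
  by rewrite ler_wpM2r ?sqr_ge0//; lra.
have uphi x : Omega x -> `|phi x + u x - 2 * y x| <= 2 * Y + 18 * B.
  move=> Ox; have := g12 x Ox; have := f_le x; have := c_le; have := yY Ox.
  rewrite /phi /u !ler_norml => /andP[? ?] /andP[? ?] /andP[? ?] /andP[? ?].
  by apply/andP; split; move: W0 WB; lra.
have bphi : bm phi by exact: bmD.
pose l v x := v x ^+ 2 - 2 * v x * y x.
have bl v : bm v -> bm (l v).
  by move=> bv; apply: bmB; [exact: bm_sqr|apply: bmM => //; exact: bmZ].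
have l_le : \int[mu]_(x in Omega) l phi x <=
    \int[mu]_(x in Omega) l u x + (2 * Y + 18 * B) * eta.
  rewrite -lerBlDl -Rintegral_bmB//; [|exact: bl..].
  apply: (@le_trans _ _ ((2 * Y + 18 * B) * \int[mu]_(x in Omega) `|g x|)).
    have bng : bm (fun x => `|g x|) by exact: bm_norm.
    rewrite -Rintegral_bmZ//; apply: le_Rintegral_bm => //.
    - by apply: bmB => //; exact: bl.
    - exact: bmZ.
    move=> x Ox; have -> : l phi x - l u x = (phi x + u x - 2 * y x) * g x.
      by rewrite /l /phi; ring.
    by rewrite (le_trans (ler_norm _))// normrM ler_wpM2r// uphi.
  by rewrite ler_wpM2l//; move: W0 WB Y0; lra.
rewrite (L_TV_congr y uE) /L_TV.
have LE v : bm v -> (\int[mu]_(x in Omega) (v x ^+ 2 - 2 * v x * y x)%:E =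
    (\int[mu]_(x in Omega) l v x)%:E)%E.
  by move=> bv; rewrite -EFin_Rintegral_bm//; exact: bl.
rewrite !LE// addeAC -EFinD.
have -> : (2 * Y + 18 * B + 1) * (17 * W / tau) = (2 * Y + 18 * B) * eta + eta.
  by rewrite /eta; ring.
rewrite addrA EFinD -addeA [(eta%:E + _)%E]addeC.
by apply: leeD; rewrite ?lee_fin.
Qed.

End approximation.

(** * Near-optimal representations, near-minimizers and the final comparison *)

Lemma barron_representationP (R : realType) (d : nat) (Omega : set 'rV[R]_d)
    (u : 'rV[R]_d -> R) fe ft : barron_representation Omega u fe ft ->
  let A w := complex.Re (ft w) in let C w := complex.Im (ft w) in
  [/\ measurable_fun setT A, measurable_fun setT C,
      (\int[lebesgue_rV R d]_w ((1 + l1norm w) ^+ 2 * amplitude (A w) (C w))%:E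
        = barron_weight ft)%E &
      forall x, Omega x -> u x =
        \int[lebesgue_rV R d]_w (cos (dotrV w x) * A w - sin (dotrV w x) * C w)].
Proof.
move=> [feu [mRe mIm] _ feE] A C; split => //.
  by apply: eq_integral => w _; rewrite /A /C /amplitude; case: (ft w).
move=> x Ox; have := feE x; rewrite feu// /cintegral => -[-> _].
by apply: eq_Rintegral => w _; rewrite /A /C /cexpi; case: (ft w).
Qed.

Lemma barron_norm_lt (R : realType) (d : nat) (Omega : set 'rV[R]_d)
    (u : 'rV[R]_d -> R) (W : R) : barron Omega u -> barron_norm Omega u < W ->
  exists fe ft, barron_representation Omega u fe ft /\ (barron_weight ft <= W%:E)%E.
Proof.
move=> [fe [ft uft]]; rewrite /barron_norm; set S := [set _ | _ in _] => infW.
have w0 (gt : 'rV[R]_d -> R[i]) : (0 <= barron_weight gt)%E.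
  apply: integral_ge0 => w _; rewrite lee_fin mulr_ge0 ?sqr_ge0//.
  by case: (gt w) => a b; exact: sqrtr_ge0.
(* [fine] would send an infinite infimum to 0; membership in the Barron space excludes that. *)
have inf_fin : ereal_inf S \is a fin_num.
  rewrite ge0_fin_numE; last by apply: le_ereal_inf_tmp => _ [gt _ <-].
  apply: (@le_lt_trans _ _ (barron_weight ft)); last by have [] := uft.
  by apply: ereal_inf_lbound; exists ft => //; exists fe.
have : (ereal_inf S < W%:E)%E by rewrite -(fineK inf_fin) lte_fin.
move=> /ereal_inf_lt[_ [gt [ge uge] <-] gtW].
by exists ge, gt; split => //; exact: ltW.
Qed.

Lemma barron_norm_ge0 (R : realType) (d : nat) (Omega : set 'rV[R]_d)
    (u : 'rV[R]_d -> R) : 0 <= barron_norm Omega u.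
Proof.
apply: fine_ge0; apply: le_ereal_inf_tmp => _ [gt _ <-].
apply: integral_ge0 => w _; rewrite lee_fin mulr_ge0 ?sqr_ge0//.
by case: (gt w) => a b; exact: sqrtr_ge0.
Qed.

Lemma delta_minimizer_ge0 (R : realType) (T : Type) (delta : R) (L : T -> R)
    (W : set T) (w : T) : is_delta_minimizer delta L W w -> 0 <= delta.
Proof.
move=> [Ww]; have : (ereal_inf [set (L v)%:E | v in W] <= (L w)%:E)%E.
  by apply: ereal_inf_lbound; exists w.
by case: ereal_inf => [r| |]//; rewrite -?EFinD !lee_fin; lra.
Qed.

Lemma delta_minimizer_le (R : realType) (T : Type) (delta : R) (L : T -> R)
    (W : set T) (w v : T) : is_delta_minimizer delta L W w -> W v ->
  L w <= L v + delta.
Proof.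
move=> [_ Lw] Wv; rewrite -lee_fin EFinD; apply: le_trans Lw _.
by rewrite leeD2r//; apply: ereal_inf_lbound; exists v.
Qed.

Lemma le_of_right_limit (R : realType) (x a b r k : R) : a < b -> 0 <= k ->
  (forall w, a < w < b -> x <= k * w + r) -> x <= k * a + r.
Proof.
move=> ab k0 H; rewrite leNgt; apply/negP => lt_x.
(* The first term keeps [a + e] below [b], the second makes [k * e] smaller than the excess; [k + 1]
   covers [k = 0]. *)
pose e := Num.min ((b - a) / 2) ((x - (k * a + r)) / (2 * (k + 1))).
have e0 : 0 < e by rewrite lt_min !divr_gt0 ?subr_gt0 ?mulr_gt0 ?ltr_wpDl.
have e1 : e <= (b - a) / 2 by rewrite ge_min lexx.
have e2 : e * (2 * (k + 1)) <= x - (k * a + r).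
  by rewrite -ler_pdivlMr ?mulr_gt0 ?ltr_wpDl// ge_min lexx orbT.
have := H (a + e); rewrite ltrDl e0 /= => /(_ _)/wrap[]; first lra.
nra.
Qed.

Theorem theorem6 (R : realType) (d : nat) (Omega : set 'rV[R]_d)
  (y : 'rV[R]_d -> R) (Y B : R) (uhat : 'rV[R]_d -> R)
  (* constants of the quadrature estimate, with their dependencies *)
  (Z1 : R -> nat -> R -> R) (Z2 : R -> nat -> R) (M1 : R -> R -> R)
  (m N : nat) (disp : measure_display) (T : measurableType disp)
  (P : probability T R) (X : 'I_N -> {RV P >-> 'rV[R]_d})
  (delta eps : R) (phihat : T -> 'rV[R]_d -> R) :
  (0 < d)%N -> (0 < m)%N -> (0 < N)%N ->
  bounded_domain Omega ->
  (* normalization of Omega matching |w_k|_1 = 1 and |b_k| <= 1 *)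
  (forall x, Omega x -> forall j, `|x 0 j| <= 1) ->
  measurable_fun Omega y -> 0 < Y -> (forall x, Omega x -> `|y x| <= Y) ->
  is_argmin (L_TV Omega y) (BV Omega) uhat ->
  barron Omega uhat -> 0 < B -> barron_norm Omega uhat < B ->
  quadrature_estimate Omega y B (Z1 B d Y) (Z2 B d) (M1 B Y) ->
  iid_sample Omega X ->
  (forall t, is_delta_minimizer delta (L_TV_emp y (fun i => X i t))
               (softplus_nets d m B) (phihat t)) ->
  0 < eps < 1 ->
  with_prob_ge P (1 - eps) [set t |
    (L_TV Omega y (phihat t) - L_TV Omega y uhat <=
     ((2 * Y + 49 * B + L2norm Omega uhat + 1)
        * (barron_norm Omega uhat / Num.sqrt m%:R) * (24 * ln m%:R + 65)
      + 4 * (Num.sqrt m%:R / Num.sqrt N%:R)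
          * (Z1 B d Y + Z2 B d * Num.sqrt (ln m%:R))
      + 2 * M1 B Y * (Num.sqrt (- 2 * ln eps) / Num.sqrt N%:R)
      + 2 * delta)%:E)%E].
Proof.
move=> d0 m0 N0 [_ oO _ _] Omega1 my Y0 yY [[iu TVfin] _] uhatB B0 normB quad iidX
  deltamin eps01.
have uX0 := iidX.2 (Ordinal N0).
have bmy : bounded_measurable Omega y by split => //; exists Y.
have vol1 := quadrature_volume d0 oO Omega1 bmy B0 uX0 quad.
have mO : measurable Omega by exact: open_rV_measurable.
have muO : (lebesgue_rV R d Omega < +oo)%E by rewrite vol1 ltry.
have [S [mS SE PS]] := quad _ _ P m N X eps m0 N0 iidX eps01.
exists S; split => // t /SE/= sup_le.
set q := quadrature_bound _ _ _ _ _ _ in sup_le.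
have net_le phi : softplus_nets d m B phi ->
    (`|(L_TV_emp y (fun i => X i t) phi)%:E - L_TV Omega y phi| <= q%:E)%E.
  by move=> phiF; apply: le_trans sup_le; apply: ereal_sup_ubound; exists phi.
(* The quadrature bound is a real number, so it also forces the exact energy of each network to be
   finite. *)
have net_fin phi : softplus_nets d m B phi -> exists r : R,
    L_TV Omega y phi = r%:E /\ `|L_TV_emp y (fun i => X i t) phi - r| <= q.
  by move=> /net_le; case: (L_TV Omega y phi) => // r; exists r.
have [FT _] := deltamin t.
have [r [rE r_le]] := net_fin _ FT.
have delta0 := delta_minimizer_ge0 (deltamin t).
pose tau : R := Num.sqrt m%:R.
have tau0 : 0 < tau by rewrite sqrtr_gt0 ltr0n.
(* Finite energy: the total variation is finite by membership in [BV], and a representation of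
   weight at most [B] bounds [uhat] on [Omega] by [B + 2 * B]. *)
have [u0 u0E] : exists u0 : R, L_TV Omega y uhat = u0%:E.
  have [fe [ft [rep weightW]]] := barron_norm_lt uhatB normB.
  have [mA mC wE uE] := barron_representationP rep; rewrite -wE in weightW.
  have bu : bounded_measurable Omega uhat.
    split; first by apply/measurable_EFinP; exact: measurable_int iu.
    exists (3 * B) => x Ox; rewrite uE// (barron_funE d0 mA mC weightW).
    rewrite (le_trans (ler_normD _ _))// [leRHS](_ : _ = B + 2 * B); last by ring.
    by rewrite lerD ?(norm_Rintegral_offset mA mC weightW)//
      (norm_barron_fun d0 mA mC weightW).
  have [v vE] : exists v : R, Defs.total_variation Omega uhat = v%:E.
    exists (fine (Defs.total_variation Omega uhat)).
    by rewrite fineK// ge0_fin_numE// total_variation_ge0.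
  rewrite /L_TV vE EFin_Rintegral_bm//; last first.
    by apply: bmB; [exact: bm_sqr|apply: bmM => //; exact: bmZ].
  by rewrite -EFinD; eexists.
rewrite rE u0E -EFinB lee_fin.
pose K := (2 * Y + 18 * B + 1) * 17 / tau.
have main W : barron_norm Omega uhat < W < B -> r - u0 <= K * W + (2 * q + delta).
  move=> /andP[normW WB].
  have [fe [ft [rep weightW]]] := barron_norm_lt uhatB normW.
  have [mA mC wE uE] := barron_representationP rep; rewrite -wE in weightW.
  have W0 : 0 < W by exact: le_lt_trans (barron_norm_ge0 _ _) normW.
  have [phi phiF] := softplus_net_approximation d0 oO Omega1 vol1 m0 W0 WB Y0 my yY
    mA mC weightW uE.
  have [s [sE s_le]] := net_fin _ phiF.
  rewrite sE u0E -EFinD lee_fin => s_u0.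
  (* Each of the two passages between exact and empirical energy costs [q]; passing from [phihat t]
     to [phi] costs [delta]. *)
  have := delta_minimizer_le (deltamin t) phiF.
  have -> : K * W = (2 * Y + 18 * B + 1) * (17 * W / tau) by rewrite /K; ring.
  move: r_le s_le s_u0; rewrite !ler_norml -/tau.
  by move=> /andP[? ?] /andP[? ?] ? ?; lra.
have K0 : 0 <= K.
  by rewrite /K !mulr_ge0 ?invr_ge0 ?(ltW tau0)//; lra.
(* Now [W] tends to the Barron norm. There remain [17 * (2 Y + 18 B + 1) <= 65 * (2 Y + 49 B + n2 +
   1)], the logarithm being nonnegative, and [delta <= 2 * delta], from [delta0]. *)
have := le_of_right_limit normB K0 main; move/le_trans; apply.
have b0 := barron_norm_ge0 Omega uhat.
have l0 : 0 <= ln m%:R :> R by rewrite ln_ge0// ler1n.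
have n0 : 0 <= L2norm Omega uhat by exact: sqrtr_ge0.
rewrite /q /quadrature_bound -/tau.
set n := barron_norm _ _ in b0 *; set l := ln m%:R in l0 *.
set n2 := L2norm _ _ in n0 *.
have h1 : K * n <= (2 * Y + 49 * B + n2 + 1) * (n / tau) * (24 * l + 65).
  have nt : 0 <= n / tau by rewrite divr_ge0// ltW.
  rewrite (_ : K * n = (2 * Y + 18 * B + 1) * 17 * (n / tau)); last by rewrite /K; ring.
  rewrite [leRHS](_ : _ = (2 * Y + 49 * B + n2 + 1) * (24 * l + 65) * (n / tau)).
    apply: ler_wpM2r => //.
    by apply: ler_pM; lra.
  by ring.
have := h1; set a := K * n; set b := (_ * _ * _); lra.
Qed.
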